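(* Let $M>0$. Then there exists a positive integer $P_1$, depending only on $M$, such that, for any $q\in B(0,M)$ and $n>P_1$, there hold $$\sup_{x\in[0,\pi]}\left|\phi_n(x;q)-\sqrt{\tfrac{2}{\pi}}\,\sin(nx)\right|\le C\,\frac{\ln n}{n^{2m-1}},$$ $$\sup_{x\in[0,\pi]}\left|\psi_n(x;q)-\sqrt{\tfrac{2}{\pi}}\,\sin\left(\left(n-\tfrac12\right)x\right)\right|\le C\,\frac{\ln n}{n^{2m-1}},$$ where $C$ is a positive constant depending only on $M$.
   Context: Fix an integer $m\ge 1$. $L^2(0,\pi)$ is the class of square-integrable complex-valued functions on $(0,\pi)$, and $B(0,M)$ denotes the ball of radius $M$ about $0$ in $L^2(0,\pi)$. For $q\in L^2(0,\pi)$, consider the differential equation $(-1)^m y^{(2m)}(x)+q(x)y(x)=\lambda y(x)$, $x\in(0,\pi)$, where $\lambda$ is the spectral parameter. $L_1(q)$ denotes the operator generated by this equation with the Dirichlet boundary conditions $y^{(2i)}(0)=y^{(2i)}(\pi)=0$, $0\le i\le m-1$, and $L_2(q)$ denotes the operator generated by this equation with the Dirichlet-Neumann boundary conditions $y^{(2i)}(0)=y^{(2i+1)}(\pi)=0$, $0\le i\le m-1$. $\{\lambda_n(q)\}_{n\ge1}$ and $\{\mu_n(q)\}_{n\ge1}$ are the spectra of $L_1(q)$ and $L_2(q)$, respectively. For $n\ge1$, $\phi_n(x;q)$ and $\psi_n(x;q)$ denote the normalized eigenfunctions corresponding to the eigenvalues $\lambda_n(q)$ and $\mu_n(q)$ of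 $L_1(q)$ and $L_2(q)$, respectively. For zero potential, $\lambda_n(0)=n^{2m}$, $\mu_n(0)=\left(n-\tfrac12\right)^{2m}$, $\phi_n(x;0)=\sqrt{\tfrac{2}{\pi}}\sin(nx)$ and $\psi_n(x;0)=\sqrt{\tfrac{2}{\pi}}\sin\left(\left(n-\tfrac12\right)x\right)$. *)

(* Defs.v *)
From mathcomp Require Export all_boot all_order all_algebra.
From mathcomp Require Export complex.
From mathcomp Require Export all_classical all_reals all_analysis.
Export Order.TTheory GRing.Theory Num.Theory.
Export numFieldNormedType.Exports.

Set Implicit Arguments.
Unset Strict Implicit.
Unset Printing Implicit Defensive.

Local Open Scope classical_set_scope.
Local Open Scope card_scope.
Local Open Scope ring_scope.

(* Functions on [0, pi] or (0, pi) are represented by total functions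
   R -> R[i]; every notion below only depends on their values there. *)
Section Operators.
Variable R : realType.
Implicit Types (y f g q : R -> R[i]) (D : set R) (z : R[i]).

Definition cmodulus z : R := ComplexField.Normc.normc z.

Definition cmeasurable D f : Prop :=
  measurable_fun D (fun x => complex.Re (f x)) /\
  measurable_fun D (fun x => complex.Im (f x)).

Definition cintegrable D f : Prop :=
  lebesgue_measure.-integrable D (fun x => (complex.Re (f x))%:E) /\
  lebesgue_measure.-integrable D (fun x => (complex.Im (f x))%:E).

Definition cintegral D f : R[i] :=
  Complex (Rintegral lebesgue_measure D (fun x => complex.Re (f x)))
          (Rintegral lebesgue_measure D (fun x => complex.Im (f x))).

Definition L2norm f : \bar R :=
  'N[lebesgue_measure]_(2%:E)[(fun x => (cmodulus (f x))%:E) \_ `]0, pi[].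

Definition inL2 f : Prop := cmeasurable `]0, pi[ f /\ (L2norm f < +oo)%E.

(* The ball is closed; as the radius is arbitrary in its uses, the open ball
   would give an equivalent statement. *)
Definition L2ball (M : R) : set (R -> R[i]) :=
  [set f | inL2 f /\ (L2norm f <= M%:E)%E].

Definition L2inner f g : R[i] :=
  cintegral `]0, pi[ (fun x => f x * (g x)^*%C).

(* Y 0, ..., Y k.-1 are absolutely continuous on [0, pi] and Y j.+1 is the
   derivative of Y j: everywhere if j.+1 < k, almost everywhere if j.+1 = k. *)
Definition ac_derivatives (k : nat) (Y : nat -> R -> R[i]) : Prop :=
  forall j, (j < k)%N ->
    cintegrable `[0, pi] (Y j.+1) /\
    forall x, x \in `[0, pi] -> Y j x = Y j 0 + cintegral `[0, x] (Y j.+1).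

Definition dirichlet (m : nat) (Y : nat -> R -> R[i]) : Prop :=
  forall i, (i < m)%N -> Y (2 * i)%N 0 = 0 /\ Y (2 * i)%N pi = 0.

Definition dirichlet_neumann (m : nat) (Y : nat -> R -> R[i]) : Prop :=
  forall i, (i < m)%N -> Y (2 * i)%N 0 = 0 /\ Y (2 * i + 1)%N pi = 0.

(* Graph of the operator y |-> (-1)^m y^(2m) + q y in L^2(0, pi): its domain is
   the set of y such that y, ..., y^(2m-1) are absolutely continuous on
   [0, pi], satisfy the boundary conditions bc, and the image f of y is in
   L^2(0, pi). *)
Definition operator_graph (bc : (nat -> R -> R[i]) -> Prop) (m : nat) q y f :
    Prop :=
  inL2 f /\
  exists Y : nat -> R -> R[i],
    [/\ forall x, x \in `[0, pi] -> Y 0%N x = y x,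
        ac_derivatives (2 * m) Y,
        bc Y &
        {ae lebesgue_measure, forall x, x \in `]0, pi[ ->
          (-1) ^+ m * Y (2 * m)%N x + q x * y x = f x}].

Definition L1 (m : nat) q := operator_graph (dirichlet m) m q.
Definition L2 (m : nat) q := operator_graph (dirichlet_neumann m) m q.

Section Spectrum.
Variable L : (R -> R[i]) -> (R -> R[i]) -> Prop.

(* y is in the domain of L^k and (L - z)^k y = 0 *)
Fixpoint ker_pow z (k : nat) y : Prop :=
  if k is k'.+1 then
    exists f, L y (fun x => z * y x + f x) /\ ker_pow z k' f
  else forall x, x \in `[0, pi] -> y x = 0.

Definition root_subspace z : set (R -> R[i]) :=
  [set y | exists k, ker_pow z k y].

(* dimension of a space of functions on [0, pi] *)
Definition has_dim (V : set (R -> R[i])) (d : nat) : Prop :=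
  exists e : 'I_d -> R -> R[i],
    [/\ forall i, V (e i),
        forall c : 'I_d -> R[i],
          (forall x, x \in `[0, pi] -> \sum_(i < d) c i * e i x = 0) ->
          forall i, c i = 0 &
        forall y, V y -> exists c : 'I_d -> R[i],
          forall x, x \in `[0, pi] -> y x = \sum_(i < d) c i * e i x].

(* lam 1, lam 2, ... are the eigenvalues of L, each repeated according to its
   algebraic multiplicity, numbered by nondecreasing real part (the usual
   increasing order when q is real); lam 0 is irrelevant. *)
Definition is_spectrum (lam : nat -> R[i]) : Prop :=
  (forall i j, (1 <= i <= j)%N -> complex.Re (lam i) <= complex.Re (lam j)) /\
  (forall z, exists d, has_dim (root_subspace z) d /\
     [set n | (1 <= n)%N /\ lam n = z] #= `I_d).

(* The norm determines the eigenfunction only up to a unimodular constant. As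
   for the normalized eigenfunctions g of the zero potential, this constant is
   fixed by a sign convention: the inner product with g is a nonnegative real
   (which is what 0 <= w means for w : R[i]). *)
Definition normalized_eigenfunction z g y : Prop :=
  [/\ L y (fun x => z * y x), L2norm y = 1%E & 0 <= L2inner y g].

End Spectrum.

Definition phi0 (n : nat) (x : R) : R := Num.sqrt (2 / pi) * sin (n%:R * x).
Definition psi0 (n : nat) (x : R) : R :=
  Num.sqrt (2 / pi) * sin ((n%:R - 2^-1) * x).

Definition toC (f : R -> R) : R -> R[i] := fun x => (f x)%:C%C.

Definition sup_dist f g : \bar R :=
  ereal_sup [set (cmodulus (f x - g x))%:E | x in `[0, pi]].

End Operators.

(* Main.v *)
Require Import Defs.
From mathcomp Require Import ring lra zify finmap measurable_realfun.

(** Expanding functions on (0, pi) in the modes s_j(x) = sin((j + 1 - theta) x),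
    j >= 0, with theta = 0 for Dirichlet and theta = 1/2 for Dirichlet-Neumann
    conditions, turns (-1)^m d^(2m)/dx^(2m) into the diagonal operator with entries
    a_j = (j + 1 - theta)^(2m), and y |-> q y into an operator Q on absolutely
    summable coefficient sequences. The estimates rest on the linearity of Q and on
    the bound |(Q c)_j| <= kappa |c|_1 for all j, with kappa depending only on M
    ([potential_coef_bound]). The dictionary between the differential operator and
    diag(a) + Q is given by [op_coef] and [op_of_seq]; it rests on integration by
    parts for absolutely continuous functions and on completeness of the modes.

    Let T_n be the 2m-th power of the midpoint between two consecutive frequencies.
    The sums of 1/|a_j - T_n| over j below and above the gap are both
    O(ln n / n^(2m-1)): dividing out the power n^(2m-2) leaves the sum of
    1/(|n - j| max(n, j)), which telescopes to a harmonic number divided by n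
    ([gap_sum_below], [gap_sum_above]). Once kappa times these sums is small, two
    things follow.

    First, the eigenvalues are located. A Riccati equation for an operator K from
    the span of the first n modes to its complement is solved by iterating a
    contraction; the graph of K is invariant under diag(a) + Q, it contains every
    root vector with Re z < T_n, and the spectrum of the restriction to the graph
    lies in that half-plane. Hence exactly n eigenvalues, counted with algebraic
    multiplicity, satisfy Re z < T_n ([spectrum_count]). Applying this to n - 1 and
    n gives T_(n-1) <= Re lambda_n < T_n, for complex q as well as for real q.

    Secondly, the eigenfunctions are close to the free ones. The coefficients of an
    eigenfunction for lambda_n satisfy c_j = (Q c)_j / (lambda_n - a_j), so the sum
    of |c_j| over all j except that of the n-th mode is at most
    kappa |c|_1 O(ln n / n^(2m-1)). This bounds the distance in the supremum norm
    to a multiple of the free eigenfunction, and the normalization together with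
    the sign convention determines the multiple up to an error of the same order
    ([eigenfunction_bound]). *)

Set Implicit Arguments.
Unset Strict Implicit.
Unset Printing Implicit Defensive.

Local Open Scope classical_set_scope.
Local Open Scope card_scope.
Local Open Scope ring_scope.

(** * Modulus, limits and absolute sums of complex numbers *)

Section Modulus.
Variable R : realType.
Implicit Types z w : R[i].
Local Notation cm := (@cmodulus R).

Lemma cm_ge0 z : 0 <= cm z.
Proof. by case: z => a b; rewrite /cmodulus /= sqrtr_ge0. Qed.
Lemma cm0 : cm 0 = 0. Proof. exact: ComplexField.Normc.normc0. Qed.
Lemma cm1 : cm 1 = 1. Proof. exact: ComplexField.Normc.normc1. Qed.
Lemma cmM z w : cm (z * w) = cm z * cm w.
Proof. exact: ComplexField.Normc.normcM. Qed.
Lemma cmD z w : cm (z + w) <= cm z + cm w.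
Proof. exact: le_normcD. Qed.
Lemma cmN z : cm (- z) = cm z.
Proof. exact: normcN. Qed.
Lemma cmV z : cm z^-1 = (cm z)^-1.
Proof. exact: ComplexField.Normc.normcV. Qed.
Lemma cm_eq0 z : cm z = 0 -> z = 0.
Proof. exact: ComplexField.Normc.eq0_normc. Qed.
Lemma cmB z w : cm (z - w) <= cm z + cm w.
Proof. by rewrite -(cmN w) cmD. Qed.
Lemma cm_real (x : R) : cm x%:C%C = `|x|.
Proof. by rewrite /cmodulus /= expr0n /= addr0 sqrtr_sqr. Qed.
Lemma cm_Re z : `|complex.Re z| <= cm z.
Proof.
by case: z => a b; rewrite /cmodulus /= -sqrtr_sqr ler_wsqrtr // lerDl sqr_ge0.
Qed.
Lemma cm_Im z : `|complex.Im z| <= cm z.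
Proof.
by case: z => a b; rewrite /cmodulus /= -sqrtr_sqr ler_wsqrtr // lerDr sqr_ge0.
Qed.
Lemma cm_le z : cm z <= `|complex.Re z| + `|complex.Im z|.
Proof.
case: z => a b /=; rewrite /cmodulus /= -[leRHS]ger0_norm ?addr_ge0 //.
rewrite -sqrtr_sqr ler_wsqrtr // sqrrD !real_normK ?num_real //.
by have := mulr_ge0 (normr_ge0 a) (normr_ge0 b); lra.
Qed.
Lemma cm_sqr z : cm z ^+ 2 = complex.Re z ^+ 2 + complex.Im z ^+ 2.
Proof. by case: z => a b; rewrite /cmodulus /= sqr_sqrtr // addr_ge0 ?sqr_ge0. Qed.
Lemma cm_sum (I : Type) (r : seq I) (P : pred I) (F : I -> R[i]) :
  cm (\sum_(i <- r | P i) F i) <= \sum_(i <- r | P i) cm (F i).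
Proof.
elim/big_rec2: _ => [|i x y _ h]; first by rewrite cm0.
by apply: (le_trans (cmD _ _)); rewrite lerD2l.
Qed.
Lemma ReD z w : complex.Re (z + w) = complex.Re z + complex.Re w.
Proof. by case: z; case: w. Qed.
Lemma ImD z w : complex.Im (z + w) = complex.Im z + complex.Im w.
Proof. by case: z; case: w. Qed.
Lemma ReN z : complex.Re (- z) = - complex.Re z.
Proof. by case: z. Qed.
Lemma ImN z : complex.Im (- z) = - complex.Im z.
Proof. by case: z. Qed.
Lemma ReM z w : complex.Re (z * w) =
  complex.Re z * complex.Re w - complex.Im z * complex.Im w.
Proof. by case: z; case: w. Qed.
Lemma ImM z w : complex.Im (z * w) =
  complex.Re z * complex.Im w + complex.Im z * complex.Re w.
Proof. by case: z; case: w. Qed.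
Lemma eq_complex_parts z w : complex.Re z = complex.Re w -> complex.Im z = complex.Im w ->
  z = w.
Proof. by case: z; case: w => a b c d /= -> ->. Qed.
Lemma Re_sum (I : Type) (r : seq I) (P : pred I) (F : I -> R[i]) :
  complex.Re (\sum_(i <- r | P i) F i) = \sum_(i <- r | P i) complex.Re (F i).
Proof. by elim/big_rec2: _ => [//|i x y _ <-]; rewrite ReD. Qed.
Lemma Im_sum (I : Type) (r : seq I) (P : pred I) (F : I -> R[i]) :
  complex.Im (\sum_(i <- r | P i) F i) = \sum_(i <- r | P i) complex.Im (F i).
Proof. by elim/big_rec2: _ => [//|i x y _ <-]; rewrite ImD. Qed.

End Modulus.

(* Otherwise simplification replaces the modulus by a square root. *)
Opaque cmodulus.

Section AbsoluteSums.
Variable R : realType.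
Implicit Types z w : R[i].
Local Notation cm := (@cmodulus R).

Lemma le_eps (x y : R) : (forall e, 0 < e -> x <= e + y) -> x <= y.
Proof. by move=> h; apply/ler_addgt0Pl. Qed.

Lemma cm_eq_small z : (forall e, 0 < e -> cm z <= e) -> z = 0.
Proof.
move=> h; apply: cm_eq0; apply/eqP; rewrite eq_le cm_ge0 andbT.
by apply: le_eps => e e0; rewrite addr0 h.
Qed.

Definition clim (u : nat -> R[i]) : R[i] :=
  Complex (limn (fun n => complex.Re (u n))) (limn (fun n => complex.Im (u n))).

Lemma real_cauchy_lim (v : nat -> R) (d : nat -> R) :
  (forall i j, (i <= j)%N -> `|v j - v i| <= d i) -> d @ \oo --> (0 : R) ->
  forall i, `|limn v - v i| <= d i.
Proof.
move=> h d0 i.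
have cv : cvgn v.
  apply/cauchy_cvgP/cauchy_exP => e e0.
  have /cvgrPdist_lt /(_ _ e0) [N _ hN] := d0.
  exists (v N); exists N => // j /= Nj.
  rewrite /ball /= distrC; apply: (le_lt_trans (h _ _ Nj)).
  have := hN N (leqnn N); rewrite sub0r normrN.
  exact: le_lt_trans (ler_norm _).
rewrite ler_distl; apply/andP; split.
  apply: limr_ge => //; exists i => // j /= ij.
  by have := h _ _ ij; rewrite ler_distl => /andP[].
apply: limr_le => //; exists i => // j /= ij.
by have := h _ _ ij; rewrite ler_distl => /andP[].
Qed.

(** A Cauchy estimate passes to the limit, at the price of a factor 2 because
    the real and imaginary parts are treated separately. *)
Lemma clim_dist (u : nat -> R[i]) (d : nat -> R) :
  (forall i j, (i <= j)%N -> cm (u j - u i) <= d i) -> d @ \oo --> (0 : R) ->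
  forall i, cm (clim u - u i) <= 2 * d i.
Proof.
move=> h d0 i; apply: (le_trans (cm_le _)); rewrite mulr2n mulrDl mul1r.
apply: lerD.
  rewrite ReD ReN /=; apply: real_cauchy_lim d0 i => a b ab.
  by apply: le_trans (h _ _ ab); rewrite -ReN -ReD cm_Re.
rewrite ImD ImN /=; apply: real_cauchy_lim d0 i => a b ab.
by apply: le_trans (h _ _ ab); rewrite -ImN -ImD cm_Im.
Qed.

(** Bounding all partial sums keeps the sum of moduli out of the extended reals,
    and the bound itself is what the estimates below propagate. *)
Definition l1bound (c : nat -> R[i]) (S : R) :=
  forall N, \sum_(i < N) cm (c i) <= S.
Definition l1 c := exists S, l1bound c S.

Lemma l1bound_ge0 c S : l1bound c S -> 0 <= S.
Proof. by move=> /(_ 0%N); rewrite big_ord0. Qed.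
Lemma l1bound_le c S S' : l1bound c S -> S <= S' -> l1bound c S'.
Proof. by move=> h SS N; apply: le_trans SS. Qed.
Lemma l1bound_cm c S j : l1bound c S -> cm (c j) <= S.
Proof.
move=> /(_ j.+1); rewrite big_ord_recr /=; apply: le_trans.
by rewrite lerDr sumr_ge0 // => i _; exact: cm_ge0.
Qed.
Lemma l1bound_mono c c' S : (forall i, cm (c i) <= cm (c' i)) ->
  l1bound c' S -> l1bound c S.
Proof. by move=> h h' N; apply: le_trans (h' N); apply: ler_sum => i _. Qed.
Lemma l1boundD c d S T : l1bound c S -> l1bound d T ->
  l1bound (fun i => c i + d i) (S + T).
Proof.
move=> hc hd N; apply: (le_trans _ (lerD (hc N) (hd N))).
by rewrite -big_split; apply: ler_sum => i _; exact: cmD.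
Qed.
Lemma l1boundZ z c S : l1bound c S -> l1bound (fun i => z * c i) (cm z * S).
Proof.
move=> hc N; under eq_bigr do rewrite cmM.
by rewrite -mulr_sumr ler_wpM2l // cm_ge0.
Qed.
Lemma l1D c d : l1 c -> l1 d -> l1 (fun i => c i + d i).
Proof. by move=> [S hS] [T hT]; exists (S + T); exact: l1boundD. Qed.
Lemma l1Z z c : l1 c -> l1 (fun i => z * c i).
Proof. by move=> [S hS]; exists (cm z * S); exact: l1boundZ. Qed.
Lemma l1B c d : l1 c -> l1 d -> l1 (fun i => c i - d i).
Proof.
move=> hc hd; have := l1D hc (l1Z (-1) hd).
by under eq_fun do rewrite mulN1r.
Qed.

Lemma l1_tail c : l1 c -> exists d : nat -> R, (d @ \oo --> (0 : R)) /\
  (forall N M, (N <= M)%N -> \sum_(N <= i < M) cm (c i) <= d N).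
Proof.
move=> [S hS]; pose s N := \sum_(0 <= i < N) cm (c i).
have sS N : s N <= S by rewrite /s big_mkord.
have snd : nondecreasing_seq s.
  apply/nondecreasing_seqP => N; rewrite /s big_nat_recr //= lerDl.
  exact: cm_ge0.
have cv : cvgn s.
  by apply: nondecreasing_is_cvgn => //; exists S => _ [N _ <-].
exists (fun N => limn s - s N); split.
  by rewrite -(subrr (limn s)); apply: cvgB => //; apply: cvg_cst.
move=> N M NM; rewrite lerBrDr addrC -big_cat_nat //=.
exact: nondecreasing_cvgn_le snd cv M.
Qed.

Definition csum (c : nat -> R[i]) := clim (fun N => \sum_(i < N) c i).

(** The error of a partial sum is controlled uniformly over all weights b of
    modulus at most 1. With b j the value of the j-th sine at x, this gives
    uniform convergence of sine series. *)
Lemma csum_dist (c b : nat -> R[i]) (d : nat -> R) :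
  d @ \oo --> (0 : R) ->
  (forall N M, (N <= M)%N -> \sum_(N <= i < M) cm (c i) <= d N) ->
  (forall j, cm (b j) <= 1) ->
  forall N, cm (csum (fun j => c j * b j) - \sum_(i < N) c i * b i) <= 2 * d N.
Proof.
move=> d0 h hb; apply: clim_dist => // N M NM.
rewrite -!(big_mkord xpredT (fun i => c i * b i)).
rewrite (big_cat_nat (leq0n N) NM) //= addrAC subrr add0r; apply: (le_trans (cm_sum _ _ _)).
apply: le_trans (h _ _ NM); apply: ler_sum => i _; rewrite cmM.
by rewrite ler_piMr // cm_ge0.
Qed.

Lemma csum_bound c b S : l1bound c S -> (forall j, cm (b j) <= 1) ->
  cm (csum (fun j => c j * b j)) <= S.
Proof.
move=> hS hb; have [d [d0 hd]] := l1_tail (ex_intro _ S hS).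
have h := csum_dist d0 hd hb.
apply: le_eps => e e0.
have /cvgrPdist_lt /(_ (e / 2)) := d0.
rewrite divr_gt0 // => /(_ isT) [N _ /(_ N (leqnn N))] /=.
rewrite sub0r normrN => /(le_lt_trans (ler_norm _)) dN.
have -> : csum (fun j => c j * b j) =
  (csum (fun j => c j * b j) - \sum_(i < N) c i * b i) + \sum_(i < N) c i * b i.
  by rewrite subrK.
apply: (le_trans (cmD _ _)); apply: lerD.
  by apply: (le_trans (h N)); lra.
apply: (le_trans (cm_sum _ _ _)); apply: le_trans (hS N).
by apply: ler_sum => i _; rewrite cmM ler_piMr // cm_ge0.
Qed.

Lemma csum_lin z c c' b : l1 c -> l1 c' -> (forall j, cm (b j) <= 1) ->
  csum (fun j => (z * c j + c' j) * b j) =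
  z * csum (fun j => c j * b j) + csum (fun j => c' j * b j).
Proof.
move=> hc hc' hb; apply/eqP; rewrite -subr_eq0; apply/eqP.
have [d [d0 hd]] := l1_tail hc.
have [d' [d'0 hd']] := l1_tail hc'.
have [d'' [d''0 hd'']] := l1_tail (l1D (l1Z z hc) hc').
have H : (fun N => 2 * d'' N + cm z * (2 * d N) + 2 * d' N) @ \oo --> (0 : R).
  rewrite -[X in _ --> X](_ : 2 * 0 + cm z * (2 * 0) + 2 * 0 = 0 :> R).
    by do 2?[apply: cvgD]; repeat (apply: cvgMr => //).
  by rewrite !mulr0 !addr0.
apply: cm_eq_small => e e0.
have /cvgrPdist_lt /(_ e e0) [N _ /(_ N (leqnn N))] := H.
rewrite /= sub0r normrN => /(le_lt_trans (ler_norm _)) dN.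
apply: le_trans (ltW dN).
have E : \sum_(i < N) (z * c i + c' i) * b i =
  z * (\sum_(i < N) c i * b i) + \sum_(i < N) c' i * b i.
  by rewrite mulr_sumr -big_split; apply: eq_bigr => i _; rewrite mulrDl mulrA.
have -> : csum (fun j => (z * c j + c' j) * b j) -
    (z * csum (fun j => c j * b j) + csum (fun j => c' j * b j)) =
  (csum (fun j => (z * c j + c' j) * b j) - \sum_(i < N) (z * c i + c' i) * b i)
  - z * (csum (fun j => c j * b j) - \sum_(i < N) c i * b i)
  - (csum (fun j => c' j * b j) - \sum_(i < N) c' i * b i).
  by rewrite E; ring.
apply: (le_trans (cmB _ _)); apply: lerD; last exact: csum_dist d'0 hd' hb N.
apply: (le_trans (cmB _ _)); apply: lerD; first exact: csum_dist d''0 hd'' hb N.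
by rewrite cmM ler_wpM2l ?cm_ge0 //; exact: csum_dist d0 hd hb N.
Qed.

End AbsoluteSums.

(** * Sums of reciprocal distances to the free spectrum *)

Section GapSums.
Variables (R : realType) (th : R) (p : nat).
Hypotheses (th0 : 0 <= th) (th1 : th <= 2^-1).

Ltac lra_theta := move: th0 th1 => ? ?; lra.

(** The free eigenvalues are the powers of these frequencies: th = 0 for
    Dirichlet and th = 1/2 for Dirichlet-Neumann conditions, with indices
    starting at 0. *)
Definition freq (j : nat) : R := j.+1%:R - th.
(** The midpoint between the frequencies of index n-1 and n. *)
Definition gapfreq (n : nat) : R := n%:R + 2^-1 - th.
Definition harm (n : nat) : R := \sum_(i < n) i.+1%:R^-1.

Lemma natS (j : nat) : j.+1%:R = j%:R + 1 :> R.
Proof. by rewrite natr1. Qed.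

Lemma freq_ge j : j%:R + 2^-1 <= freq j.
Proof. rewrite /freq (natS j). lra_theta. Qed.
Lemma freq_gt0 j : 0 < freq j.
Proof. by apply: lt_le_trans (freq_ge j); rewrite ltr_wpDl. Qed.

(** Because x y^k dominates x^(k+1), powers spread apart at least like y^k. *)
Lemma expr_gap (x y : R) k : 0 <= x -> x <= y ->
  (y - x) * y ^+ k <= y ^+ k.+1 - x ^+ k.+1.
Proof.
move=> x0 xy; rewrite mulrBl -exprS lerD2l lerN2 exprS.
by rewrite ler_wpM2l // lerXn2r // nnegrE (le_trans x0).
Qed.

Lemma ler_exp (x y : R) k : 0 <= x -> x <= y -> x ^+ k <= y ^+ k.
Proof. by move=> x0 xy; rewrite lerXn2r // nnegrE (le_trans x0). Qed.

Lemma ler_inv (x y : R) : 0 < x -> x <= y -> y^-1 <= x^-1.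
Proof. by move=> x0 xy; rewrite lef_pV2 // posrE // (lt_le_trans x0). Qed.

Lemma gap_below n j : (j < n)%N ->
  (n - j)%:R / 2 * n%:R ^+ p.+1 <= gapfreq n ^+ p.+2 - freq j ^+ p.+2.
Proof.
move=> jn; have hj := freq_gt0 j.
have d : (n - j)%:R / 2 <= gapfreq n - freq j.
  have : (1 : R) <= (n - j)%:R by rewrite ler1n subn_gt0.
  by rewrite /gapfreq /freq natrB ?(ltnW jn) // (natS j); lra_theta.
have n0 : (0 : R) <= (n - j)%:R by [].
apply: (le_trans _ (expr_gap _ (ltW hj) _)); last by lra_theta.
have h : n%:R <= gapfreq n by rewrite /gapfreq; lra_theta.
apply: ler_pM; rewrite ?divr_ge0 ?exprn_ge0 //.
exact: ler_exp.
Qed.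

(** One of the powers of the frequency is kept as j+1 and only the others are
    lowered to n. The product (j-n+1)(j+1) makes the reciprocals summable
    over j, by telescoping. *)
Lemma gap_above n j : (0 < n)%N -> (n <= j)%N ->
  (j - n).+1%:R * j.+1%:R / 4 * n%:R ^+ p <= freq j ^+ p.+2 - gapfreq n ^+ p.+2.
Proof.
move=> n0 nj; have hj := freq_ge j.
have d : (j - n).+1%:R / 2 <= freq j - gapfreq n.
  have : (0 : R) <= (j - n)%:R by [].
  by rewrite /gapfreq /freq (natS j) (natS (j - n)) natrB //; lra_theta.
have d0 : (0 : R) <= (j - n).+1%:R by [].
have g0 : 0 <= gapfreq n.
  by rewrite /gapfreq; have : (0 : R) <= n%:R by []; lra_theta.
apply: (le_trans _ (expr_gap _ g0 _)); last by lra_theta.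
have h : n%:R <= freq j.
  have : n%:R <= j%:R :> R by rewrite ler_nat.
  by move=> hn; apply: le_trans hj; lra_theta.
rewrite (_ : _ / 4 = ((j - n).+1%:R / 2) * (j.+1%:R / 2)); last by field.
rewrite -mulrA; apply: ler_pM; rewrite ?mulr_ge0 ?divr_ge0 ?exprn_ge0 //.
rewrite exprS; apply: ler_pM; rewrite ?divr_ge0 ?exprn_ge0 //.
- by apply: le_trans hj; rewrite (natS j); have : (0 : R) <= j%:R by []; lra_theta.
- exact: ler_exp.
Qed.

Lemma harm_ge0 n : 0 <= harm n.
Proof. by apply: sumr_ge0 => i _; rewrite invr_ge0. Qed.

Lemma harmS n : harm n.+1 = harm n + n.+1%:R^-1.
Proof. by rewrite /harm big_ord_recr. Qed.

Lemma harm_mono n k : (n <= k)%N -> harm n <= harm k.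
Proof.
move/subnKC <-; elim: (k - n)%N => [|d IH]; first by rewrite addn0.
by rewrite addnS harmS (le_trans IH) // lerDl invr_ge0.
Qed.

Lemma gap_sum_below n : (0 < n)%N ->
  \sum_(j < n) (gapfreq n ^+ p.+2 - freq j ^+ p.+2)^-1 <= 4 * (harm n / n%:R ^+ p.+1).
Proof.
move=> n0.
have np : 0 < n%:R ^+ p.+1 :> R by rewrite exprn_gt0 // ltr0n.
have -> : harm n = \sum_(j < n) (n - j)%:R^-1.
  rewrite /harm (reindex_inj rev_ord_inj) /=; apply: eq_bigr => i _.
  by congr (_%:R^-1); have := ltn_ord i; lia.
rewrite mulr_suml mulr_sumr; apply: ler_sum => j _.
have d0 : (0 : R) < (n - j)%:R by rewrite ltr0n subn_gt0.
apply: (@le_trans _ _ ((n - j)%:R / 2 * n%:R ^+ p.+1)^-1).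
  by apply: ler_inv (gap_below _) => //; rewrite ?mulr_gt0 ?divr_gt0.
rewrite !invfM invrK mulrA; apply: ler_wpM2r; first by rewrite invr_ge0 ltW.
rewrite mulrC; apply: ler_wpM2r; first by rewrite invr_ge0 ltW.
by rewrite ler_nat.
Qed.

(** The sum of 1/((j-n+1)(j+1)) over j >= n is, up to the factor 1/n, this
    telescoping sum; the harmonic number of n bounds it uniformly in N. *)
Lemma harm_telescope n N : (n <= N)%N ->
  \sum_(n <= j < N) ((j - n).+1%:R^-1 - j.+1%:R^-1 : R) =
  harm (N - n) - (harm N - harm n).
Proof.
move/subnKC <-; elim: (N - n)%N => [|d IH].
  by rewrite addn0 big_geq // subnn /harm big_ord0; lra.
rewrite addnS big_nat_recr ?leq_addr //= IH !addKn -addnS addKn !harmS addnS harmS.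
by move: (_.+1%:R^-1) ((n + d).+1%:R^-1) (harm _) => *; ring.
Qed.

Lemma gap_sum_above n N : (0 < n)%N ->
  \sum_(n <= j < N) (freq j ^+ p.+2 - gapfreq n ^+ p.+2)^-1
    <= 4 * (harm n / n%:R ^+ p.+1).
Proof.
move=> n0.
have np : 0 < n%:R ^+ p :> R by rewrite exprn_gt0 // ltr0n.
have n0R : (0 : R) < n%:R by rewrite ltr0n.
have [Nn|nN] := leqP N n.
  by rewrite big_geq // mulr_ge0 // divr_ge0 ?harm_ge0 // exprn_ge0.
apply: (@le_trans _ _ (4 / n%:R ^+ p.+1 *
    \sum_(n <= j < N) ((j - n).+1%:R^-1 - j.+1%:R^-1))).
  rewrite mulr_sumr !big_nat; apply: ler_sum => j /andP[nj _].
  have h0 : (0 : R) < (j - n).+1%:R * j.+1%:R / 4 * n%:R ^+ p.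
    by rewrite !mulr_gt0 // invr_gt0.
  apply: (@le_trans _ _ ((j - n).+1%:R * j.+1%:R / 4 * n%:R ^+ p)^-1).
    exact: ler_inv (gap_above _ _).
  rewrite le_eqVlt; apply/orP; left; apply/eqP.
  have E : j.+1%:R = (j - n).+1%:R + n%:R :> R.
    by rewrite -natrD; congr (_%:R); lia.
  have : (j - n).+1%:R != 0 :> R by rewrite pnatr_eq0.
  have : j.+1%:R != 0 :> R by rewrite pnatr_eq0.
  have : n%:R != 0 :> R by rewrite gt_eqF.
  have : n%:R ^+ p != 0 :> R by rewrite gt_eqF.
  rewrite E exprS; move: (n%:R ^+ p) (_.+1%:R : R) => P Q h1 h2 h3 h4.
  by field; do ?[apply/andP; split].
rewrite [leRHS]mulrCA [leRHS]mulrC ler_wpM2l ?divr_ge0 ?exprn_ge0 //.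
rewrite harm_telescope ?(ltnW nN) //.
have := harm_mono (leq_subr n N); lra.
Qed.

End GapSums.

Section HarmonicLog.
Variable R : realType.

Lemma harm_ln n : (0 < n)%N -> harm R n <= 1 + ln n%:R.
Proof.
case: n => // n _; elim: n => [|n IH].
  by rewrite /harm big_ord1 ln1 addr0 invr1.
rewrite harmS; apply: (le_trans (lerD IH (lexx _))).
suff : n.+2%:R^-1 <= ln n.+2%:R - ln n.+1%:R :> R by move=> h; rewrite -addrA lerD2l -lerBrDl.
have h1 : (0 : R) < n.+1%:R by [].
have h2 : (0 : R) < n.+2%:R by [].
have -> : ln n.+2%:R - ln n.+1%:R = - ln (1 + (- n.+2%:R^-1)) :> R.
  have -> : 1 + - n.+2%:R^-1 = n.+1%:R / n.+2%:R :> R.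
    by rewrite -[n.+2]addn1 natrD; field; rewrite gt_eqF // -natrD addn1.
  by rewrite ln_div ?posrE // opprB.
rewrite lerNr; apply: le_ln1Dx.
by rewrite ltrN2 invf_lt1 // ltr1n.
Qed.

Lemma ln2_ge : 2^-1 <= ln 2 :> R.
Proof.
have := @harm_ln 2 isT; rewrite /harm !big_ord_recr big_ord0 /= invr1; lra.
Qed.

Lemma harm_le_ln n : (1 < n)%N -> harm R n <= 3 * ln n%:R.
Proof.
move=> n1; apply: (le_trans (harm_ln (ltnW n1))).
have : ln 2 <= ln n%:R :> R by rewrite ler_ln ?posrE ?ltr0n ?ler_nat // ltnW.
have := ln2_ge; lra.
Qed.

(** The first K terms are at most 1 and the others at most 1/(K+1). *)
Lemma harm_split K n : harm R n <= K%:R + n%:R / K.+1%:R.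
Proof.
elim: n => [|n IH]; first by rewrite /harm big_ord0 mul0r addr0.
rewrite harmS; have [nK|Kn] := ltnP n K.
  apply: (@le_trans _ _ n.+1%:R).
    elim: n {IH nK} => [|n IH]; first by rewrite /harm big_ord0 add0r invr1.
    rewrite harmS -[leRHS]natr1; apply: lerD => //.
    by rewrite invf_le1 // ler1n.
  have : n.+1%:R <= K%:R :> R by rewrite ler_nat.
  by move/le_trans; apply; rewrite lerDl divr_ge0.
rewrite -[n.+1%:R]natr1 mulrDl addrA lerD // mul1r.
by rewrite natr1; apply: ler_inv => //; rewrite ler_nat ltnS.
Qed.

Lemma harm_over_small (e : R) p : 0 < e -> exists N, forall n, (N <= n)%N ->
  harm R n / n%:R ^+ p.+1 <= e.
Proof.
move=> e0; have [K hK] : exists K : nat, 2 / e < K%:R.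
  by exists (Num.trunc (2 / e)).+1; exact: truncnS_gt.
exists (K * K).+1 => n Kn.
have K0 : (0 : R) < K%:R by apply: lt_trans hK; rewrite divr_gt0.
have n0 : (0 : R) < n%:R by rewrite ltr0n (leq_trans _ Kn).
apply: (@le_trans _ _ (harm R n / n%:R)).
  rewrite ler_wpM2l ?harm_ge0 //; apply: ler_inv => //.
  by rewrite exprS ler_peMr ?(ltW n0) // exprn_ege1 // ler1n (leq_trans _ Kn).
rewrite ler_pdivrMr //; apply: (le_trans (harm_split K n)).
have h1 : K%:R <= n%:R / K%:R :> R.
  by rewrite ler_pdivlMr // -natrM ler_nat ltnW.
have h2 : n%:R / K.+1%:R <= n%:R / K%:R :> R.
  by rewrite ler_wpM2l ?(ltW n0) //; apply: ler_inv => //; rewrite ler_nat.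
apply: (le_trans (lerD h1 h2)).
rewrite -mulrDr mulrC ler_wpM2r ?(ltW n0) //.
move: hK; rewrite ltr_pdivrMr // => /ltW hK.
rewrite (_ : K%:R^-1 + K%:R^-1 = 2 / K%:R); last by rewrite mulrDl mul1r.
by rewrite ler_pdivrMr // mulrC.
Qed.

End HarmonicLog.

(** * Block diagonalization by a Riccati equation *)

Lemma half_pow_small (R : realType) (K e : R) : 0 < e ->
  exists i, K * (2^-1) ^+ i <= e.
Proof.
move=> e0; have : geometric K (2^-1 : R) @ \oo --> (0 : R).
  by apply: cvg_geometric; rewrite ger0_norm ?invr_ge0 // invf_lt1 // ltr1n.
move/cvgrPdist_lt => /(_ e e0) [N _ /(_ N (leqnn N))] /=.
rewrite sub0r normrN => /(le_lt_trans (ler_norm _)) h; exists N; exact: ltW.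
Qed.

Lemma sum_tail_nat (R : realType) (f : nat -> R) n N :
  \sum_(i < N) (if (i < n)%N then 0 else f i) = \sum_(n <= i < N) f i.
Proof.
rewrite -(big_mkord xpredT (fun i => if (i < n)%N then 0 else f i)).
have [nN|Nn] := leqP n N.
  rewrite (big_cat_nat (leq0n n) nN) /= [X in X + _]big_nat big1 ?add0r; last first.
    by move=> i /andP[_ ->].
  by rewrite !big_nat; apply: eq_bigr => i /andP[ni _]; rewrite ltnNge ni.
rewrite [RHS]big_geq ?(ltnW Nn) // big_nat big1 // => i /andP[_ iN].
by rewrite (ltn_trans iN Nn).
Qed.

Section Riccati.
Variables (R : realType) (Q : (nat -> R[i]) -> nat -> R[i]) (a : nat -> R).
Variables (T kap eps : R) (n : nat).
Local Notation cm := (@cmodulus R).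
Hypothesis QZD : forall z c d, l1 c -> l1 d -> forall j,
  Q (fun i => z * c i + d i) j = z * Q c j + Q d j.
Hypothesis Qb : forall c S j, l1bound c S -> cm (Q c j) <= kap * S.
Hypothesis a_lt : forall k, (k < n)%N -> a k < T.
Hypothesis a_gt : forall j, (n <= j)%N -> T < a j.
Hypothesis sum_lt : \sum_(k < n) (T - a k)^-1 <= eps.
Hypothesis sum_gt : forall N, \sum_(n <= j < N) (a j - T)^-1 <= eps.
Hypothesis kap0 : 0 < kap.
Hypothesis eps0 : 0 <= eps.
Hypothesis small : kap * eps <= 10^-1.

Implicit Types X Y : 'I_n -> nat -> R[i].

(** The unknown of the Riccati equation is stored as X = (a j - a k) K, where K
    is the operator from the span of the first n modes to its complement
    whose graph is invariant. Then X is bounded uniformly in n, whereas its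
    quotient K by the gaps is summable in each index. *)
Definition offdiag X (k : 'I_n) j : R[i] := X k j / (a j - a k)%:C%C.
(** The image of the k-th basis vector under u -> (u, K u). *)
Definition graph_col X (k : 'I_n) j : R[i] :=
  if (j < n)%N then (j == k :> nat)%:R else offdiag X k j.
(** Invariance of the graph of K under diag(a) + Q reads (a j - a k) K j k = (K
    Q (1 + K)) j k - (Q (1 + K)) j k for k < n <= j. The right-hand side is
    this map of X. *)
Definition riccati X (k : 'I_n) j : R[i] := if (j < n)%N then 0 else
  \sum_(l < n) offdiag X l j * Q (graph_col X k) l - Q (graph_col X k) j.
Definition sup_bounded X b := forall k j, (n <= j)%N -> cm (X k j) <= b.

Lemma gap_gt0 (k : 'I_n) j : (n <= j)%N -> 0 < a j - a k.
Proof.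
by move=> nj; rewrite subr_gt0; apply: lt_trans (a_lt (ltn_ord k)) (a_gt nj).
Qed.

Lemma offdiag_cm X b k j : sup_bounded X b -> (n <= j)%N ->
  cm (offdiag X k j) <= b / (a j - a k).
Proof.
move=> hX nj; have g0 := gap_gt0 k nj.
rewrite /offdiag cmM cmV cm_real (ger0_norm (ltW g0)).
by rewrite ler_wpM2r ?invr_ge0 ?(ltW g0) // hX.
Qed.

Lemma sup_bounded_ge0 X b (k : 'I_n) : sup_bounded X b -> 0 <= b.
Proof. by move=> /(_ k n (leqnn n)); apply: le_trans; exact: cm_ge0. Qed.

(** For fixed j >= n the gaps a j - a k are at least T - a k, and for fixed k <
    n they are at least a j - T, which is used in [offdiag_l1]. Both sums of
    reciprocals are at most eps. *)
Lemma offdiag_sum X b j : sup_bounded X b -> 0 <= b -> (n <= j)%N ->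
  \sum_(k < n) cm (offdiag X k j) <= b * eps.
Proof.
move=> hX b0 nj; apply: (@le_trans _ _ (\sum_(k < n) b * (T - a k)^-1)).
  apply: ler_sum => k _; apply: (le_trans (offdiag_cm _ hX nj)).
  rewrite ler_wpM2l // lef_pV2 ?posrE ?subr_gt0 ?a_lt //.
    by rewrite lerD2r ltW // a_gt.
  by have := gap_gt0 k nj; rewrite subr_gt0.
by rewrite -mulr_sumr ler_wpM2l.
Qed.

Lemma offdiag_l1 X b k : sup_bounded X b ->
  l1bound (fun j => if (j < n)%N then 0 else offdiag X k j) (b * eps).
Proof.
move=> hX N; have b0 := sup_bounded_ge0 k hX.
rewrite (eq_bigr (fun i : 'I_N => if (i < n)%N then 0 else cm (offdiag X k i)));
  last by move=> i _; case: ifP => // _; rewrite cm0.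
rewrite (sum_tail_nat (fun i => cm (offdiag X k i))).
apply: (@le_trans _ _ (\sum_(n <= j < N) b * (a j - T)^-1)).
  rewrite !big_nat; apply: ler_sum => j /andP[nj _].
  apply: (le_trans (offdiag_cm _ hX nj)).
  rewrite ler_wpM2l // lef_pV2 ?posrE ?subr_gt0 ?a_gt //.
    by rewrite lerD2l lerN2 ltW // a_lt.
  by have := gap_gt0 k nj; rewrite subr_gt0.
by rewrite -mulr_sumr ler_wpM2l.
Qed.

Lemma delta_l1 (k : 'I_n) :
  l1bound (fun j => if (j < n)%N then (j == k :> nat)%:R else 0 : R[i]) 1.
Proof.
move=> N; apply: (@le_trans _ _ (\sum_(i < N | (i == k :> nat)) 1)).
  rewrite [leRHS]big_mkcond; apply: ler_sum => i _.
  have [->|ik] := eqVneq (i : nat) k; first by rewrite ltn_ord cm1.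
  by case: ifP; rewrite cm0.
rewrite sumr_const; have [kN|Nk] := ltnP k N.
  rewrite (_ : #|_| = 1%N) ?mulr1n //; rewrite (eq_card (B := pred1 (Ordinal kN))) ?card1 //.
rewrite (_ : #|_| = 0%N) ?mulr0n // eq_card0 // => i.
rewrite !inE /= -[_ \in _]/(i == k :> nat); apply/eqP => E.
by have := ltn_ord i; rewrite E ltnNge Nk.
Qed.

Lemma graph_col_l1 X b k : sup_bounded X b -> l1bound (graph_col X k) (1 + b * eps).
Proof.
move=> hX; have := l1boundD (delta_l1 k) (offdiag_l1 k hX).
apply: l1bound_mono => j; rewrite /graph_col; case: ifP => _; first by rewrite addr0.
by rewrite add0r.
Qed.

Lemma l1_bound_l1 (c : nat -> R[i]) S : l1bound c S -> l1 c.
Proof. by exists S. Qed.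

Lemma QB c d j : l1 c -> l1 d -> Q (fun i => c i - d i) j = Q c j - Q d j.
Proof.
move=> hc hd; rewrite -[RHS]addrC -mulN1r -QZD //; congr Q.
by apply/funext => i; rewrite mulN1r addrC.
Qed.

Lemma Q_graph_colB X Y b d k j : sup_bounded X b -> sup_bounded Y b ->
  sup_bounded (fun k j => X k j - Y k j) d ->
  cm (Q (graph_col X k) j - Q (graph_col Y k) j) <= kap * (d * eps).
Proof.
move=> hX hY hd; have l1X := l1_bound_l1 (graph_col_l1 k hX).
rewrite -QB //; last exact: l1_bound_l1 (graph_col_l1 k hY).
apply: Qb; apply: l1bound_mono (offdiag_l1 k hd) => i /=.
rewrite /graph_col; case: ifP => _; first by rewrite subrr.
by rewrite /offdiag mulrBl.
Qed.

Lemma riccati_sup_bounded X b : 0 <= b -> sup_bounded X b ->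
  sup_bounded (riccati X) (kap * (1 + b * eps) * (1 + b * eps)).
Proof.
move=> b0 hX k j nj; rewrite /riccati ltnNge nj /=.
have be0 : 0 <= b * eps by rewrite mulr_ge0.
have hc l : cm (Q (graph_col X k) l) <= kap * (1 + b * eps) by exact: Qb (graph_col_l1 k hX).
apply: (le_trans (cmB _ _)); rewrite mulrDr mulr1 addrC; apply: lerD => //.
apply: (le_trans (cm_sum _ _ _)).
apply: (@le_trans _ _ (\sum_(l < n) cm (offdiag X l j) * (kap * (1 + b * eps)))).
  by apply: ler_sum => l _; rewrite cmM ler_wpM2l ?cm_ge0.
rewrite -mulr_suml mulrC ler_wpM2l ?offdiag_sum //.
by rewrite mulr_ge0 ?(ltW kap0) // addr_ge0.
Qed.

Lemma riccati_contr X Y b d : 0 <= d -> sup_bounded X b -> sup_bounded Y b ->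
  sup_bounded (fun k j => X k j - Y k j) d ->
  sup_bounded (fun k j => riccati X k j - riccati Y k j)
    (kap * eps * d * (2 + 2 * (b * eps))).
Proof.
move=> d0 hX hY hd k j nj; rewrite /riccati ltnNge nj /=.
have b0 := sup_bounded_ge0 k hX.
have hc l : cm (Q (graph_col X k) l) <= kap * (1 + b * eps) by exact: Qb (graph_col_l1 k hX).
have hB l := Q_graph_colB k l hX hY hd.
have -> : \sum_(l < n) offdiag X l j * Q (graph_col X k) l - Q (graph_col X k) j -
    (\sum_(l < n) offdiag Y l j * Q (graph_col Y k) l - Q (graph_col Y k) j) =
   \sum_(l < n) (offdiag (fun k j => X k j - Y k j) l j * Q (graph_col X k) l) +
   \sum_(l < n) (offdiag Y l j * (Q (graph_col X k) l - Q (graph_col Y k) l)) -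
   (Q (graph_col X k) j - Q (graph_col Y k) j).
  have E : \sum_(l < n) offdiag X l j * Q (graph_col X k) l -
      \sum_(l < n) offdiag Y l j * Q (graph_col Y k) l =
     \sum_(l < n) (offdiag (fun k j => X k j - Y k j) l j * Q (graph_col X k) l) +
     \sum_(l < n) (offdiag Y l j * (Q (graph_col X k) l - Q (graph_col Y k) l)).
    rewrite -sumrB -big_split; apply: eq_bigr => l _; rewrite /offdiag /=; ring.
  by rewrite -E; ring.
apply: (le_trans (cmB _ _)).
apply: (@le_trans _ _ ((d * eps * (kap * (1 + b * eps)) + b * eps * (kap * (d * eps)))
   + kap * (d * eps))); last by rewrite le_eqVlt; apply/orP; left; apply/eqP; ring.
apply: lerD => //; apply: (le_trans (cmD _ _)); apply: lerD.
  apply: (le_trans (cm_sum _ _ _)).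
  apply: (@le_trans _ _ (\sum_(l < n) cm (offdiag (fun k j => X k j - Y k j) l j)
     * (kap * (1 + b * eps)))).
    by apply: ler_sum => l _; rewrite cmM ler_wpM2l ?cm_ge0.
  rewrite -mulr_suml ler_wpM2r ?offdiag_sum //.
  by rewrite mulr_ge0 ?(ltW kap0) // addr_ge0 // mulr_ge0.
apply: (le_trans (cm_sum _ _ _)).
apply: (@le_trans _ _ (\sum_(l < n) cm (offdiag Y l j) * (kap * (d * eps)))).
  by apply: ler_sum => l _; rewrite cmM ler_wpM2l ?cm_ge0.
rewrite -mulr_suml ler_wpM2r ?offdiag_sum //.
by rewrite !mulr_ge0 ?(ltW kap0).
Qed.

(** This is where kap * eps <= 1/10 enters. The radius 8 kap is the one at which
    the limit of the iteration, bounded by twice its geometric majorant 4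
    kap, is known to lie. *)
Lemma riccati_contr_half X Y d : 0 <= d -> sup_bounded X (8 * kap) -> sup_bounded Y (8 * kap) ->
  sup_bounded (fun k j => X k j - Y k j) d ->
  sup_bounded (fun k j => riccati X k j - riccati Y k j) (d / 2).
Proof.
move=> d0 hX hY hd k j nj; apply: (le_trans (riccati_contr d0 hX hY hd k nj)).
move: kap0 eps0 small => k0 e0 sm.
have ke0 : 0 <= kap * eps by rewrite mulr_ge0 ?(ltW k0).
rewrite (_ : _ * (2 + _) = d * (kap * eps * (2 + 16 * (kap * eps)))); last by ring.
rewrite ler_wpM2l //; move: (kap * eps) ke0 sm => t t0 t1.
apply: (@le_trans _ _ (10^-1 * (2 + 16 * 10^-1))); last by lra.
by apply: ler_pM => //; lra.
Qed.

Definition riccati_iter i := iter i riccati (fun _ _ => 0).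

Lemma riccati_iter_bounded i : sup_bounded (riccati_iter i) (2 * kap).
Proof.
move: kap0 eps0 small => k0 e0 sm.
elim: i => [|i IH] k j nj; first by rewrite /riccati_iter /= cm0; lra.
have h := @riccati_sup_bounded _ (2 * kap) _ IH; apply: (le_trans (h _ k j nj)); first by lra.
rewrite -!mulrA [leRHS]mulrC ler_wpM2l ?(ltW k0) //.
have ke0 : 0 <= kap * eps by rewrite mulr_ge0 ?(ltW k0).
move: (kap * eps) ke0 sm => t t0 t1.
apply: (@le_trans _ _ ((1 + 2 * 10^-1) * (1 + 2 * 10^-1))); last by lra.
by apply: ler_pM => //; lra.
Qed.

Lemma riccati_iter_bounded8 i : sup_bounded (riccati_iter i) (8 * kap).
Proof.
move=> k j nj; apply: (le_trans (riccati_iter_bounded i k nj)); move: kap0 => ?; lra.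
Qed.

Lemma riccati_iter_step i : sup_bounded (fun k j => riccati_iter i.+1 k j - riccati_iter i k j)
  (2 * kap * 2^-1 ^+ i).
Proof.
elim: i => [|i IH].
  by move=> k j nj; rewrite subr0 expr0 mulr1; exact: (riccati_iter_bounded 1).
have d0 : 0 <= 2 * kap * 2^-1 ^+ i.
  by rewrite !mulr_ge0 ?exprn_ge0 ?invr_ge0 // ltW.
have := riccati_contr_half d0 (riccati_iter_bounded8 i.+1) (riccati_iter_bounded8 i) IH.
by rewrite exprSr mulrA.
Qed.

Lemma riccati_iter_dist k j i i' : (n <= j)%N -> (i <= i')%N ->
  cm (riccati_iter i' k j - riccati_iter i k j) <= 4 * kap * 2^-1 ^+ i.
Proof.
move=> nj /subnKC <-.
apply: (@le_trans _ _ (4 * kap * (2^-1 ^+ i - 2^-1 ^+ (i + (i' - i))))); last first.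
  by rewrite ler_wpM2l ?mulr_ge0 ?(ltW kap0) // gerBl exprn_ge0 ?invr_ge0.
elim: (i' - i)%N => [|d IH]; first by rewrite addn0 !subrr cm0 mulr0.
rewrite -(subrK (riccati_iter (i + d) k j) (riccati_iter (i + d.+1) k j)) -addrA addnS.
apply: (le_trans (cmD _ _)).
apply: (le_trans (lerD (riccati_iter_step (i + d) k nj) IH)).
by rewrite exprSr le_eqVlt; apply/orP; left; apply/eqP; field.
Qed.

Definition riccati_sol (k : 'I_n) j := clim (fun i => riccati_iter i k j).

Lemma riccati_sol_dist k j i : (n <= j)%N ->
  cm (riccati_sol k j - riccati_iter i k j) <= 8 * kap * 2^-1 ^+ i.
Proof.
move=> nj; rewrite (_ : 8 * kap * _ = 2 * (4 * kap * 2^-1 ^+ i)); last by ring.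
apply: (@clim_dist _ (fun i => riccati_iter i k j) (fun i => 4 * kap * 2^-1 ^+ i)).
  by move=> p q pq; exact: riccati_iter_dist.
apply: (@cvg_geometric R (4 * kap) 2^-1).
by rewrite ger0_norm ?invr_ge0 // invf_lt1 // ltr1n.
Qed.

Lemma riccati_sol_bounded : sup_bounded riccati_sol (8 * kap).
Proof.
by move=> k j nj; have := riccati_sol_dist k 0 nj; rewrite subr0 expr0 mulr1.
Qed.

Lemma riccati_sol_fixed k j : (n <= j)%N -> riccati riccati_sol k j = riccati_sol k j.
Proof.
move=> nj; apply/eqP; rewrite -subr_eq0; apply/eqP; apply: cm_eq_small => e e0.
have [i hi] := half_pow_small (8 * kap) e0.
apply: le_trans hi.
have d0 : 0 <= 8 * kap * 2^-1 ^+ i.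
  by rewrite !mulr_ge0 ?exprn_ge0 ?invr_ge0 // ltW.
have h1 := riccati_contr_half d0 riccati_sol_bounded (riccati_iter_bounded8 i)
  (fun k j nj => riccati_sol_dist k i nj) k nj.
have h2 := riccati_sol_dist k i.+1 nj.
rewrite -(subrK (riccati (riccati_iter i) k j) (riccati riccati_sol k j)) -addrA.
apply: (le_trans (cmD _ _)); apply: (le_trans (lerD h1 _)).
  by rewrite -opprB cmN; exact: h2.
by rewrite exprS le_eqVlt; apply/orP; left; apply/eqP; field.
Qed.

Local Notation Cl := (graph_col riccati_sol).

Lemma sol_col_l1 k : l1bound (Cl k) 2.
Proof.
apply: l1bound_le (graph_col_l1 k riccati_sol_bounded) _.
move: small => h; rewrite -mulrA; lra.
Qed.

Lemma Q0 (c : nat -> R[i]) j : (forall i, c i = 0) -> Q c j = 0.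
Proof.
move=> c0; apply: cm_eq0; apply/eqP; rewrite eq_le cm_ge0 andbT.
rewrite -(mulr0 kap); apply: Qb => N; rewrite big1 // => i _.
by rewrite c0 cm0.
Qed.

Lemma l1_sum (I : eqType) (r : seq I) (u : I -> R[i]) (c : I -> nat -> R[i]) :
  (forall k, l1 (c k)) -> l1 (fun i => \sum_(k <- r) u k * c k i).
Proof.
move=> hc; elim: r => [|k r IH].
  by exists 0 => N; rewrite big1 // => i _; rewrite big_nil cm0.
by under eq_fun do rewrite big_cons; exact: l1D (l1Z _ (hc k)) IH.
Qed.

Lemma Q_sum (I : eqType) (r : seq I) (u : I -> R[i]) (c : I -> nat -> R[i]) j :
  (forall k, l1 (c k)) ->
  Q (fun i => \sum_(k <- r) u k * c k i) j = \sum_(k <- r) u k * Q (c k) j.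
Proof.
move=> hc; elim: r => [|k r IH].
  by rewrite big_nil; apply: Q0 => i; rewrite big_nil.
under eq_fun do rewrite big_cons.
by rewrite QZD ?big_cons ?IH //; exact: l1_sum.
Qed.

Definition graph_emb (u : 'rV[R[i]]_n) j := \sum_k u 0 k * Cl k j.
(** The restriction of diag(a) + Q to its invariant graph, in the coordinates of
    the first n modes. Matrices act on row vectors. *)
Definition reduced_mx : 'M[R[i]]_n :=
  \matrix_(k, l) ((a k)%:C%C *+ (k == l) + Q (Cl k) l).
Definition seqrel (c d : nat -> R[i]) := forall j, (a j)%:C%C * c j + Q c j = d j.

Lemma graph_emb_lt u (l : 'I_n) : graph_emb u l = u 0 l.
Proof.
rewrite /graph_emb (bigD1 l) //= /graph_col ltn_ord eqxx mulr1 big1 ?addr0 // => k kl.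
by rewrite (_ : (l == k :> nat) = false) ?mulr0 // eq_sym; apply: negbTE.
Qed.

Lemma graph_emb_lin z u v j : graph_emb (z *: u + v) j = z * graph_emb u j + graph_emb v j.
Proof.
rewrite /graph_emb mulr_sumr -big_split; apply: eq_bigr => k _.
by rewrite !mxE mulrDl mulrA.
Qed.

Lemma graph_emb_l1bound u : l1bound (graph_emb u) (2 * \sum_k cm (u 0 k)).
Proof.
move=> N; apply: (@le_trans _ _ (\sum_(i < N) \sum_k cm (u 0 k) * cm (Cl k i))).
  apply: ler_sum => i _; apply: (le_trans (cm_sum _ _ _)).
  by apply: ler_sum => k _; rewrite cmM.
rewrite exchange_big mulr_sumr; apply: ler_sum => k _.
rewrite -mulr_sumr mulrC ler_wpM2r ?cm_ge0 //.
exact: sol_col_l1.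
Qed.

Lemma graph_emb_l1 u : l1 (graph_emb u).
Proof. by exists (2 * \sum_k cm (u 0 k)); exact: graph_emb_l1bound. Qed.

Lemma Q_graph_emb u j : Q (graph_emb u) j = \sum_k u 0 k * Q (Cl k) j.
Proof. by apply: Q_sum => k; exists 2; exact: sol_col_l1. Qed.

Lemma graph_col_rel k j : (a j)%:C%C * Cl k j + Q (Cl k) j = \sum_l reduced_mx k l * Cl l j.
Proof.
have E : \sum_l reduced_mx k l * Cl l j =
    (a k)%:C%C * Cl k j + \sum_(l < n) Q (Cl k) l * Cl l j.
  rewrite (eq_bigr (fun l => (if l == k then (a k)%:C%C * Cl l j else 0)
     + Q (Cl k) l * Cl l j)).
    by rewrite big_split /= -big_mkcond big_pred1_eq.
  move=> l _; rewrite mxE mulrDl eq_sym; case: eqP => _; first by rewrite mulr1n.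
  by rewrite mulr0n mul0r.
rewrite E; have [jn|nj] := ltnP j n.
  pose l0 := Ordinal jn.
  rewrite (bigD1 l0) //= big1 ?addr0 => [|l ll0]; last first.
    rewrite /graph_col jn (_ : (j == l :> nat) = false) ?mulr0 //.
    by apply/negbTE; apply: contraNneq ll0 => jl; apply/eqP/val_inj.
  have -> : Cl l0 j = 1 by rewrite /graph_col jn eqxx.
  rewrite mulr1; congr (_ + _).
  rewrite /graph_col jn; have [->|] := eqVneq j k; by rewrite ?mulr0.
have := riccati_sol_fixed k nj; rewrite {1}/riccati ltnNge nj /= => H.
have g0 : (a j - a k)%:C%C != 0 :> R[i].
  by apply/eqP => -[/eqP]; rewrite gt_eqF // gap_gt0.
have E2 : Cl k j * (a j - a k)%:C%C = \sum_(l < n) Q (Cl k) l * Cl l j - Q (Cl k) j.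
  rewrite {1}/graph_col ltnNge nj /= /offdiag divfK // -H; congr (_ - _).
  by apply: eq_bigr => l _; rewrite mulrC /graph_col ltnNge nj.
have E3 : (a j - a k)%:C%C = (a j)%:C%C - (a k)%:C%C by rewrite rmorphB.
rewrite E3 in E2.
rewrite -[\sum_(l < n) _](subrK (Q (Cl k) j)) -E2; ring.
Qed.

Lemma seqrel_graph_emb u : seqrel (graph_emb u) (graph_emb (u *m reduced_mx)).
Proof.
move=> j; rewrite Q_graph_emb /graph_emb mulr_sumr -big_split /=.
under [RHS]eq_bigr do rewrite mxE mulr_suml.
rewrite exchange_big /=; apply: eq_bigr => k _.
rewrite mulrCA -mulrDr graph_col_rel mulr_sumr; apply: eq_bigr => l _; by rewrite mulrA.
Qed.

Lemma l1_shrink (c : nat -> R[i]) S : (forall S, l1bound c S -> l1bound c (S / 2)) ->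
  l1bound c S -> forall j, c j = 0.
Proof.
move=> h hS j; apply: cm_eq_small => e e0.
have [i hi] := half_pow_small S e0; apply: le_trans hi.
apply: l1bound_cm; elim: i => [|i IH]; first by rewrite expr0 mulr1.
by rewrite exprSr mulrA; exact: h.
Qed.

(** Let w be the component of c transverse to the graph. It solves (a j - z) w j
    = (K Q w) j - (Q w) j for j >= n, and |a j - z| >= a j - T, so the sum
    of its moduli is at most kap * eps * (9/5) times itself, hence w = 0. *)
Lemma graph_contains_root_vector (c : nat -> R[i]) z v : l1 c -> complex.Re z < T ->
  seqrel c (fun j => z * c j + graph_emb v j) ->
  exists u, (forall j, c j = graph_emb u j) /\ u *m reduced_mx = z *: u + v.
Proof.
move=> hc zT hrel; pose u : 'rV[R[i]]_n := \row_(k < n) c k.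
pose w j := c j - graph_emb u j.
have hw : l1 w by apply: l1B => //; exact: graph_emb_l1.
pose v' := z *: u + v - u *m reduced_mx.
have wlt j : (j < n)%N -> w j = 0.
  by move=> jn; rewrite /w (graph_emb_lt u (Ordinal jn)) mxE subrr.
have relw j : (a j)%:C%C * w j + Q w j = z * w j + graph_emb v' j.
  rewrite /w QB //; last exact: graph_emb_l1.
  have -> : v' = (-1) *: (u *m reduced_mx) + (z *: u + v) by rewrite scaleN1r addrC.
  rewrite !graph_emb_lin -(seqrel_graph_emb u j) mulrBr -(subrK (Q c j) ((a j)%:C%C * c j)).
  by have := hrel j => /(canRL (addrK _)) ->; ring.
have v'E (l : 'I_n) : v' 0 l = Q w l.
  by have := relw l; rewrite graph_emb_lt wlt // !mulr0 !add0r.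
(* Any bound on the sum of moduli of w can be halved. *)
have shr S : l1bound w S -> l1bound w (S / 2).
  move=> hS; have S0 := l1bound_ge0 hS.
  have bw j : (n <= j)%N -> cm (w j) <= kap * S * (9 / 5) * (a j - T)^-1.
    move=> nj; have aT : 0 < a j - T by rewrite subr_gt0 a_gt.
    rewrite ler_pdivlMr //.
    have E : ((a j)%:C%C - z) * w j = graph_emb v' j - Q w j.
      by rewrite mulrBl; have := relw j => /(canRL (addrK _)) ->; ring.
    apply: (@le_trans _ _ (cm (graph_emb v' j - Q w j))).
      rewrite -E cmM mulrC ler_wpM2r ?cm_ge0 //.
      apply: (le_trans _ (cm_Re _)); rewrite ReD ReN /=.
      by apply: (le_trans _ (ler_norm _)); move: (ltW zT); lra.
    apply: (le_trans (cmB _ _)).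
    apply: (@le_trans _ _ (kap * S * (8 * kap * eps) + kap * S)).
      apply: lerD; last exact: Qb.
      apply: (le_trans (cm_sum _ _ _)).
      apply: (@le_trans _ _ (\sum_l kap * S * cm (offdiag riccati_sol l j))).
        apply: ler_sum => l _; rewrite cmM v'E /graph_col ltnNge nj /=.
        by rewrite ler_wpM2r ?cm_ge0 // Qb.
      rewrite -mulr_sumr ler_wpM2l ?mulr_ge0 ?(ltW kap0) //.
      by apply: offdiag_sum nj; [exact: riccati_sol_bounded | rewrite mulr_ge0 ?(ltW kap0)].
    have kS : 0 <= kap * S by rewrite mulr_ge0 // ltW.
    rewrite -[X in _ + X]mulr1 -mulrDr ler_wpM2l //.
    by move: small; rewrite -mulrA; lra.
  move=> N; rewrite (eq_bigr (fun i : 'I_N => if (i < n)%N then 0 else cm (w i)));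
    last by move=> i _; case: ifP => // /wlt ->; rewrite cm0.
  rewrite (sum_tail_nat (fun i => cm (w i))).
  apply: (@le_trans _ _ (\sum_(n <= j < N) kap * S * (9 / 5) * (a j - T)^-1)).
    by rewrite !big_nat; apply: ler_sum => j /andP[nj _]; exact: bw.
  rewrite -mulr_sumr; apply: (@le_trans _ _ (kap * S * (9 / 5) * eps)).
    by rewrite ler_wpM2l // mulr_ge0 ?mulr_ge0 ?(ltW kap0) // divr_ge0.
  rewrite (_ : _ * eps = S * (kap * eps * (9 / 5))); last by ring.
  by rewrite ler_wpM2l //; move: small; lra.
have w0 j : w j = 0 by case: hw => S hS; exact: l1_shrink hS j.
exists u; split; first by move=> j; apply/eqP; rewrite -subr_eq0; apply/eqP/w0.
apply/rowP => l; apply/eqP; rewrite eq_sym -subr_eq0.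
have := v'E l; rewrite Q0 // /v' => <-; by rewrite !mxE.
Qed.

(** If Re z >= T then |z - a k| >= T - a k for every k < n, and the same
    smallness as for the transverse part forces u = 0. *)
Lemma reduced_mx_eigenvalue (u : 'rV[R[i]]_n) z :
  u *m reduced_mx = z *: u -> u != 0 -> complex.Re z < T.
Proof.
move=> uB; apply: contraNT; rewrite -leNgt => Tz.
have hE (k : 'I_n) : (z - (a k)%:C%C) * u 0 k = Q (graph_emb u) k.
  have := seqrel_graph_emb u k; rewrite uB.
  have -> : z *: u = z *: u + 0 by rewrite addr0.
  rewrite graph_emb_lin !graph_emb_lt mxE addr0 => /(canRL (addKr _)) ->; ring.
set s := \sum_k cm (u 0 k).
have s0 : 0 <= s by apply: sumr_ge0 => k _; exact: cm_ge0.
have hb (k : 'I_n) : cm (u 0 k) <= kap * (2 * s) * (T - a k)^-1.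
  have aT : 0 < T - a k by rewrite subr_gt0 a_lt.
  rewrite ler_pdivlMr //; apply: le_trans (Qb k (graph_emb_l1bound u)).
  rewrite -hE cmM mulrC ler_wpM2r ?cm_ge0 //.
  apply: (le_trans _ (cm_Re _)); rewrite ReD ReN /=.
  by apply: (le_trans _ (ler_norm _)); move: Tz; lra.
have sle : s <= s / 2.
  apply: (le_trans (ler_sum _ (fun k _ => hb k))); rewrite -mulr_sumr.
  apply: (@le_trans _ _ (kap * (2 * s) * eps)).
    by rewrite ler_wpM2l // !mulr_ge0 // ltW.
  rewrite (_ : _ * eps = s * (2 * (kap * eps))); last by ring.
  by rewrite ler_wpM2l //; move: small; lra.
have s00 : s = 0 by apply/eqP; rewrite eq_le s0 andbT; lra.
apply/eqP/rowP => k; rewrite mxE; apply: cm_eq0; apply/eqP.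
have := s00 => /eqP; rewrite psumr_eq0 => [|i _]; last exact: cm_ge0.
by move=> /allP /(_ k (mem_index_enum k)).
Qed.

(** The chain condition of a root vector, for coefficient sequences. *)
Fixpoint seq_ker_pow z k (c : nat -> R[i]) : Prop :=
  if k is k'.+1 then
    exists d, [/\ l1 d, seqrel c (fun j => z * c j + d j) & seq_ker_pow z k' d]
  else forall j, c j = 0.

Lemma seq_ker_pow_graph z k c : complex.Re z < T -> l1 c -> seq_ker_pow z k c ->
  exists u, (forall j, c j = graph_emb u j) /\ u *m (reduced_mx - z%:M) ^+ k = 0.
Proof.
move=> zT; elim: k c => [|k IH] c hc /=.
  move=> c0; exists 0; split; last by rewrite mul0mx.
  by move=> j; rewrite c0 /graph_emb big1 // => l _; rewrite mxE mul0r.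
move=> [d [hd hrel /(IH _ hd) [v [dv vB]]]].
have [|u [cu uB]] := @graph_contains_root_vector c z v hc zT; first by move=> j; rewrite -dv.
exists u; split => //.
by rewrite exprS mulmxA mulmxBr uB mul_mx_scalar addrAC subrr add0r.
Qed.

Lemma graph_seq_ker_pow z k (u : 'rV[R[i]]_n) : u *m (reduced_mx - z%:M) ^+ k = 0 ->
  seq_ker_pow z k (graph_emb u).
Proof.
elim: k u => [|k IH] u /=.
  by rewrite expr0 mulmx1 => -> j; rewrite /graph_emb big1 // => l _; rewrite mxE mul0r.
rewrite exprS mulmxA => /IH h; exists (graph_emb (u *m (reduced_mx - z%:M))); split => //.
  exact: graph_emb_l1.
move=> j; rewrite seqrel_graph_emb -graph_emb_lin mulmxBr mul_mx_scalar.
by rewrite addrC subrK.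
Qed.

End Riccati.

(** * Counting eigenvalues with multiplicity *)

(** By Cayley-Hamilton the kernel of the characteristic polynomial is
    everything, and it splits as the direct sum of the kernels of its
    coprime factors (X - z)^e, each contained in a generalized eigenspace. *)
Lemma sum_rank_geigenspace (F : closedFieldType) (n : nat) (B : 'M[F]_n.+1) :
  exists s : seq F, [/\ uniq s, (forall z, (z \in s) = eigenvalue B z) &
    (\sum_(z <- s) \rank (geigenspace B z))%N = n.+1].
Proof.
have [r hr] := closed_field_poly_normal (char_poly B).
have cp := char_poly_monic B.
rewrite (monicP cp) scale1r in hr.
pose s := undup r; exists s; split; first exact: undup_uniq.
  by move=> z; rewrite mem_undup eigenvalue_root_char hr root_prod_XsubC.
pose p (i : 'I_(size s)) := ('X - (s`_i)%:P) ^+ (count_mem s`_i r).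
have sinj : injective (fun i : 'I_(size s) => s`_i).
  move=> i j /eqP; rewrite nth_uniq ?undup_uniq // => /eqP; exact: val_inj.
have hp : char_poly B = \prod_i p i.
  rewrite hr -(prodr_undup_exp_count r xpredT) -/s (big_nth 0) big_mkord.
  exact: eq_bigr.
have cop : {in xpredT &, forall i j, j != i -> coprimep (p i) (p j)}.
  move=> i j _ _ ij; rewrite coprimep_expr ?coprimep_expl //.
  by rewrite coprimep_XsubC root_XsubC (inj_eq sinj).
have full : (1%:M <= \sum_(i < size s) geigenspace B s`_i)%MS.
  have := kermxpoly_prod B cop; rewrite -hp => h.
  have := kermxpoly_min (mxminpoly_dvd_char B) => h1.
  rewrite -h1 h; apply: sumsmxS => i _.
  rewrite /geigenspace /kermxpoly; apply/sub_kermxP.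
  have le : leq (count_mem s`_i r) n.+1.
    apply: (leq_trans (count_size _ _)).
    by have := size_char_poly B; rewrite hr size_prod_XsubC => -[->].
  have -> : ('X - (s`_i)%:P) ^+ n.+1 = p i * ('X - (s`_i)%:P) ^+ (n.+1 - count_mem s`_i r).
    by rewrite /p -exprD subnKC.
  by rewrite rmorphM -mulmxE mulmxA mulmx_ker mul0mx.
have dir : mxdirect (\sum_(i < size s) geigenspace B s`_i).
  by apply: (@mxdirect_sum_geigenspace _ _ _ _ xpredT) => i j _ _; exact: sinj.
rewrite (big_nth 0) big_mkord -(mxdirectP dir) /=.
by apply/eqP; rewrite -[_ == _]/(row_full _) -sub1mx.
Qed.

Lemma geigenspace_eigenvalue (F : fieldType) (n : nat) (B : 'M[F]_n.+1) z :
  geigenspace B z != 0 -> eigenvalue B z.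
Proof.
apply: contraNT => /negPn; rewrite /eigenspace kermx_eq0 row_free_unit => u.
by rewrite geigenspaceE kermx_eq0 row_free_unit unitrX.
Qed.

Lemma initial_segment (L : seq nat) : uniq L -> 0%N \notin L ->
  (forall j k, k \in L -> (1 <= j <= k)%N -> j \in L) ->
  forall k, (k \in L) = (1 <= k <= size L)%N.
Proof.
move=> uL L0 dL k; have [->|k0] := posnP k; first by rewrite (negbTE L0).
apply/idP/idP => [kL|/= kn].
  suff : (size (iota 1 k) <= size L)%N by rewrite size_iota.
  apply: uniq_leq_size; first exact: iota_uniq.
  by move=> j; rewrite mem_iota => jk; apply: dL kL _; lia.
apply: contraT => kL.
suff : (size L <= size (iota 1 k.-1))%N by rewrite size_iota; lia.
apply: uniq_leq_size => // j jL; rewrite mem_iota.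
have [j0|j0] := posnP j; first by move: L0; rewrite -j0 jL.
have : (j < k)%N by rewrite ltnNge; apply/negP => kj; case/negP: kL; apply: dL jL _; lia.
lia.
Qed.

Lemma card_eq_seq (A : set nat) d : A #= `I_d ->
  exists L : seq nat, [/\ uniq L, size L = d & forall k, (k \in L) = `[<A k>]].
Proof.
move=> Ad; have fA : finite_set A by apply/finite_setP; exists d.
exists (enum_fset (fset_set A)); split; first exact: fset_uniq.
  exact: card_fset_set.
move=> k; rewrite -[LHS]/(k \in fset_set A) in_fset_set //.

Qed.

(** A numbering that repeats each z with Re z < T according to the rank of its
    generalized eigenspace contains exactly n+1 indices below T in total.
    Monotonicity of the real parts makes this set of indices an initial
    segment. *)
Lemma count_spectrum (R : realType) (T : R) (n : nat) (B : 'M[R[i]]_n.+1)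
    (lam : nat -> R[i]) :
  (forall z, eigenvalue B z -> complex.Re z < T) ->
  (forall i j, (1 <= i <= j)%N -> complex.Re (lam i) <= complex.Re (lam j)) ->
  (forall z, complex.Re z < T ->
     [set k | (1 <= k)%N /\ lam k = z] #= `I_(\rank (geigenspace B z))) ->
  forall k, (1 <= k)%N -> (complex.Re (lam k) < T) = (k <= n.+1)%N.
Proof.
move=> eT mono hc.
have [s [us sE ss]] := sum_rank_geigenspace B.
have sT z : z \in s -> complex.Re z < T by rewrite sE; exact: eT.
have [L [uL sL LE]] : exists L : seq nat, [/\ uniq L,
    size L = (\sum_(z <- s) \rank (geigenspace B z))%N &
    forall k, (k \in L) = (1 <= k)%N && (lam k \in s)].
  elim: s us sT {sE ss} => [|z s IH] /=.
    by exists [::]; rewrite big_nil; split => // k; rewrite andbF.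
  move=> /andP[zs us] sT.
  have [|L [uL sL LE]] := IH us; first by move=> w ws; apply: sT; rewrite inE ws orbT.
  have [L' [uL' sL' LE']] := card_eq_seq (hc z (sT z (mem_head _ _))).
  exists (L' ++ L); rewrite big_cons size_cat sL sL'; split => //.
    rewrite cat_uniq uL uL' /= andbT; apply/hasPn => k; rewrite LE LE'.
    by move=> /andP[_ ks]; apply/asboolP => -[_ kz]; rewrite kz (negbTE zs) in ks.
  move=> k; rewrite mem_cat LE LE' inE andb_orr; congr (_ || _).
  by apply/asboolP/andP => -[h /eqP h1]; split => //; apply/eqP.
have hL k : (1 <= k)%N -> (k \in L) = (complex.Re (lam k) < T).
  move=> k1; rewrite LE k1 /=; apply/idP/idP => [|h]; first exact: sT.
  rewrite sE; have [L' [uL' sL' LE']] := card_eq_seq (hc _ h).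
  have kL' : k \in L' by rewrite LE'; apply/asboolP.
  have : (0 < \rank (geigenspace B (lam k)))%N.
    by rewrite -sL'; case: (L') kL'.
  by rewrite lt0n mxrank_eq0; exact: geigenspace_eigenvalue.
move=> k k1; rewrite -hL // initial_segment // ?k1 ?sL ?ss //.
  by rewrite LE.
move=> j i iL /andP[j1 ji]; have i1 : (1 <= i)%N by apply: leq_trans ji.
rewrite hL //; rewrite hL // in iL; apply: le_lt_trans iL; apply: mono.
by rewrite j1.
Qed.

(** A parametrization of V by row vectors, injective on [0, pi], turns a basis
    of V into the rows of a matrix with the same row space as W. *)
Lemma has_dim_rank (R : realType) (n : nat) (V : set (R -> R[i]))
    (E : 'rV[R[i]]_n -> R -> R[i]) (W : 'M[R[i]]_n) d :
  (forall z u v x, x \in `[0, pi] -> E (z *: u + v) x = z * E u x + E v x) ->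
  (forall u, (forall x, x \in `[0, pi] -> E u x = 0) -> u = 0) ->
  (forall y, V y <-> exists u, (u <= W)%MS /\ forall x, x \in `[0, pi] -> y x = E u x) ->
  has_dim V d -> d = \rank W.
Proof.
move=> Elin Einj VE [e [Ve efree espan]].
have E0 x : x \in `[0, pi] -> E 0 x = 0.
  move=> x0; have := Elin (-1) 0 0 x x0.
  by rewrite scaler0 add0r mulN1r addNr.
have EZ z u x : x \in `[0, pi] -> E (z *: u) x = z * E u x.
  by move=> x0; have := Elin z u 0 x x0; rewrite !addr0 E0 // addr0.
have ED u v x : x \in `[0, pi] -> E (u + v) x = E u x + E v x.
  by move=> x0; have := Elin 1 u v x x0; rewrite scale1r mul1r.
have /choice [U hU] i : exists u, (u <= W)%MS /\
    forall x, x \in `[0, pi] -> e i x = E u x by apply/VE/Ve.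
pose M : 'M[R[i]]_(d, n) := \matrix_i U i.
have EM (c : 'rV_d) x : x \in `[0, pi] ->
    E (c *m M) x = \sum_i c 0 i * e i x.
  move=> x0; rewrite mulmx_sum_row.
  have -> : \sum_i c 0 i *: row i M = \sum_i c 0 i *: U i.
    by apply: eq_bigr => i _; rewrite rowK.
  rewrite (big_morph (fun u => E u x) (id1 := 0) (op1 := +%R)).
  - by apply: eq_bigr => i _; rewrite EZ // (hU i).2.
  - by move=> u v; rewrite ED.
  - exact: E0.
have Mfree : row_free M.
  rewrite -kermx_eq0; apply/eqP/row_matrixP => i; rewrite row0.
  apply/rowP => j; rewrite [RHS]mxE.
  apply: (efree (fun j => row i (kermx M) 0 j)) => x x0.
  rewrite -EM // (_ : row i (kermx M) *m M = 0) ?E0 //.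
  by apply/sub_kermxP; exact: row_sub.
have MW : (M == W)%MS.
  apply/andP; split; apply/row_subP => i; first by rewrite rowK (hU i).1.
  have [|c hc] := espan (E (row i W)).
    by apply/VE; exists (row i W); split => //; exact: row_sub.
  apply/submxP; exists (\row_j c j); apply/eqP; rewrite -subr_eq0; apply/eqP.
  apply: Einj => x x0; rewrite -scaleN1r ED // EZ // EM // hc //.
  by under [X in -1 * X]eq_bigr do rewrite mxE; rewrite mulN1r subrr.
by rewrite -(eqmx_rank MW) ; apply/eqP; rewrite eq_sym.
Qed.

(** * Integration by parts for absolutely continuous functions *)

Section RealIntegrals.
Variable R : realType.
Local Notation mu := (@lebesgue_measure R).
Implicit Types (f g h : R -> R) (a b x y K : R).

(** On N equal pieces the increments of F add up to at most (b - a) (m b - m a)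
    / N, which tends to 0. *)
Lemma eq_of_product_increments (F m : R -> R) a b : a <= b ->
  (forall x y, a <= x -> x <= y -> y <= b ->
     `|F y - F x| <= (y - x) * (m y - m x)) -> F b = F a.
Proof.
move=> ab h; apply/eqP; rewrite -subr_eq0 -normr_le0.
have H N : `|F b - F a| <= (b - a) * (m b - m a) / N.+1%:R.
  have N0 : (0 : R) < N.+1%:R by [].
  pose t i := a + (b - a) * (i%:R / N.+1%:R).
  have tb : t N.+1 = b by rewrite /t divff ?gt_eqF //; ring.
  have t0 : t 0%N = a by rewrite /t mul0r mulr0 addr0.
  have tS i : t i.+1 - t i = (b - a) / N.+1%:R.
    by rewrite /t -natr1; field; rewrite gt_eqF // addrC natr1.
  have d0 : 0 <= (b - a) / N.+1%:R by rewrite divr_ge0 ?subr_ge0 // ltW.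
  have tm i : t i <= t i.+1 by rewrite -subr_ge0 tS.
  have ta i : a <= t i.
    by rewrite /t lerDl mulr_ge0 ?subr_ge0 // divr_ge0.
  have tle i : (i <= N.+1)%N -> t i <= b.
    move=> iN; rewrite -tb /t lerD2l ler_wpM2l ?subr_ge0 //.
    by rewrite ler_wpM2r ?invr_ge0 // ler_nat.
  have : forall i, (i <= N.+1)%N ->
      `|F (t i) - F a| <= (b - a) / N.+1%:R * (m (t i) - m a).
    elim=> [_|i IH iN]; first by rewrite t0 !subrr normr0 mulr0.
    rewrite -(subrK (F (t i)) (F (t i.+1))) -addrA.
    apply: (le_trans (ler_normD _ _)).
    apply: (le_trans (lerD (h _ _ (ta i) (tm i) (tle _ iN)) (IH (ltnW iN)))).
    by rewrite tS -mulrDr addrA subrK.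
  move=> /(_ N.+1 (leqnn _)); rewrite tb; move/le_trans; apply.
  by rewrite mulrAC.
rewrite leNgt; apply/negP => p0.
pose M := (b - a) * (m b - m a) / `|F b - F a|.
have := H (Num.trunc M); rewrite ler_pdivlMr // leNgt => /negP; apply.
by rewrite -ltr_pdivrMl // mulrC; exact: truncnS_gt.
Qed.

Lemma integrable_sub (A B : set (measurableTypeR R)) f : measurable A -> measurable B -> A `<=` B ->
  mu.-integrable B (EFin \o f) -> mu.-integrable A (EFin \o f).
Proof. by move=> mA mB AB; apply: integrableS. Qed.

Lemma sub_oc x y : 0 <= x -> y <= pi -> `]x, y] `<=` `[0, (pi : R)].
Proof.
move=> x0 yp t /=; rewrite !in_itv /= => /andP[xt ty].
by rewrite (le_trans x0 (ltW xt)) (le_trans ty yp).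
Qed.
Lemma sub_cc y : y <= pi -> `[0, y] `<=` `[0, (pi : R)].
Proof.
move=> yp t /=; rewrite !in_itv /= => /andP[xt ty].
by rewrite xt (le_trans ty yp).
Qed.

Lemma Rint_diff f x y : mu.-integrable `[0, pi] (EFin \o f) ->
  0 <= x -> x <= y -> y <= pi ->
  \int[mu]_(t in `[0, y]) f t - \int[mu]_(t in `[0, x]) f t
  = \int[mu]_(t in `]x, y]) f t.
Proof.
move=> fi x0 xy yp; apply: Rintegral_itvB.
- by apply: integrable_sub fi => //; exact: sub_cc.
- by rewrite bnd_simp.
- by rewrite bnd_simp.
Qed.

Lemma integrable_mul_bounded (D : set (measurableTypeR R)) f g K : measurable D ->
  mu.-integrable D (EFin \o f) ->
  measurable_fun D g -> (forall x, D x -> `|g x| <= K) ->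
  mu.-integrable D (EFin \o (fun x => f x * g x)).
Proof.
move=> mD fi mg gK.
have := @integrableMl _ _ _ mu D mD _ g fi mg.
apply; exists K; split; first exact: num_real.
by move=> M KM x Dx; apply: (le_trans (gK x Dx)); exact: ltW.
Qed.

Lemma itg_add (D : set (measurableTypeR R)) f g : measurable D ->
  mu.-integrable D (EFin \o f) -> mu.-integrable D (EFin \o g) ->
  mu.-integrable D (EFin \o (fun x => f x + g x)).
Proof. by move=> mD fi gi; have := integrableD mD fi gi. Qed.

Lemma itg_sub (D : set (measurableTypeR R)) f g : measurable D ->
  mu.-integrable D (EFin \o f) -> mu.-integrable D (EFin \o g) ->
  mu.-integrable D (EFin \o (fun x => f x - g x)).
Proof. by move=> mD fi gi; have := integrableB mD fi gi. Qed.

Lemma itg_scale (D : set (measurableTypeR R)) (k : R) f : measurable D ->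
  mu.-integrable D (EFin \o f) ->
  mu.-integrable D (EFin \o (fun x => k * f x)).
Proof. by move=> mD fi; have := integrableZl mD k fi. Qed.

Lemma Rint_le_bound (D : set (measurableTypeR R)) f g : measurable D ->
  mu.-integrable D (EFin \o f) -> mu.-integrable D (EFin \o g) ->
  (forall x, D x -> `|f x| <= g x) ->
  `|\int[mu]_(x in D) f x| <= \int[mu]_(x in D) g x.
Proof.
move=> mD fi gi h; have := le_normr_Rintegral mD fi. move=> /le_trans; apply.
apply: le_Rintegral => //.
by have := integrable_norm fi.
Qed.

Lemma Rint_cst_oc x y K : x <= y -> \int[mu]_(t in `]x, y]) K = K * (y - x).
Proof.
move=> xy; rewrite Rintegral_cst //= lebesgue_measure_itv /= lte_fin.
case: ltP => // yx; have -> : x = y by apply/eqP; rewrite eq_le xy.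
by rewrite subrr.
Qed.

Lemma deriv_diff g (dg : R -> R) x y : x <= y ->
  (forall t, is_derive t (1 : R) g (dg t)) -> continuous dg ->
  \int[mu]_(t in `]x, y]) dg t = g y - g x.
Proof.
rewrite le_eqVlt => /predU1P[<-|xy] hg cg.
  by rewrite set_itvoc0 Rintegral_set0 subrr.
have cw : {within `[x, y], continuous dg} by exact: continuous_subspaceT.
have ci : mu.-integrable `[x, y] (EFin \o dg).
  by apply: continuous_compact_integrable => //; exact: segment_compact.
rewrite Rintegral_itv_obnd_cbnd; last first.
  by apply: integrable_sub ci => // t /=; rewrite !in_itv /= => /andP[/ltW -> ->].
have cg' : continuous g.
  move=> t; apply: differentiable_continuous; apply/derivable1_diffP.
  exact: (@ex_derive _ _ _ _ _ _ _ (hg t)).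
rewrite /Rintegral (@continuous_FTC2 _ dg g x y) //.
  split.
  - by move=> t _; exact: (@ex_derive _ _ _ _ _ _ _ (hg t)).
  - by apply: cvg_at_right_filter; exact: cg'.
  - by apply: cvg_at_left_filter; exact: cg'.
move=> t _; rewrite derive1E; exact: (@derive_val _ _ _ _ _ _ _ (hg t)).
Qed.

Lemma deriv_lip g (dg : R -> R) K x y : (forall t, is_derive t (1 : R) g (dg t)) ->
  (forall t, `|dg t| <= K) -> `|g y - g x| <= K * `|y - x|.
Proof.
move=> hg hK; wlog xy : x y / x < y => [H|].
  have [xy|yx|->] := ltgtP x y; first exact: H.
    by rewrite distrC (distrC y); exact: H.
  by rewrite !subrr normr0 mulr0.
have cg' : continuous g.
  move=> t; apply: differentiable_continuous; apply/derivable1_diffP.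
  exact: (@ex_derive _ _ _ _ _ _ _ (hg t)).
have [|c _ ->] := @MVT _ g dg _ _ xy (fun t _ => hg t).
  exact: continuous_subspaceT.
by rewrite normrM ler_wpM2r.
Qed.

Lemma AC_continuous f h : mu.-integrable `[0, pi] (EFin \o h) ->
  (forall x, x \in `[0, (pi : R)] -> f x = f 0 + \int[mu]_(t in `[0, x]) h t) ->
  {within `[0, pi], continuous f}.
Proof.
move=> hi fE; have c := parameterized_integral_continuous (pi_ge0 R) hi.
have : {within `[0, pi], continuous (fun x : R => f 0 + \int[mu]_(t in `[0, x]) h t)}.
  apply: (@within_continuousD _ R R _ (cst (f 0))); last exact: c.
  exact: (continuous_subspaceT (@cst_continuous _ _ _)).
apply: subspace_eq_continuous => x /set_mem xJ; rewrite /=; symmetry; exact: fE.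
Qed.

Lemma cont_measurable f : {within `[0, pi], continuous f} ->
  measurable_fun (`[0, (pi : R)] : set (measurableTypeR R)) f.
Proof. by move=> c; apply: subspace_continuous_measurable_fun. Qed.

Lemma cont_itg f : {within `[0, pi], continuous f} ->
  mu.-integrable `[0, (pi : R)] (EFin \o f).
Proof.
by move=> c; apply: continuous_compact_integrable => //; exact: segment_compact.
Qed.

Lemma cont_bounded f : {within `[0, pi], continuous f} ->
  exists2 K, 0 <= K & forall x, x \in `[0, (pi : R)] -> `|f x| <= K.
Proof.
move=> c.
have c' : {within `[0, (pi : R)], continuous (fun x => `|f x|)}.
  move=> x; apply: continuous_comp; [exact: c | exact: norm_continuous].
have [y yJ hy] := EVT_max (pi_ge0 R) c'.
by exists `|f y|.
Qed.

(** Only integrability of h is available, so the product rule is replaced by an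
    increment estimate. The difference of the two sides on [0, x] changes
    between x and y by the integral of h (g - g y) + (H - H x) dg, of
    modulus at most 2 K (y - x) times the integral of |h| over ]x, y]. *)
Lemma integration_by_parts_ac h (H : R -> R) g (dg : R -> R) K :
  mu.-integrable `[0, pi] (EFin \o h) ->
  (forall x, x \in `[0, (pi : R)] -> H x = H 0 + \int[mu]_(t in `[0, x]) h t) ->
  (forall t, is_derive t (1 : R) g (dg t)) -> continuous dg -> (forall t, `|dg t| <= K) ->
  \int[mu]_(t in `[0, pi]) (h t * g t) =
  H pi * g pi - H 0 * g 0 - \int[mu]_(t in `[0, pi]) (H t * dg t).
Proof.
move=> hi HE hg cdg dgK.
have cH := AC_continuous hi HE.
have Hi := cont_itg cH.
have cg : continuous g.
  move=> t; apply: differentiable_continuous; apply/derivable1_diffP.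
  exact: (@ex_derive _ _ _ _ _ _ _ (hg t)).
have [K1 _ gK] := cont_bounded (continuous_subspaceT cg).
have mg : measurable_fun (`[0, (pi : R)] : set (measurableTypeR R)) g.
  by apply: cont_measurable; exact: continuous_subspaceT.
have mdg : measurable_fun (`[0, (pi : R)] : set (measurableTypeR R)) dg.
  by apply: cont_measurable; exact: continuous_subspaceT.
have hgi : mu.-integrable `[0, pi] (EFin \o (fun t => h t * g t)).
  by apply: (@integrable_mul_bounded _ _ _ K1).
have Hdgi : mu.-integrable `[0, pi] (EFin \o (fun t => H t * dg t)).
  by apply: (@integrable_mul_bounded _ _ _ K).
have nhi : mu.-integrable `[0, pi] (EFin \o (fun t => `|h t|)) by have := integrable_norm hi.
have K0 : 0 <= K by apply: le_trans (dgK 0).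
(* The defect of the formula on [0, x], to be shown constant. *)
pose Phi x := \int[mu]_(t in `[0, x]) (h t * g t) - H x * g x +
   \int[mu]_(t in `[0, x]) (H t * dg t).
pose m x := 2 * K * \int[mu]_(t in `[0, x]) `|h t|.
suff : Phi pi = Phi 0.
  rewrite /Phi set_itv1 !Rintegral_set1; lra.
apply: (@eq_of_product_increments Phi m) => [|x y x0 xy yp]; first exact: pi_ge0.
have mxy : measurable (`]x, y] : set (measurableTypeR R)) by [].
have sxy := sub_oc x0 yp.
have hi' := integrable_sub mxy (measurable_itv _) sxy hi.
have nhi' := integrable_sub mxy (measurable_itv _) sxy nhi.
have Hi' := integrable_sub mxy (measurable_itv _) sxy Hi.
have hgi' := integrable_sub mxy (measurable_itv _) sxy hgi.
have Hdgi' := integrable_sub mxy (measurable_itv _) sxy Hdgi.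
have xJ : x \in `[0, (pi : R)] by rewrite in_itv /= x0 (le_trans xy).
have yJ : y \in `[0, (pi : R)] by rewrite in_itv /= yp (le_trans x0).
have dH : H y - H x = \int[mu]_(t in `]x, y]) h t.
  by rewrite (HE _ yJ) (HE _ xJ) -(Rint_diff hi x0 xy yp); ring.
have dgi' : mu.-integrable `]x, y] (EFin \o dg).
  apply: (integrable_sub mxy (measurable_itv _) sxy).
  by apply: cont_itg; exact: continuous_subspaceT.
have gi' k : mu.-integrable `]x, y] (EFin \o (fun t => h t * k)).
  by apply: (@integrable_mul_bounded _ _ _ `|k|) => //; exact: measurable_cst.
have dgi2 k : mu.-integrable `]x, y] (EFin \o (fun t => k * dg t)).
  have -> : (fun t => k * dg t) = (fun t => dg t * k) by apply/funext => t; rewrite mulrC.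
  by apply: (@integrable_mul_bounded _ _ _ `|k|) => //; exact: measurable_cst.
set D := \int[mu]_(t in `]x, y]) `|h t|.
have E : Phi y - Phi x = \int[mu]_(t in `]x, y]) (h t * g t - h t * g y) +
   \int[mu]_(t in `]x, y]) (H t * dg t - H x * dg t).
  rewrite !RintegralB // RintegralZr // RintegralZl // -dH (deriv_diff xy hg cdg).
  by rewrite -(Rint_diff hgi x0 xy yp) -(Rint_diff Hdgi x0 xy yp) /Phi; ring.
have mD : m y - m x = 2 * K * D by rewrite /m -mulrBr (Rint_diff nhi x0 xy yp).
rewrite E mD; apply: (le_trans (ler_normD _ _)).
have -> : (y - x) * (2 * K * D) = D * (K * (y - x)) + D * K * (y - x) by ring.
apply: lerD.
  rewrite -(RintegralZr _ mxy nhi'); apply: Rint_le_bound => //.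
  - by have := integrableB mxy hgi' (gi' (g y)).
  - by apply: (@integrable_mul_bounded _ _ _ `|K * (y - x)|) => //; exact: measurable_cst.
  move=> t /=; rewrite in_itv /= => /andP[xt ty].
  rewrite -mulrBr normrM ler_wpM2l //; apply: (le_trans (deriv_lip _ _ hg dgK)).
  rewrite ler_wpM2l // distrC ger0_norm ?subr_ge0 //; lra.
rewrite -(Rint_cst_oc _ xy); apply: Rint_le_bound => //.
- by have := integrableB mxy Hdgi' (dgi2 (H x)).
- by apply: measurable_bounded_integrable => //; last exact: bounded_cst;
    rewrite /= lebesgue_measure_itv /=; case: ifP; rewrite ?ltry.
move=> t /=; rewrite in_itv /= => /andP[xt ty].
rewrite -mulrBl normrM; apply: ler_pM => //.
have tp : t <= pi by apply: le_trans yp.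
have tJ : t \in `[0, (pi : R)] by rewrite in_itv /= tp (le_trans x0 (ltW xt)).
have -> : H t - H x = \int[mu]_(t in `]x, t]) h t.
  by rewrite (HE _ tJ) (HE _ xJ) -(Rint_diff hi x0 (ltW xt) tp); ring.
have mxt : measurable (`]x, t] : set (measurableTypeR R)) by [].
have sxt := sub_oc x0 tp.
apply: (le_trans (le_normr_Rintegral mxt (integrable_sub mxt (measurable_itv _) sxt hi))).
rewrite /D -(Rint_diff nhi x0 xy yp) -(Rint_diff nhi x0 (ltW xt) tp) lerD2r -subr_ge0.
have t0 : 0 <= t by apply: le_trans (ltW xt).
rewrite (Rint_diff nhi t0 ty yp); exact: Rintegral_ge0.
Qed.

End RealIntegrals.

(** * Completeness of the two sine systems *)

Section Completeness.
Variable R : realType.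
Local Notation mu := (@lebesgue_measure R).
Implicit Types (f g h : R -> R) (x y : R) (b : bool).

(** The boolean selects the boundary conditions: false for Dirichlet, true for
    Dirichlet-Neumann. *)
Definition theta b : R := if b then 2^-1 else 0.
Definition omega b j : R := freq (theta b) j.
Definition sine b j x : R := sin (omega b j * x).
Definition cosine b j x : R := cos (omega b j * x).

Lemma theta_ge0 b : 0 <= theta b.
Proof. by rewrite /theta; case: b; rewrite ?lexx ?invr_ge0. Qed.
Lemma theta_le b : theta b <= 2^-1.
Proof. by rewrite /theta; case: b; rewrite ?lexx ?invr_ge0. Qed.

Lemma omega_gt0 b j : 0 < omega b j.
Proof. exact: (freq_gt0 (theta_ge0 b) (theta_le b)). Qed.

Lemma sine_derive b j x : is_derive x (1 : R) (sine b j) (omega b j * cosine b j x).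
Proof.
rewrite /sine /cosine.
have h : is_derive x (1 : R) (fun y : R => omega b j * y) (omega b j).
  have := @is_deriveZ _ _ _ (@id R) (omega b j) x 1 1 (is_derive_id _ _).
  by rewrite /GRing.scale /= mulr1.
have := is_derive1_comp (is_derive_sin (omega b j * x)) h.
by rewrite mulrC.
Qed.

Lemma cosine_derive b j x : is_derive x (1 : R) (cosine b j) (- omega b j * sine b j x).
Proof.
rewrite /sine /cosine.
have h : is_derive x (1 : R) (fun y : R => omega b j * y) (omega b j).
  have := @is_deriveZ _ _ _ (@id R) (omega b j) x 1 1 (is_derive_id _ _).
  by rewrite /GRing.scale /= mulr1.
have := is_derive1_comp (is_derive_cos (omega b j * x)) h.
by rewrite mulNr mulrC mulNr.
Qed.

Lemma derive_continuous g (dg : R -> R) :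
  (forall t, is_derive t (1 : R) g (dg t)) -> continuous g.
Proof.
move=> hg t; apply: differentiable_continuous; apply/derivable1_diffP.
exact: (@ex_derive _ _ _ _ _ _ _ (hg t)).
Qed.

Lemma sine_cont b j : continuous (sine b j).
Proof. exact: derive_continuous (sine_derive b j). Qed.
Lemma cosine_cont b j : continuous (cosine b j).
Proof. exact: derive_continuous (cosine_derive b j). Qed.

Lemma sine_le1 b j x : `|sine b j x| <= 1.
Proof. by rewrite /sine ler_norml sin_geN1 sin_le1. Qed.
Lemma cosine_le1 b j x : `|cosine b j x| <= 1.
Proof. by rewrite /cosine ler_norml cos_geN1 cos_le1. Qed.

Lemma sine_at0 b j : sine b j 0 = 0.
Proof. by rewrite /sine mulr0 sin0. Qed.

Lemma sin_nat_pi (n : nat) : sin (n%:R * pi) = 0 :> R.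
Proof.
elim: n => [|n IH]; first by rewrite mul0r sin0.
by rewrite -natr1 mulrDl mul1r sinDpi IH oppr0.
Qed.

Lemma sine_at_pi j : sine false j pi = 0.
Proof. by rewrite /sine /omega /freq /= subr0 sin_nat_pi. Qed.

Lemma cosine_at_pi j : cosine true j pi = 0.
Proof.
rewrite /cosine /omega /freq /= (_ : _ * _ = j%:R * pi + pi / 2); last first.
  by rewrite -[j.+1%:R]natr1; field.
by rewrite cosD cos_pihalf sin_nat_pi mulr0 mul0r subr0.
Qed.

Lemma sine_cosM b j x : sine b j.+1 x * cos x = 2^-1 * (sine b j.+2 x + sine b j x).
Proof.
rewrite /sine /omega /freq.
have -> : (j.+3%:R - theta b) * x = (j.+2%:R - theta b) * x + x.
  by rewrite -[j.+3%:R]natr1; ring.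
have -> : (j.+1%:R - theta b) * x = (j.+2%:R - theta b) * x - x.
  by rewrite -[j.+2%:R]natr1; ring.
by rewrite sinD sinB; field.
Qed.

(** The mode of index -1 is 0 for Dirichlet conditions and the opposite of the
    mode of index 0 for Dirichlet-Neumann conditions. *)
Lemma sine_cosM0 b x : sine b 0 x * cos x =
  2^-1 * (sine b 1 x - (if b then sine b 0 x else 0)).
Proof.
rewrite /sine /omega /freq.
have -> : (2 - theta b) * x = (1 - theta b) * x + x by ring.
rewrite sinD; case: b => /=; last first.
  by rewrite !subr0 mul1r mulrC; field.
have -> : (1 - 2^-1) * x = x / 2 by field.
have h : sin (x / 2) = sin x * cos (x / 2) - cos x * sin (x / 2).
  by rewrite -sinB; congr sin; field.
by rewrite {3}h; field.
Qed.

Lemma mul_cont_itg f g : mu.-integrable `[0, pi] (EFin \o f) -> continuous g ->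
  mu.-integrable `[0, (pi : R)] (EFin \o (fun x => f x * g x)).
Proof.
move=> fi cg; have [K _ gK] := cont_bounded (continuous_subspaceT cg).
apply: (@integrable_mul_bounded _ _ _ _ K) => //.
by apply: cont_measurable; exact: continuous_subspaceT.
Qed.

Lemma continuous_horner_cos (P : {poly R}) : continuous (fun x : R => P.[cos x]).
Proof.
move=> x; apply: continuous_comp; first exact: continuous_cos.
exact: continuous_horner.
Qed.

(** Multiplication by cos x maps each sine mode to a combination of its
    neighbours, so orthogonality to all modes is inherited by all products
    of a mode and a polynomial in cos x. *)
Lemma orthogonal_poly_cos b f : mu.-integrable `[0, pi] (EFin \o f) ->
  (forall j, \int[mu]_(x in `[0, pi]) (f x * sine b j x) = 0) ->
  forall (P : {poly R}) j,
  \int[mu]_(x in `[0, pi]) (f x * (sine b j x * P.[cos x])) = 0.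
Proof.
move=> fi h.
have mJ : measurable (`[0, pi] : set (measurableTypeR R)) by [].
have ci j (P : {poly R}) : mu.-integrable `[0, (pi : R)]
    (EFin \o (fun x => f x * (sine b j x * P.[cos x]))).
  apply: mul_cont_itg => // x; apply: continuousM; first exact: sine_cont.
  exact: continuous_horner_cos.
have si j : mu.-integrable `[0, (pi : R)] (EFin \o (fun x => f x * sine b j x)).
  by apply: mul_cont_itg => //; exact: sine_cont.
have cli (k : R) j (P : {poly R}) : mu.-integrable `[0, (pi : R)]
    (EFin \o (fun x => k * (f x * (sine b j x * P.[cos x])))).
  have := ci j (k *: P); congr (mu.-integrable _ (EFin \o _)).
  by apply/funext => x; rewrite hornerZ; ring.
elim/poly_ind => [|P c IH] j.
  under eq_Rintegral do rewrite horner0 !mulr0.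
  by rewrite Rintegral_cst // mul0r.
have csi : mu.-integrable `[0, (pi : R)] (EFin \o (fun x => c * (f x * sine b j x))).
  have := ci j c%:P; congr (mu.-integrable _ (EFin \o _)).
  by apply/funext => x; rewrite hornerC; ring.
case: j => [|j] in csi *.
  under eq_Rintegral => x _.
    rewrite hornerMXaddC (_ : f x * _ = 2^-1 * (f x * (sine b 1 x * P.[cos x]))
     + ((if b then - 2^-1 else 0) * (f x * (sine b 0 x * P.[cos x])) + c * (f x * sine b 0 x)));
       last first.
      rewrite (_ : f x * _ = f x * (sine b 0 x * cos x) * P.[cos x]
        + c * (f x * sine b 0 x)); last by ring.
      by rewrite sine_cosM0; case: (b); field.
    over.
  rewrite RintegralD //; last first.
    exact: itg_add.
  rewrite RintegralD // !RintegralZl // !IH h !mulr0 !addr0 //.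
under eq_Rintegral => x _.
  rewrite hornerMXaddC (_ : f x * _ = 2^-1 * (f x * (sine b j.+2 x * P.[cos x]))
   + (2^-1 * (f x * (sine b j x * P.[cos x])) + c * (f x * sine b j.+1 x)));
     last first.
    rewrite (_ : f x * _ = f x * (sine b j.+1 x * cos x) * P.[cos x]
      + c * (f x * sine b j.+1 x)); last by ring.
    by rewrite sine_cosM; field.
  over.
rewrite RintegralD //; last first.
  exact: itg_add.
by rewrite RintegralD // !RintegralZl // !IH h !mulr0 !addr0.
Qed.

Lemma sine_0_gt0 b x : 0 < x -> x < pi -> 0 < sine b 0 x.
Proof.
move=> x0 xp; apply: sin_gt0_pi; rewrite ?mulr_gt0 ?omega_gt0 //.
apply: le_lt_trans xp; rewrite ler_piMl ?(ltW x0) //.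
by rewrite /omega /freq; have := theta_ge0 b; lra.
Qed.

Lemma cos_lt x y : 0 <= x -> x < y -> y <= pi -> cos y < cos x.
Proof.
move=> x0 xy yp; rewrite ltr_cos ?in_itv //= ?x0 ?yp ?andbT ?(le_trans x0 (ltW xy)) //.
exact: le_trans (ltW xy) yp.
Qed.

Lemma cos_le x y : 0 <= x -> x <= y -> y <= pi -> cos y <= cos x.
Proof.
by move=> x0; rewrite le_eqVlt => /predU1P[->//|xy yp]; exact/ltW/cos_lt.
Qed.

(** If f were positive at x1, integrate f times the lowest mode against the k-th
    power of P(cos x) = 1 - (cos x - cos x1)^2 / 4. This kernel concentrates
    at x1 as k grows, so the integral would become positive, although it
    vanishes by orthogonality. *)
Lemma orthogonal_le0 b f : {within `[0, pi], continuous f} ->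
  (forall j, \int[mu]_(x in `[0, pi]) (f x * sine b j x) = 0) ->
  forall x, 0 < x -> x < pi -> f x <= 0.
Proof.
move=> cf h x1 x10 x1p; rewrite leNgt; apply/negP => f0.
have fi := cont_itg cf.
have mJ : measurable (`[0, pi] : set (measurableTypeR R)) by [].
pose F x := f x * sine b 0 x.
have F0 : 0 < F x1 by rewrite mulr_gt0 // sine_0_gt0.
have cfx : {for x1, continuous f}.
  have /(continuous_within_itvP _ (pi_gt0 R)) [c _ _] := cf.
  by apply: c; rewrite in_itv /= x10.
have cFx : {for x1, continuous F}.
  by apply: continuousM => //; exact: sine_cont.
pose eta := F x1 / 2.
have eta0 : 0 < eta by rewrite divr_gt0.
have [d d0 hd] : exists2 d, 0 < d & forall x, `|x1 - x| < d -> eta <= F x.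
  move/cvgrPdist_le : cFx => /(_ _ eta0) /nbhs_ballP [d /= d0 hd].
  exists d => // x xd; have := hd x xd; rewrite /= ler_norml => /andP[_].
  by rewrite /eta; lra.
(* F >= eta within dl of x1; cos is at distance at least gm from cos x1 outside that
   neighbourhood, and at most gm / 2 within d'. *)
pose dl := Num.min (d / 2) (Num.min (x1 / 2) ((pi - x1) / 2)).
have dl0 : 0 < dl.
  by rewrite !lt_min !divr_gt0 // subr_gt0.
have dld : dl < d by rewrite gt_min; apply/orP; left; lra.
have [dlx dlp] : dl <= x1 / 2 /\ dl <= (pi - x1) / 2.
  by split; rewrite !ge_min lexx ?orbT.
have inJ x : 0 <= x -> x <= pi -> x \in `[0, (pi : R)] by rewrite in_itv /= => -> ->.
pose gm := Num.min 1 (Num.min (cos (x1 - dl) - cos x1) (cos x1 - cos (x1 + dl))).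
have gm0 : 0 < gm.
  by rewrite !lt_min ltr01 !subr_gt0 !cos_lt //; lra.
have gm1 : gm <= 1 by rewrite ge_min lexx.
have [gm2 gm3] : gm <= cos (x1 - dl) - cos x1 /\ gm <= cos x1 - cos (x1 + dl).
  by split; rewrite !ge_min lexx ?orbT.
have out x : 0 <= x -> x <= pi -> dl <= `|x1 - x| -> gm <= `|cos x - cos x1|.
  move=> x0 xp; have [xx|xx] := leP x x1.
    rewrite ger0_norm ?subr_ge0 // => hx; apply: (le_trans gm2).
    apply: (le_trans _ (ler_norm _)); rewrite lerD2r cos_le //; lra.
  rewrite ler0_norm ?subr_le0 ?(ltW xx) // => hx; apply: (le_trans gm3).
  rewrite distrC; apply: (le_trans _ (ler_norm _)).
  rewrite lerD2l lerN2 cos_le //; lra.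
pose d' := Num.min dl (gm / 2).
have d'0 : 0 < d' by rewrite lt_min dl0 divr_gt0.
have [d'1 d'2] : d' <= dl /\ d' <= gm / 2 by split; rewrite ge_min lexx ?orbT.
clearbody d'; clearbody gm dl eta.
have inn x : `|x1 - x| <= d' -> `|cos x - cos x1| <= gm / 2.
  move=> hx; apply: le_trans d'2; apply: le_trans hx; rewrite (distrC x1).
  have lip := @deriv_lip _ cos (fun t => - sin t) 1 x1 x (@is_derive_cos R).
  apply: (le_trans (lip _)); last by rewrite mul1r.
  by move=> t; rewrite normrN ler_norml sin_geN1 sin_le1.
pose P : {poly R} := 1 - 4^-1 *: ('X - (cos x1)%:P) ^+ 2.
have PE x : P.[cos x] = 1 - 4^-1 * (cos x - cos x1) ^+ 2.
  by rewrite /P !hornerE.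
have P0 x : 0 <= P.[cos x].
  rewrite PE subr_ge0 ler_pdivrMl // mulr1.
  have -> : (4 : R) = 2 ^+ 2 by rewrite expr2; ring.
  rewrite -[leLHS]real_normK ?num_real // lerXn2r ?nnegrE //.
  apply: (le_trans (ler_normB _ _)); rewrite (_ : 2 = 1 + 1) //.
  by rewrite lerD // ler_norml cos_geN1 cos_le1.
(* The kernel is at most rho away from x1 and at least rho' > rho close to x1. *)
pose rho := 1 - 4^-1 * gm ^+ 2.
pose rho' := 1 - 4^-1 * (gm / 2) ^+ 2.
have rho0 : 0 <= rho.
  by rewrite /rho subr_ge0; have : gm ^+ 2 <= 1 by [rewrite expr_le1 // ltW]; lra.
have rr : rho < rho'.
  rewrite /rho /rho'; have : 0 < gm ^+ 2 by rewrite exprn_gt0.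
  by rewrite exprMn [X in X * _]lock expr2 -lock => ?; lra.
have rho'0 : 0 < rho' by apply: le_lt_trans rr.
have [Bd Bd0 hB] := cont_bounded cf.
have FB x : x \in `[0, (pi : R)] -> `|F x| <= Bd.
  move=> xJ; rewrite normrM; apply: le_trans (hB x xJ).
  by rewrite ler_piMr // sine_le1.
(* The contributions near x1 and away from x1 balance, since the integral vanishes. *)
have key k : eta * rho' ^+ k * (2 * d') <= Bd * rho ^+ k * pi.
  have PkE x : (P ^+ k).[cos x] = P.[cos x] ^+ k by rewrite horner_exp.
  have Fi : mu.-integrable `[0, (pi : R)]
      (EFin \o (fun x => f x * (sine b 0 x * (P ^+ k).[cos x]))).
    apply: mul_cont_itg => // x; apply: continuousM; first exact: sine_cont.
    exact: continuous_horner_cos.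
  have cI (D : set (measurableTypeR R)) (K : R) : measurable D -> D `<=` `[0, (pi:R)] ->
      mu.-integrable D (EFin \o (fun _ : R => K)).
    move=> mD DJ; apply: (integrable_sub mD mJ DJ).
    by apply: cont_itg; apply: continuous_subspaceT => ?; exact: cst_continuous.
    (* Adding the bound of the outer part makes the integrand nonnegative, so that its
     integral over a subinterval is a lower bound. *)
pose G x := f x * (sine b 0 x * (P ^+ k).[cos x]) + Bd * rho ^+ k.
  have Gi : mu.-integrable `[0, (pi : R)] (EFin \o G).
    by apply: itg_add => //; exact: cI.
  have Gint : \int[mu]_(x in `[0, pi]) G x = Bd * rho ^+ k * pi.
    rewrite RintegralD //; last exact: cI.
    rewrite (orthogonal_poly_cos fi h (P ^+ k) 0%N) add0r Rintegral_cst //=.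
    by rewrite lebesgue_measure_itv /= lte_fin pi_gt0 /= subr0.
  have BR0 : 0 <= Bd * rho ^+ k by rewrite mulr_ge0 // exprn_ge0.
  have FE x : f x * (sine b 0 x * (P ^+ k).[cos x]) = F x * P.[cos x] ^+ k.
    by rewrite PkE mulrA.
  have G0 x : x \in `[0, (pi : R)] -> 0 <= G x.
    move=> xJ; rewrite /G FE; have [xd|xd] := ltP `|x1 - x| dl.
      rewrite addr_ge0 // mulr_ge0 ?exprn_ge0 // (le_trans (ltW eta0)) // hd //.
      exact: lt_trans dld.
    rewrite -lerBlDr sub0r lerNl; apply: (le_trans (ler_norm _)).
    rewrite normrN normrM ler_pM // ?FB // normrX.
    rewrite ler_exp // ger0_norm // PE /rho lerD2l lerN2 ler_wpM2l ?invr_ge0 //.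
    rewrite -[leRHS]real_normK ?num_real // ler_exp ?(ltW gm0) //.
    by move: xJ; rewrite in_itv /= => /andP[? ?]; exact: out.
  have xa : 0 <= x1 - d' by lra.
  have xb : x1 + d' <= pi by lra.
  have xab : x1 - d' <= x1 + d' by lra.
  have mab : measurable (`]x1 - d', x1 + d'] : set (measurableTypeR R)) by [].
  have sab := sub_oc xa xb.
  have low : eta * rho' ^+ k * (2 * d') <= \int[mu]_(x in `]x1 - d', x1 + d']) G x.
    rewrite (_ : 2 * d' = (x1 + d') - (x1 - d')); last by ring.
    rewrite -Rint_cst_oc //; apply: le_Rintegral => //; first exact: cI.
      exact: (integrable_sub mab mJ sab).
    move=> x /=; rewrite in_itv /= => /andP[xl xr].
    have xd' : `|x1 - x| <= d' by rewrite ler_norml; lra.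
    apply: (@le_trans _ _ (F x * P.[cos x] ^+ k)); last by rewrite /G FE lerDl.
    rewrite ler_pM ?(ltW eta0) ?exprn_ge0 ?(ltW rho'0) //.
      by apply: hd; apply: le_lt_trans dld; apply: le_trans d'1.
    rewrite ler_exp ?(ltW rho'0) // PE /rho' lerD2l lerN2 ler_wpM2l ?invr_ge0 //.
    by rewrite -[leLHS]real_normK ?num_real // ler_exp // inn.
  apply: (le_trans low); rewrite -(Rint_diff Gi xa xab xb) -Gint.
  have x1d : 0 <= x1 + d' by lra.
  have := Rint_diff Gi x1d xb (lexx _).
  have : 0 <= \int[mu]_(t in `]x1 + d', pi]) G t.
    by apply: Rintegral_ge0 => t /(sub_oc x1d (lexx _)); exact: G0.
  have : 0 <= \int[mu]_(t in `[0, x1 - d']) G t.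
    apply: Rintegral_ge0 => t; have : x1 - d' <= pi by lra.
    by move=> /sub_cc s /s; exact: G0.
  lra.
have g1 : `|rho / rho'| < 1.
  rewrite ger0_norm ?divr_ge0 ?(ltW rho'0) //.
  by rewrite ltr_pdivrMr // mul1r.
have c0 : 0 < eta * (2 * d') by apply: mulr_gt0 => //; apply: mulr_gt0.
have /cvgrPdist_lt /(_ _ c0) [N _ /(_ N (leqnn N))] :=
  @cvg_geometric R (Bd * pi) (rho / rho') g1.
rewrite /= sub0r normrN => /(le_lt_trans (ler_norm _)).
apply/negP; rewrite -leNgt expr_div_n [leRHS]mulrA ler_pdivlMr ?exprn_gt0 //.
have := key N; set u := rho' ^+ N; set v := rho ^+ N; lra.
Qed.

(** Positivity is excluded for both f and -f in the interior; the endpoints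
    follow by continuity. *)
Lemma sine_complete b f : {within `[0, pi], continuous f} ->
  (forall j, \int[mu]_(x in `[0, pi]) (f x * sine b j x) = 0) ->
  forall x, x \in `[0, (pi : R)] -> f x = 0.
Proof.
move=> cf h.
have fi := cont_itg cf.
have mJ : measurable (`[0, pi] : set (measurableTypeR R)) by [].
have si j : mu.-integrable `[0, (pi : R)] (EFin \o (fun x => f x * sine b j x)).
  by apply: mul_cont_itg => //; exact: sine_cont.
have int0 x : 0 < x -> x < pi -> f x = 0.
  move=> x0 xp; apply/eqP; rewrite eq_le (orthogonal_le0 cf h) //=.
  rewrite -oppr_le0; apply: (@orthogonal_le0 b (fun x => - f x)) => //.
    by move=> y; apply: cvgN; exact: cf.
  move=> j; have E := RintegralZl (-1) mJ (si j).
  rewrite h mulr0 in E; rewrite -[RHS]E; apply: eq_Rintegral => y _; by rewrite mulN1r mulNr.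
have /(continuous_within_itvP _ (pi_gt0 R)) [_ c0 cp] := cf.
move=> x; rewrite in_itv /= => /andP[]; rewrite le_eqVlt => /predU1P[<- _|x0].
  have e : \forall y \near 0^'+, f y = 0.
    near=> y; apply: int0; near: y; first exact: nbhs_right_gt.
    exact: nbhs_right_lt (pi_gt0 R).
  apply: (@cvg_unique _ _ (f y @[y --> 0^'+]) _ _ _) => //.
  apply: cvg_near_cst; exact: e.
rewrite le_eqVlt => /predU1P[->|xp]; last exact: int0.
have e : \forall y \near pi^'-, f y = 0.
  near=> y; apply: int0; near: y; last exact: nbhs_left_lt.
  exact: nbhs_left_gt (pi_gt0 R).
apply: (@cvg_unique _ _ (f y @[y --> pi^'-]) _ _ _) => //.
apply: cvg_near_cst; exact: e.
Unshelve. all: by end_near.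
Qed.

End Completeness.
Arguments theta {R} b.
Arguments omega {R} b j.
Arguments omega_gt0 {R} b j.

(** * Orthogonality and the Green operator of the second derivative *)

Section RealGreen.
Variable R : realType.
Local Notation mu := (@lebesgue_measure R).
Local Notation J := (`[0, (pi : R)]%classic : set (measurableTypeR R)).
Local Notation itg f := (mu.-integrable `[0, (pi : R)]%classic (EFin \o f)).
Implicit Types (f g h u : R -> R) (x y : R) (b : bool).

Lemma measurable_0pi : measurable J. Proof. by []. Qed.

Lemma in0J : (0 : R) \in `[0, (pi : R)].
Proof. by rewrite in_itv /= lexx pi_ge0. Qed.

Lemma itg_cst (k : R) : itg (fun _ : R => k).
Proof. by apply: cont_itg; apply: continuous_subspaceT => ?; exact: cst_continuous. Qed.

Lemma Rint_cst_J (k : R) : \int[mu]_(x in `[0, pi]) k = k * pi.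
Proof.
rewrite Rintegral_cst //=.
by rewrite lebesgue_measure_itv /= lte_fin pi_gt0 /= subr0.
Qed.

Lemma Rint_cc_oc f (y : R) : 0 <= y -> y <= pi -> itg f ->
  \int[mu]_(x in `[0, y]) f x = \int[mu]_(x in `]0, y]) f x.
Proof.
move=> y0 yp fi; have := Rint_diff fi (lexx _) y0 yp.
by rewrite set_itv1 Rintegral_set1 subr0.
Qed.

Lemma int_cos (k : nat) : (0 < k)%N -> \int[mu]_(x in `[0, pi]) cos (k%:R * x) = 0.
Proof.
move=> k0; have k0R : k%:R != 0 :> R by rewrite pnatr_eq0 -lt0n.
have hk x : is_derive x (1 : R) (fun y : R => k%:R * y) (k%:R : R).
  have := @is_deriveZ _ _ _ (@id R) (k%:R : R) x 1 1 (is_derive_id _ _).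
  by rewrite /GRing.scale /= mulr1.
have ds x : is_derive x (1 : R) (fun y : R => k%:R^-1 * sin (k%:R * y)) (cos (k%:R * x)).
  have h1 := is_derive1_comp (is_derive_sin (k%:R * x)) (hk x).
  have := @is_deriveZ _ _ _ _ (k%:R^-1 : R) x 1 _ h1.
  by rewrite /GRing.scale /= mulrC mulfK.
have cc : continuous (fun x : R => cos (k%:R * x)).
  have dc x := is_derive1_comp (is_derive_cos (k%:R * x)) (hk x).
  exact: (derive_continuous dc).
rewrite Rint_cc_oc ?pi_ge0 //; last by apply: cont_itg; exact: continuous_subspaceT.
by rewrite (deriv_diff (pi_ge0 R) ds cc) mulr0 sin0 sin_nat_pi subrr.
Qed.

Lemma sine_orthogonal b i j : \int[mu]_(x in `[0, pi]) (sine b i x * sine b j x) =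
  if i == j then pi / 2 else 0.
Proof.
wlog ij : i j / (i <= j)%N.
  move=> H; case/orP: (leq_total i j) => [|ji]; first exact: H.
  by rewrite eq_sym -H //; apply: eq_Rintegral => x _; rewrite mulrC.
have E x : sine b i x * sine b j x = 2^-1 * cos ((j - i)%:R * x)
    + (- 2^-1) * cos ((i + j + 2 - b)%:R * x).
  have -> : (j - i)%:R * x = omega b j * x - omega b i * x.
    by rewrite natrB // /omega /freq -![_.+1%:R]natr1; ring.
  have -> : (i + j + 2 - b)%:R * x = omega b j * x + omega b i * x.
    have hb : (b <= i + j + 2)%N by case: (b); lia.
    rewrite natrB // /omega /freq /theta.
    by rewrite !natrD -![_.+1%:R]natr1; case: (b) => /=; field.
  by rewrite cosB cosD /sine; field.
have ci (k : nat) (z : R) : itg (fun x => z * cos (k%:R * x)).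
  apply: cont_itg; apply: continuous_subspaceT => x; apply: continuousM.
    exact: cst_continuous.
  apply: continuous_comp; last exact: continuous_cos.
  by apply: continuousM; [exact: cst_continuous | exact: cvg_id].
have ci1 (k : nat) : itg (fun x => cos (k%:R * x)).
  have := ci k 1; congr (mu.-integrable _ (EFin \o _)).
  by apply/funext => x; rewrite mul1r.
under eq_Rintegral do rewrite E.
rewrite RintegralD //.
rewrite !RintegralZl //; try exact measurable_0pi.
rewrite [X in _ + _ * X]int_cos; last by rewrite subn_gt0; case: (b); lia.
rewrite mulr0 addr0; case: eqP => [->|/eqP ne].
  rewrite subnn; under eq_Rintegral do rewrite mul0r cos0.
  by rewrite Rint_cst_J mul1r mulrC.
by rewrite int_cos ?mulr0 // subn_gt0 ltn_neqAle ne.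
Qed.

Definition antiderivative f h := forall x, x \in `[0, (pi : R)] ->
  f x = f 0 + \int[mu]_(t in `[0, x]) h t.

Definition right_bc b (y0 y1 : R) := if b then y1 = 0 else y0 = 0.

(** Two integrations by parts. The boundary terms vanish at 0 because Y and the
    mode do, and at pi because of the condition on Y there and the matching
    one on the mode. *)
Lemma green2 b j (Y Y1 Y2 : R -> R) : itg Y1 -> itg Y2 ->
  antiderivative Y Y1 -> antiderivative Y1 Y2 ->
  Y 0 = 0 -> right_bc b (Y pi) (Y1 pi) ->
  - (\int[mu]_(x in `[0, pi]) (Y2 x * sine b j x)) =
  omega b j ^+ 2 * \int[mu]_(x in `[0, pi]) (Y x * sine b j x).
Proof.
move=> i1 i2 a0 a1 Y0 Yp.
have iY := cont_itg (AC_continuous i1 a0).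
have w0 : (0 : R) < omega b j := omega_gt0 b j.
have cc : continuous (fun x : R => omega b j * cosine b j x).
  by move=> x; apply: cvgMr; exact: cosine_cont.
have cs : continuous (fun x : R => - omega b j * sine b j x).
  by move=> x; apply: cvgMr; exact: sine_cont.
rewrite (@integration_by_parts_ac R Y2 Y1 _ _ (omega b j) i2 a1 (sine_derive b j) cc); last first.
  by move=> t; rewrite normrM (ger0_norm (ltW w0)) ler_piMr ?cosine_le1 ?(ltW w0).
have -> : \int[mu]_(t in `[0, pi]) (Y1 t * (omega b j * cosine b j t)) =
    omega b j * \int[mu]_(t in `[0, pi]) (Y1 t * cosine b j t).
  rewrite -RintegralZl; first by apply: eq_Rintegral => x _; ring.
    exact measurable_0pi.
  by apply: mul_cont_itg => //; exact: cosine_cont.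
rewrite (@integration_by_parts_ac R Y1 Y _ _ (omega b j) i1 a0 (cosine_derive b j) cs); last first.
  by move=> t; rewrite normrM normrN (ger0_norm (ltW w0)) ler_piMr ?sine_le1 ?(ltW w0).
have -> : \int[mu]_(t in `[0, pi]) (Y t * (- omega b j * sine b j t)) =
    - omega b j * \int[mu]_(t in `[0, pi]) (Y t * sine b j t).
  rewrite -RintegralZl; first by apply: eq_Rintegral => x _; ring.
    exact measurable_0pi.
  by apply: mul_cont_itg => //; exact: sine_cont.
rewrite Y0 sine_at0; move: Yp; rewrite /right_bc; case: (b) => /= ->.
  by rewrite cosine_at_pi; ring.
by rewrite sine_at_pi; ring.
Qed.

Lemma green_chain b j m (Y : nat -> R -> R) :
  (forall i, (i < 2 * m)%N -> itg (Y i.+1) /\ antiderivative (Y i) (Y i.+1)) ->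
  (forall i, (i < m)%N -> Y (2 * i)%N 0 = 0 /\
     right_bc b (Y (2 * i)%N pi) (Y (2 * i + 1)%N pi)) ->
  (-1) ^+ m * \int[mu]_(x in `[0, pi]) (Y (2 * m)%N x * sine b j x) =
  omega b j ^+ (2 * m) * \int[mu]_(x in `[0, pi]) (Y 0%N x * sine b j x).
Proof.
elim: m => [|m IH] hY hb; first by rewrite muln0 !expr0.
have [i1 a1] := hY (2 * m)%N ltac:(lia).
have [i2 a2] := hY (2 * m).+1 ltac:(lia).
have [b0 bp] := hb m (ltnSn m).
rewrite addn1 in bp.
have := green2 j i1 i2 a1 a2 b0 bp.
rewrite (_ : (2 * m.+1)%N = (2 * m).+2); last by lia.
rewrite [(-1) ^+ _]exprS -mulrA mulN1r -mulrN => ->.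
rewrite mulrCA IH; first by rewrite mulrA -exprD add2n.
  by move=> i hi; apply: hY; lia.
by move=> i hi; apply: hb; lia.
Qed.

Definition primitive f x := \int[mu]_(t in `[0, x]) f t.
(** The value at 0 of the first derivative of the solution of y'' = u, chosen to
    satisfy the condition at pi. *)
Definition green_slope b u : R :=
  if b then - primitive u pi else - (primitive (primitive u) pi / pi).
Definition green1 b u x := green_slope b u + primitive u x.
Definition green0 b u x := primitive (green1 b u) x.

Lemma primitive0 f : primitive f 0 = 0.
Proof. by rewrite /primitive set_itv1 Rintegral_set1. Qed.

Lemma primitive_itg u : itg u -> itg (primitive u).
Proof.
move=> iu; apply: cont_itg; apply: (AC_continuous iu) => x xJ.
by rewrite primitive0 add0r.
Qed.

Lemma green1_antid b u : antiderivative (green1 b u) u.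
Proof. by move=> x xJ; rewrite /green1 primitive0 addr0. Qed.
Lemma green0_antid b u : antiderivative (green0 b u) (green1 b u).
Proof. by move=> x xJ; rewrite /green0 primitive0 add0r. Qed.
Lemma green1_itg b u : itg u -> itg (green1 b u).
Proof. by move=> iu; apply: cont_itg; exact: AC_continuous iu (green1_antid b u). Qed.
Lemma green0_itg b u : itg u -> itg (green0 b u).
Proof.
move=> iu; apply: cont_itg.
exact: AC_continuous (green1_itg b iu) (green0_antid b u).
Qed.

Lemma green_bc b u : itg u -> right_bc b (green0 b u pi) (green1 b u pi).
Proof.
move=> iu; rewrite /right_bc; case: b; first by rewrite /green1 /green_slope addNr.
rewrite /green0 {1}/primitive /green1 RintegralD //.
- rewrite Rint_cst_J /green_slope -[X in _ + X]/(primitive (primitive u) pi) mulNr divfK ?addNr //.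
  by rewrite gt_eqF // pi_gt0.
- exact: itg_cst.
- exact: primitive_itg.
Qed.

(** The derivatives of orders j = 0, ..., 2m of the solution y of (-1)^m y^(2m)
    = h: the even ones are iterates of the Green operator applied to (-1)^m
    h, and the odd ones are first derivatives of such iterates. *)
Definition green_tower b m h (j : nat) : R -> R :=
  let u k := iter k (green0 b) (fun x => (-1) ^+ m * h x) in
  if odd j then green1 b (u (m - j./2 - 1)%N) else u (m - j./2)%N.

Lemma green_tower_even b m h i : (i <= m)%N -> green_tower b m h (2 * i) =
  iter (m - i) (green0 b) (fun x => (-1) ^+ m * h x).
Proof. by move=> im; rewrite /green_tower mul2n odd_double doubleK. Qed.

Lemma green_tower_odd b m h i : green_tower b m h (2 * i).+1 =
  green1 b (iter (m - i - 1) (green0 b) (fun x => (-1) ^+ m * h x)).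
Proof. by rewrite /green_tower /= mul2n odd_double /= uphalf_double. Qed.

Lemma green_iter_itg b m h k : itg h ->
  itg (iter k (green0 b) (fun x => (-1) ^+ m * h x)).
Proof.
move=> ih; elim: k => [|k IH] /=; last exact: green0_itg.
by apply: itg_scale => //; exact measurable_0pi.
Qed.

Lemma green_tower_ac b m h : itg h -> forall i, (i < 2 * m)%N ->
  itg (green_tower b m h i.+1) /\ antiderivative (green_tower b m h i) (green_tower b m h i.+1).
Proof.
move=> ih i im; have := odd_double_half i; rewrite -mul2n.
set k := i./2; case: (odd i) => /= E; rewrite ?add1n ?add0n in E; rewrite -E.
  rewrite green_tower_odd (_ : (2 * k).+2 = 2 * k.+1)%N; last by lia.
  rewrite green_tower_even; last by lia.
  rewrite -subnDA addn1; split; first exact: green_iter_itg.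
  exact: green1_antid.
rewrite green_tower_odd green_tower_even; last by lia.
have -> : (m - k)%N = (m - k - 1).+1 by lia.
rewrite subn1 /=; split; first exact/green1_itg/green_iter_itg.
exact: green0_antid.
Qed.

Lemma green_tower_bc b m h : itg h -> forall i, (i < m)%N ->
  green_tower b m h (2 * i)%N 0 = 0 /\
  right_bc b (green_tower b m h (2 * i)%N pi) (green_tower b m h (2 * i + 1)%N pi).
Proof.
move=> ih i im; rewrite addn1 green_tower_odd green_tower_even; last by lia.
set k := (m - i - 1)%N; have -> : (m - i)%N = k.+1 by lia.
split; first by rewrite /= /green0 primitive0.
by apply: green_bc; exact: green_iter_itg.
Qed.

End RealGreen.

(** * Square-integrable functions on the interval *)

Section OpenClosed.
Variable R : realType.
Local Notation mu := (@lebesgue_measure R).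
Local Notation J := (`[0, (pi : R)]%classic : set (measurableTypeR R)).
Local Notation O := (`]0, (pi : R)[%classic : set (measurableTypeR R)).
Local Notation itg f := (mu.-integrable `[0, (pi : R)]%classic (EFin \o f)).
Implicit Types (f g h u : R -> R) (x y : R) (b : bool).

Lemma measurable_OJ f : measurable_fun O f -> measurable_fun J f.
Proof.
by move=> mf; apply/measurable_fun_itv_bndo_bndcP/measurable_fun_itv_obnd_cbndP.
Qed.

Lemma integral_OJ (f : R -> \bar R) : measurable_fun O f ->
  (\int[mu]_(x in `]0%R, pi[) f x = \int[mu]_(x in `[0%R, pi]) f x)%E.
Proof.
move=> mf; rewrite integral_itv_bndo_bndc // integral_itv_obnd_cbnd //.
exact/emeasurable_fun_itv_bndo_bndcP.
Qed.

Lemma itg_OJ f : mu.-integrable O (EFin \o f) -> itg f.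
Proof.
move=> /integrableP[mf fi]; apply/integrableP; split.
  apply/measurable_EFinP; apply: measurable_OJ; exact/measurable_EFinP.
rewrite -integral_OJ //; exact: measurableT_comp.
Qed.

Lemma OsubJ : O `<=` J.
Proof. exact: subset_itv_oo_cc. Qed.

Lemma itg_JO f : itg f -> mu.-integrable O (EFin \o f).
Proof. by apply: integrable_sub => //; exact: OsubJ. Qed.

Lemma Rint_OJ f : itg f ->
  \int[mu]_(x in `]0, pi[) f x = \int[mu]_(x in `[0, pi]) f x.
Proof.
by move=> fi; rewrite /Rintegral integral_OJ //; exact: (measurable_int _ (itg_JO fi)).
Qed.

End OpenClosed.

Section L2.
Variable R : realType.
Local Notation mu := (@lebesgue_measure R).
Local Notation cm := (@cmodulus R).
Local Notation J := (`[0, (pi : R)]%classic : set (measurableTypeR R)).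
Local Notation O := (`]0, (pi : R)[%classic : set (measurableTypeR R)).
Local Notation itg f := (mu.-integrable `[0, (pi : R)]%classic (EFin \o f)).
Implicit Types f : R -> R[i].

Lemma L2norm_sq f : (L2norm f `^ 2 = \int[mu]_(x in `]0%R, pi[) (cm (f x) ^+ 2)%:E)%E.
Proof.
rewrite /L2norm poweR_Lnorm // [RHS]integral_mkcond; apply: eq_integral => x _.
rewrite !patchE; case: ifP => _ /=; last by rewrite normr0 powR0.
by rewrite ger0_norm ?cm_ge0 // powR_mulrn ?cm_ge0.
Qed.

Lemma cm_sqr_meas f : cmeasurable O f -> measurable_fun O (fun x => cm (f x) ^+ 2).
Proof.
move=> [mr mi].
have -> : (fun x => cm (f x) ^+ 2) =
    (fun x => complex.Re (f x) ^+ 2 + complex.Im (f x) ^+ 2).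
  by apply/funext => x; rewrite cm_sqr.
by apply: measurable_funD; apply: measurable_funX.
Qed.

Lemma L2_sq_itg f : inL2 f -> itg (fun x => cm (f x) ^+ 2).
Proof.
move=> [mf fL]; apply: itg_OJ; apply/integrableP; split.
  apply/measurable_EFinP; exact: cm_sqr_meas.
under eq_integral => x _ do rewrite /= ger0_norm ?exprn_ge0 ?cm_ge0 //.
rewrite -L2norm_sq; exact: poweR_lty.
Qed.

Lemma L2_sq_int f : inL2 f ->
  ((\int[mu]_(x in `[0, pi]) (cm (f x) ^+ 2))%:E = L2norm f `^ 2)%E.
Proof.
move=> fL; have fi := L2_sq_itg fL; rewrite -Rint_OJ // L2norm_sq /Rintegral fineK //.
by apply: integrable_fin_num => //; exact: itg_JO.
Qed.

Lemma L2ball_int f (M : R) : 0 <= M -> L2ball M f ->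
  \int[mu]_(x in `[0, pi]) (cm (f x) ^+ 2) <= M ^+ 2.
Proof.
move=> M0 [fL fM]; rewrite -lee_fin L2_sq_int //.
rewrite -powR_mulrn // -poweR_EFin; apply: gt0_ler_poweR => //.
  by rewrite in_itv /= Lnorm_ge0 leey.
by rewrite in_itv /= lee_fin M0 leey.
Qed.

Lemma L2_unit_int f : inL2 f -> L2norm f = 1%E ->
  \int[mu]_(x in `[0, pi]) (cm (f x) ^+ 2) = 1.
Proof.
move=> fL f1; apply: EFin_inj; rewrite L2_sq_int // f1.
by rewrite poweR_EFin powR1.
Qed.

Lemma itg_cm_half f : inL2 f -> itg (fun x => (1 + cm (f x) ^+ 2) / 2).
Proof.
move=> fL.
have -> : (fun x => (1 + cm (f x) ^+ 2) / 2) = (fun x => 2^-1 * (1 + cm (f x) ^+ 2)).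
  by apply/funext => x; rewrite mulrC.
apply: itg_scale => //; apply: itg_add => //; first exact: itg_cst.
exact: L2_sq_itg.
Qed.

(** This elementary bound replaces the Cauchy-Schwarz inequality in estimating
    the integral of |f| by the square norm of f. *)
Lemma cm_half (z : R[i]) : cm z <= (1 + cm z ^+ 2) / 2.
Proof. by have := sqr_ge0 (cm z - 1); rewrite sqrrB expr1n mulr1; lra. Qed.

Lemma inL2_cintegrable f : inL2 f -> cintegrable `[0, pi] f.
Proof.
move=> fL; have [[mr mi] _] := fL.
have h := itg_cm_half fL.
split; apply: (le_integrable _ _ _ h) => //.
- by apply/measurable_EFinP; apply: measurable_OJ.
- move=> x _ /=; rewrite lee_fin; apply: le_trans (ler_norm _).
  exact: le_trans (cm_Re _) (cm_half _).
- by apply/measurable_EFinP; apply: measurable_OJ.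
- move=> x _ /=; rewrite lee_fin; apply: le_trans (ler_norm _).
  exact: le_trans (cm_Im _) (cm_half _).
Qed.

Lemma L2_half_int f (M : R) : 0 <= M -> L2ball M f ->
  \int[mu]_(x in `[0, pi]) ((1 + cm (f x) ^+ 2) / 2) <= (pi + M ^+ 2) / 2.
Proof.
move=> M0 fM; have [fL _] := fM.
have fi := L2_sq_itg fL.
under eq_Rintegral do rewrite mulrC.
rewrite RintegralZl //; last by apply: itg_add => //; exact: itg_cst.
rewrite RintegralD //; last exact: itg_cst.
rewrite Rint_cst_J mul1r mulrC ler_wpM2r ?invr_ge0 // lerD2l.
exact: L2ball_int.
Qed.

Lemma bounded_inL2 f (K : R) : cmeasurable O f ->
  (forall x, x \in `[0, (pi : R)] -> cm (f x) <= K) -> inL2 f.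
Proof.
move=> mf fK; split => //.
have K0 : 0 <= K by apply: le_trans (fK 0 (in0J R)); exact: cm_ge0.
have : (L2norm f `^ 2 < +oo)%E.
  rewrite L2norm_sq; apply: (@le_lt_trans _ _ (\int[mu]_(x in `]0%R, pi[) (K ^+ 2)%:E)%E).
    apply: ge0_le_integral => //.
    - by move=> x _; rewrite lee_fin exprn_ge0 ?cm_ge0.
    - apply/measurable_EFinP; exact: cm_sqr_meas.
    - move=> x xO; rewrite lee_fin ler_exp ?cm_ge0 //; apply: fK.
      exact: (OsubJ xO).
  rewrite integral_cst //= lebesgue_measure_itv /= lte_fin pi_gt0.
  by rewrite -EFinD -EFinM ltry.
exact: lty_poweRy.
Qed.

End L2.

(** * Absolutely convergent sine series *)

Section RealSeries.
Variable R : realType.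
Local Notation mu := (@lebesgue_measure R).
Local Notation J := (`[0, (pi : R)]%classic : set (measurableTypeR R)).
Local Notation itg f := (mu.-integrable `[0, (pi : R)]%classic (EFin \o f)).
Implicit Types (f g F : R -> R) (x y : R) (b : bool).

Lemma unif_cont f : (forall e, 0 < e -> exists2 g, continuous g &
  forall x, `|f x - g x| <= e) -> continuous f.
Proof.
move=> h x; apply/cvgrPdist_le => e e0.
have e3 : 0 < e / 3 by rewrite divr_gt0.
have [g cg hg] := h _ e3.
have /cvgrPdist_le /(_ _ e3) := cg x; apply: filterS => y hy.
have -> : f x - f y = (f x - g x) + (g x - g y) - (f y - g y) by ring.
apply: (le_trans (ler_normB _ _)); rewrite (_ : e = e / 3 + e / 3 + e / 3); last by field.
apply: lerD => //; apply: (le_trans (ler_normD _ _)); exact: lerD.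
Qed.

Definition sine_sum b (r : nat -> R) N x := \sum_(i < N) r i * sine b i x.

Lemma sine_sum_cont b r N : continuous (sine_sum b r N).
Proof.
elim: N => [|N IH] x.
  rewrite (_ : sine_sum b r 0 = cst 0); first exact: cst_continuous.
  by apply/funext => y; rewrite /sine_sum big_ord0.
have -> : sine_sum b r N.+1 = (fun y => sine_sum b r N y + r N * sine b N y).
  by apply/funext => y; rewrite /sine_sum big_ord_recr.
apply: continuousD; first exact: IH.
by apply: cvgMr; exact: sine_cont.
Qed.

Lemma sine_sum_coef b r N j : \int[mu]_(x in `[0, pi]) (sine_sum b r N x * sine b j x) =
  if (j < N)%N then r j * (pi / 2) else 0.
Proof.
have ci (g h : R -> R) : continuous g -> continuous h -> itg (fun x => g x * h x).
  move=> cg ch; apply: mul_cont_itg => //.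
  by apply: cont_itg; exact: continuous_subspaceT.
elim: N => [|N IH].
  under eq_Rintegral do rewrite /sine_sum big_ord0 mul0r.
  by rewrite Rint_cst_J mul0r.
under eq_Rintegral do rewrite /sine_sum big_ord_recr /= mulrDl -mulrA.
rewrite RintegralD //.
- rewrite RintegralZl //; last by apply: ci; exact: sine_cont.
  rewrite IH sine_orthogonal ltnS (leq_eqVlt j N).
  have [<-|jN] := eqVneq N j; first by rewrite ltnn /= add0r.
  by rewrite /= mulr0 addr0.
- apply: ci; [exact: sine_sum_cont | exact: sine_cont].
- by apply: itg_scale => //; apply: ci; exact: sine_cont.
Qed.

Variables (b : bool) (F : R -> R) (r : nat -> R) (d : nat -> R).
Hypothesis d0 : d @ \oo --> (0 : R).
Hypothesis hF : forall N x, `|F x - sine_sum b r N x| <= 2 * d N.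

Lemma tail_small e : 0 < e ->
  exists N0, forall N, (N0 <= N)%N -> 2 * d N <= e.
Proof.
move=> e0; have e2 : 0 < e / 2 by rewrite divr_gt0.
have /cvgrPdist_lt /(_ _ e2) [N0 _ h] := d0.
exists N0 => N NN; have := h N NN; rewrite /= sub0r normrN => /(le_lt_trans (ler_norm _)).
by rewrite ltr_pdivlMr // mulrC => /ltW.
Qed.

Lemma series_cont : continuous F.
Proof.
apply: unif_cont => e e0; have [N0 h] := tail_small e0.
exists (sine_sum b r N0); first exact: sine_sum_cont.
by move=> x; apply: le_trans (hF N0 x) (h _ (leqnn _)).
Qed.

Lemma series_coef j : 2 / pi * \int[mu]_(x in `[0, pi]) (F x * sine b j x) = r j.
Proof.
have p0 := pi_gt0 R.
suff : \int[mu]_(x in `[0, pi]) (F x * sine b j x) = r j * (pi / 2).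
  move=> ->; have : (pi : R) != 0 by rewrite gt_eqF.
  by move: (pi : R) => p pn; field.
apply/eqP; rewrite -subr_eq0 -normr_le0; apply: le_eps => e e0; rewrite addr0.
have ep0 : 0 < e / pi by rewrite divr_gt0.
have [N0 h] := tail_small ep0.
pose N := maxn N0 j.+1.
have := sine_sum_coef b r N j; rewrite leq_maxr => <-.
have ci (g : R -> R) : continuous g -> itg (fun x => g x * sine b j x).
  move=> cg; apply: mul_cont_itg; last exact: sine_cont.
  by apply: cont_itg; exact: continuous_subspaceT.
have iF := ci _ series_cont.
have ir := ci _ (sine_sum_cont (b := b) (r := r) (N := N)).
rewrite -RintegralB //.
have pn : (pi : R) != 0 by rewrite gt_eqF.
rewrite -[leRHS](divfK pn) -Rint_cst_J.
apply: Rint_le_bound => //; [exact: itg_sub|exact: itg_cst|].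
move=> x _; rewrite -mulrBl normrM; apply: le_trans (h N _); last by rewrite leq_maxl.
by apply: le_trans (hF N x); rewrite ler_piMr // sine_le1.
Qed.

End RealSeries.

Section SineSeries.
Variable R : realType.
Local Notation mu := (@lebesgue_measure R).
Local Notation cm := (@cmodulus R).
Local Notation C := R[i].
Local Notation J := (`[0, (pi : R)]%classic : set (measurableTypeR R)).
Local Notation itg f := (mu.-integrable `[0, (pi : R)]%classic (EFin \o f)).
Local Notation Re := complex.Re.
Local Notation Im := complex.Im.
Implicit Types (f g y q : R -> C) (x : R) (b : bool) (c : nat -> C).

(** The factor 2/pi normalizes the modes, whose square norm is pi/2. *)
Definition sine_coef b j f : C :=
  Complex (2 / pi * \int[mu]_(x in `[0, pi]) (Re (f x) * sine b j x))
          (2 / pi * \int[mu]_(x in `[0, pi]) (Im (f x) * sine b j x)).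

Definition sine_series b c x := csum (fun j => c j * (sine b j x)%:C%C).

Lemma sineC_le1 b j x : cm (sine b j x)%:C%C <= 1.
Proof. by rewrite cm_real sine_le1. Qed.

Lemma sine_series_bound b c S x : l1bound c S -> cm (sine_series b c x) <= S.
Proof. by move=> hS; apply: csum_bound hS _ => j; exact: sineC_le1. Qed.

Lemma sine_series_lin b z c c' x : l1 c -> l1 c' ->
  sine_series b (fun j => z * c j + c' j) x = z * sine_series b c x + sine_series b c' x.
Proof. by move=> h h'; apply: csum_lin => // j; exact: sineC_le1. Qed.

Lemma sine_series_approx b c : l1 c -> exists d : nat -> R, [/\ d @ \oo --> (0 : R),
  forall N x, `|Re (sine_series b c x) - sine_sum b (fun j => Re (c j)) N x| <= 2 * d N &
  forall N x, `|Im (sine_series b c x) - sine_sum b (fun j => Im (c j)) N x| <= 2 * d N].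
Proof.
move=> /l1_tail [d [d0 hd]]; exists d.
have hs N x := csum_dist d0 hd (fun j => sineC_le1 b j x) N.
split => // N x; apply: le_trans (hs N x).
- apply: le_trans (cm_Re _); rewrite ReD ReN Re_sum.
  by under [X in _ <= `|_ - X|]eq_bigr do rewrite ReM /= mulr0 subr0.
- apply: le_trans (cm_Im _); rewrite ImD ImN Im_sum.
  by under [X in _ <= `|_ - X|]eq_bigr do rewrite ImM /= mulr0 add0r.
Qed.

Lemma sine_series_cont_Re b c : l1 c -> continuous (fun x => Re (sine_series b c x)).
Proof. by move=> /(sine_series_approx b) [d [d0 h _]]; exact: series_cont d0 h. Qed.
Lemma sine_series_cont_Im b c : l1 c -> continuous (fun x => Im (sine_series b c x)).
Proof. by move=> /(sine_series_approx b) [d [d0 _ h]]; exact: series_cont d0 h. Qed.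

Lemma sine_coef_series b c j : l1 c -> sine_coef b j (sine_series b c) = c j.
Proof.
move=> /(sine_series_approx b) [d [d0 h h']]; apply: eq_complex_parts => /=.
  exact: series_coef d0 h j.
exact: series_coef d0 h' j.
Qed.

Lemma eq_sine_coef b j f g : (forall x, x \in `[0, (pi : R)] -> f x = g x) ->
  sine_coef b j f = sine_coef b j g.
Proof.
move=> fg; rewrite /sine_coef; congr (Complex (_ * _) (_ * _));
  by apply: eq_Rintegral => x /set_mem /= xJ; rewrite fg.
Qed.

Lemma sine_coef_lin b j z f g : cintegrable `[0, pi] f -> cintegrable `[0, pi] g ->
  sine_coef b j (fun x => z * f x + g x) = z * sine_coef b j f + sine_coef b j g.
Proof.
move=> [fr fi] [gr gi].
have mi (h : R -> R) : itg h -> itg (fun x => h x * sine b j x).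
  by move=> hi; apply: mul_cont_itg => //; exact: sine_cont.
have lin (u v : R) (h1 h2 h3 : R -> R) : itg h1 -> itg h2 -> itg h3 ->
    \int[mu]_(x in `[0, pi]) ((u * h1 x + v * h2 x + h3 x) * sine b j x) =
    u * \int[mu]_(x in `[0, pi]) (h1 x * sine b j x) +
    v * \int[mu]_(x in `[0, pi]) (h2 x * sine b j x) +
    \int[mu]_(x in `[0, pi]) (h3 x * sine b j x).
  move=> i1 i2 i3; have mJ : measurable J by [].
  rewrite -!RintegralZl ?mi // -!RintegralD //; try (by apply: itg_scale => //; exact: mi);
    try exact: mi.
    by apply: eq_Rintegral => x _; ring.
  by apply: itg_add => //; apply: itg_scale => //; exact: mi.
apply: eq_complex_parts; rewrite ?ReD ?ImD ?ReM ?ImM /=.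
  have := lin (Re z) (- Im z) _ _ _ fr fi gr.
  rewrite (_ : \int[mu]_(x in `[0, pi]) _ =
  \int[mu]_(x in `[0, pi]) (Re (z * f x + g x) * sine b j x)).
    by move=> ->; ring.
  by apply: eq_Rintegral => x _; rewrite ReD ReM mulNr.
have := lin (Re z) (Im z) _ _ _ fi fr gi.
rewrite (_ : \int[mu]_(x in `[0, pi]) _ =
  \int[mu]_(x in `[0, pi]) (Im (z * f x + g x) * sine b j x)).
  by move=> ->; ring.
by apply: eq_Rintegral => x _; rewrite ImD ImM.
Qed.

Lemma sine_coef_bound b j f (g : R -> R) : cintegrable `[0, pi] f -> itg g ->
  (forall x, x \in `[0, (pi : R)] -> cm (f x) <= g x) ->
  cm (sine_coef b j f) <= 4 / pi * \int[mu]_(x in `[0, pi]) g x.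
Proof.
move=> [fr fi] gi fg; have p0 := pi_gt0 R.
have mi (h : R -> R) : itg h -> itg (fun x => h x * sine b j x).
  by move=> hi; apply: mul_cont_itg => //; exact: sine_cont.
apply: (le_trans (cm_le _)) => /=.
rewrite (_ : 4 / pi * _ = 2 / pi * \int[mu]_(x in `[0, pi]) g x +
   2 / pi * \int[mu]_(x in `[0, pi]) g x); last by ring.
rewrite !normrM (ger0_norm (_ : 0 <= 2)) // ger0_norm ?invr_ge0 ?(ltW p0) //.
apply: lerD; rewrite ler_wpM2l ?divr_ge0 ?(ltW p0) //; apply: Rint_le_bound => //.
- exact: mi.
- move=> x xJ; rewrite normrM; apply: le_trans (fg x xJ); apply: le_trans (cm_Re _).
  by rewrite ler_piMr // sine_le1.
- exact: mi.
- move=> x xJ; rewrite normrM; apply: le_trans (fg x xJ); apply: le_trans (cm_Im _).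
  by rewrite ler_piMr // sine_le1.
Qed.

Lemma cintegrable_mul_bounded q y (K : R) : cintegrable `[0, pi] q ->
  measurable_fun J (fun x => Re (y x)) -> measurable_fun J (fun x => Im (y x)) ->
  (forall x, x \in `[0, (pi : R)] -> cm (y x) <= K) ->
  cintegrable `[0, pi] (fun x => q x * y x).
Proof.
move=> [qr qi] mr mi yK.
have h (u v : R -> R) : itg u -> measurable_fun J v ->
    (forall x, x \in `[0, (pi : R)] -> `|v x| <= K) -> itg (fun x => u x * v x).
  by move=> iu mv vK; apply: (@integrable_mul_bounded _ _ _ _ K).
have rK x : x \in `[0, (pi : R)] -> `|Re (y x)| <= K.
  by move=> xJ; exact: le_trans (cm_Re _) (yK x xJ).
have iK x : x \in `[0, (pi : R)] -> `|Im (y x)| <= K.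
  by move=> xJ; exact: le_trans (cm_Im _) (yK x xJ).
have mJ : measurable J by [].
split.
  have := itg_sub mJ (h _ _ qr mr rK) (h _ _ qi mi iK).
  by congr (mu.-integrable _ _); apply/funext => x /=; rewrite ReM.
have := itg_add mJ (h _ _ qr mi iK) (h _ _ qi mr rK).
by congr (mu.-integrable _ _); apply/funext => x /=; rewrite ImM.
Qed.

Lemma sine_series_measurable b c : l1 c -> measurable_fun J (fun x => Re (sine_series b c x)) /\
  measurable_fun J (fun x => Im (sine_series b c x)).
Proof.
by move=> hc; split; apply: cont_measurable; apply: continuous_subspaceT;
  [exact: sine_series_cont_Re | exact: sine_series_cont_Im].
Qed.

Lemma sine_series_cintegrable b c : l1 c -> cintegrable `[0, pi] (sine_series b c).
Proof.
by move=> hc; split; apply: cont_itg; apply: continuous_subspaceT;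
  [exact: sine_series_cont_Re | exact: sine_series_cont_Im].
Qed.

Lemma cintegrable_mul_series b q c : cintegrable `[0, pi] q -> l1 c ->
  cintegrable `[0, pi] (fun x => q x * sine_series b c x).
Proof.
move=> hq hc; have [mr mi] := sine_series_measurable b hc; have [S hS] := hc.
by apply: (@cintegrable_mul_bounded _ _ S) => // x _; exact: sine_series_bound.
Qed.

(** The sine coefficients of the product of q and the series with coefficients
    c. This is the operator Q of the sequence model. *)
Definition potential_coef b q c j := sine_coef b j (fun x => q x * sine_series b c x).

Lemma potential_coef_lin b q z c d : cintegrable `[0, pi] q -> l1 c -> l1 d -> forall j,
  potential_coef b q (fun i => z * c i + d i) j =
    z * potential_coef b q c j + potential_coef b q d j.
Proof.
move=> hq hc hd j; rewrite /potential_coef -sine_coef_lin; try exact: cintegrable_mul_series.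
by apply: eq_sine_coef => x _; rewrite sine_series_lin //; ring.
Qed.

Definition kappa (M : R) : R := 2 / pi * (pi + M ^+ 2).

(** The only place where the size of q matters: |q| has integral at most (pi +
    M^2)/2, the series is bounded by S, and the modes by 1. *)
Lemma potential_coef_bound b q (M : R) c S j : 0 <= M -> L2ball M q -> l1bound c S ->
  cm (potential_coef b q c j) <= kappa M * S.
Proof.
move=> M0 qM hS; have [qL _] := qM; have S0 := l1bound_ge0 hS.
have hq := inL2_cintegrable qL; have hc : l1 c by exists S.
have gi : itg (fun x => S * ((1 + cm (q x) ^+ 2) / 2)).
  by apply: itg_scale => //; exact: itg_cm_half.
apply: (le_trans (sine_coef_bound _ _ (cintegrable_mul_series b hq hc) gi _)).
  move=> x xJ; rewrite cmM mulrC; apply: ler_pM; rewrite ?cm_ge0 ?cm_half //.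
  exact: sine_series_bound.
rewrite RintegralZl //; last exact: itg_cm_half.
rewrite /kappa mulrCA mulrC ler_wpM2r //.
rewrite (_ : 2 / pi * _ = 4 / pi * ((pi + M ^+ 2) / 2)); last first.
  have : (pi : R) != 0 by rewrite gt_eqF ?pi_gt0.
  by move: (pi : R) => p pn; field.
rewrite ler_wpM2l ?divr_ge0 ?pi_ge0 //; exact: L2_half_int.
Qed.

(** Both sides are continuous on [0, pi] and have the same sine coefficients. *)
Lemma eq_sine_series b y c : {within `[0, pi], continuous (fun x => Re (y x))} ->
  {within `[0, pi], continuous (fun x => Im (y x))} -> l1 c ->
  (forall j, sine_coef b j y = c j) ->
  forall x, x \in `[0, (pi : R)] -> y x = sine_series b c x.
Proof.
move=> cr ci hc hy.
have p0 : 2 / (pi : R) != 0 by rewrite mulf_neq0 // invr_eq0 gt_eqF // pi_gt0.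
have key (u v : R -> R) : {within `[0, pi], continuous u} -> continuous v ->
    (forall j, 2 / pi * \int[mu]_(x in `[0, pi]) (u x * sine b j x) =
               2 / pi * \int[mu]_(x in `[0, pi]) (v x * sine b j x)) ->
    forall x, x \in `[0, (pi : R)] -> u x = v x.
  move=> cu cv h x xJ; apply/eqP; rewrite -subr_eq0; apply/eqP.
  have cv' : {within `[0, pi], continuous v} by exact: continuous_subspaceT.
  apply: (@sine_complete _ b (fun x => u x - v x)) xJ.
    exact: (@within_continuousB _ R R _ u v).
  move=> j; under eq_Rintegral do rewrite mulrBl.
  rewrite RintegralB //; try (apply: mul_cont_itg; [exact: cont_itg | exact: sine_cont]).
  by have /(mulfI p0) -> := h j; rewrite subrr.
move=> x xJ; apply: eq_complex_parts.
  apply: (key _ _ cr (sine_series_cont_Re (b := b) hc)) => // j.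
  by have := hy j; rewrite -(sine_coef_series b j hc) => -[].
apply: (key _ _ ci (sine_series_cont_Im (b := b) hc)) => // j.
by have := hy j; rewrite -(sine_coef_series b j hc) => -[].
Qed.

End SineSeries.

(** * The operators in sine coordinates *)

Section Operator.
Variable R : realType.
Local Notation mu := (@lebesgue_measure R).
Local Notation cm := (@cmodulus R).
Local Notation C := R[i].
Local Notation J := (`[0, (pi : R)]%classic : set (measurableTypeR R)).
Local Notation O := (`]0, (pi : R)[%classic : set (measurableTypeR R)).
Local Notation itg f := (mu.-integrable `[0, (pi : R)]%classic (EFin \o f)).
Local Notation Re := complex.Re.
Local Notation Im := complex.Im.
Implicit Types (f g y q : R -> C) (x : R) (b : bool) (c d : nat -> C).

Definition boundary_conditions b : nat -> (nat -> R -> C) -> Prop :=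
  if b then @dirichlet_neumann R else @dirichlet R.
Definition bc_operator b m q := operator_graph (boundary_conditions b m) m q.

Definition free_ev b m j : R := omega b j ^+ (2 * m).

Lemma free_ev_gt0 b m j : 0 < free_ev b m j.
Proof. by rewrite exprn_gt0 // omega_gt0. Qed.

(** Beyond the index 0, each free eigenvalue exceeds its distance to the first
    gap level, so the gap sums apply. *)
Lemma inv_free_ev_sum b m : (0 < m)%N -> exists2 A, 0 <= A &
  forall N, \sum_(i < N) (free_ev b m i)^-1 <= A.
Proof.
move=> m0; have [p pE] : exists p, (2 * m = p.+2)%N by exists (2 * m - 2)%N; lia.
pose A := 4 * (harm R 1 / 1 ^+ p.+1).
have A0 : 0 <= A by rewrite mulr_ge0 // divr_ge0 ?harm_ge0 // exprn_ge0.
exists ((free_ev b m 0)^-1 + A); first by rewrite addr_ge0 // invr_ge0 ltW // free_ev_gt0.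
case=> [|N]; first by rewrite big_ord0 addr_ge0 // invr_ge0 ltW // free_ev_gt0.
rewrite -(big_mkord xpredT (fun i => (free_ev b m i)^-1)) big_nat_recl // lerD2l.
apply: le_trans (gap_sum_above p (theta_ge0 R b) (theta_le R b) N.+1 (ltnSn 0)).
rewrite big_add1 /= big_nat [leRHS]big_nat; apply: ler_sum => i _.
have h := gap_above p (theta_ge0 R b) (theta_le R b) (ltnSn 0) (ltn0Sn i).
have g0 : 0 < freq (theta b) i.+1 ^+ p.+2 - gapfreq (theta b) 1 ^+ p.+2 :> R.
  by apply: lt_le_trans h; rewrite !mulr_gt0 // exprn_gt0.
rewrite /free_ev pE; apply: ler_inv => //.
rewrite lerBlDr lerDl exprn_ge0 // /gapfreq.
by have := theta_le R b; lra.
Qed.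

Lemma ae_sub (P Q : R -> Prop) : (forall x, P x -> Q x) ->
  {ae mu, forall x, P x} -> {ae mu, forall x, Q x}.
Proof. by move=> PQ; apply: (@filterS _ _ (ae_filter_ringOfSetsType mu)). Qed.

Lemma ae_eq_sine_coef b j f g : cintegrable `[0, pi] f -> cintegrable `[0, pi] g ->
  {ae mu, forall x, x \in `]0, (pi : R)[ -> f x = g x} -> sine_coef b j f = sine_coef b j g.
Proof.
move=> [fr fi] [gr gi] fg.
have key (u v : R -> R) : itg u -> itg v ->
   {ae mu, forall x, x \in `]0, (pi : R)[ -> u x = v x} ->
   \int[mu]_(x in `[0, pi]) (u x * sine b j x) = \int[mu]_(x in `[0, pi]) (v x * sine b j x).
  move=> iu iv uv.
  have mi (h : R -> R) : itg h -> itg (fun x => h x * sine b j x).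
    by move=> hi; apply: mul_cont_itg => //; exact: sine_cont.
  rewrite -!Rint_OJ ?mi // /Rintegral; congr fine.
  apply: ae_eq_integral => //.
  - exact: (measurable_int _ (itg_JO (mi _ iu))).
  - exact: (measurable_int _ (itg_JO (mi _ iv))).
  - by apply: ae_sub uv => x h xO; rewrite h.
apply: eq_complex_parts => /=; congr (_ * _); apply: key => //.
  by apply: ae_sub fg => x h xO; rewrite h.
by apply: ae_sub fg => x h xO; rewrite h.
Qed.

Lemma signC m : (-1) ^+ m = ((-1) ^+ m : R)%:C%C :> C.
Proof. by rewrite rmorphXn /= rmorphN1. Qed.

Lemma Re_realM (r : R) (z : C) : Re (r%:C%C * z) = r * Re z.
Proof. by rewrite ReM /= mul0r subr0. Qed.
Lemma Im_realM (r : R) (z : C) : Im (r%:C%C * z) = r * Im z.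
Proof. by rewrite ImM /= mul0r addr0. Qed.

Lemma tower_coef b m (Y : nat -> R -> C) j :
  ac_derivatives (2 * m) Y -> boundary_conditions b m Y ->
  (-1) ^+ m * sine_coef b j (Y (2 * m)%N) = (free_ev b m j)%:C%C * sine_coef b j (Y 0%N).
Proof.
move=> ac bc.
have bcr i : (i < m)%N -> Y (2 * i)%N 0 = 0 /\
    if b then Y (2 * i + 1)%N pi = 0 else Y (2 * i)%N pi = 0.
  by move: bc; rewrite /boundary_conditions; case: (b) => h im; have [] := h i im.
rewrite signC; apply: eq_complex_parts; rewrite ?ReM ?ImM /= ?mul0r ?subr0 ?addr0.
  rewrite mulrCA (mulrCA (free_ev b m j)); congr (_ * _).
  apply: (@green_chain _ b j m (fun i x => Re (Y i x))) => i im.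
    have [[ir _] aY] := ac i im; split => // x xJ.
    by rewrite (aY x xJ) ReD.
  have [-> h] := bcr i im; split => //; rewrite /right_bc.
  by case: (b) h => ->.
rewrite mulrCA (mulrCA (free_ev b m j)); congr (_ * _).
apply: (@green_chain _ b j m (fun i x => Im (Y i x))) => i im.
  have [[_ ii] aY] := ac i im; split => // x xJ.
  by rewrite (aY x xJ) ImD.
have [-> h] := bcr i im; split => //; rewrite /right_bc.
by case: (b) h => ->.
Qed.

Lemma ac_cont m (Y : nat -> R -> C) : (0 < m)%N -> ac_derivatives m Y ->
  {within `[0, pi], continuous (fun x => Re (Y 0%N x))} /\
  {within `[0, pi], continuous (fun x => Im (Y 0%N x))}.
Proof.
move=> m0 ac; have [[ir ii] aY] := ac 0%N m0.
split; [apply: (AC_continuous ir) | apply: (AC_continuous ii)] => x xJ.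
  by rewrite (aY x xJ) ReD.
by rewrite (aY x xJ) ImD.
Qed.

Lemma l1_of_bound b m c (K : R) : (0 < m)%N ->
  (forall j, cm ((free_ev b m j)%:C%C * c j) <= K) -> l1 c.
Proof.
move=> m0 h; have [A A0 hA] := inv_free_ev_sum b m0.
have K0 : 0 <= K by apply: le_trans (h 0%N); exact: cm_ge0.
exists (K * A) => N; apply: (@le_trans _ _ (\sum_(i < N) K * (free_ev b m i)^-1)).
  apply: ler_sum => i _; rewrite ler_pdivlMr ?free_ev_gt0 // mulrC.
  by have := h i; rewrite cmM cm_real ger0_norm ?(ltW (free_ev_gt0 _ _ _)).
by rewrite -mulr_sumr ler_wpM2l.
Qed.

(** The coefficients of (-1)^m y^(2m) are those of y multiplied by the free
    eigenvalues. Those of f and of q y are bounded, so the coefficients of y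
    are O(1/a_j), hence summable, and y is the sum of its sine series. *)
Lemma op_coef b m q y f : (0 < m)%N -> inL2 q -> bc_operator b m q y f ->
  let c j := sine_coef b j y in
  [/\ l1 c, forall x, x \in `[0, (pi : R)] -> y x = sine_series b c x &
   forall j, (free_ev b m j)%:C%C * c j + potential_coef b q c j = sine_coef b j f].
Proof.
move=> m0 qL [fL [Y [Y0 ac bc ae]]] c.
have m2 : (0 < 2 * m)%N by rewrite muln_gt0.
have qi := inL2_cintegrable qL; have fi := inL2_cintegrable fL.
have [cr ci] := ac_cont m2 ac.
have [Kr Kr0 hr] := cont_bounded cr; have [Ki Ki0 hi] := cont_bounded ci.
have YK x : x \in `[0, (pi : R)] -> cm (Y 0%N x) <= Kr + Ki.
  by move=> xJ; apply: (le_trans (cm_le _)); apply: lerD; [exact: hr | exact: hi].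
have qYi : cintegrable `[0, pi] (fun x => q x * Y 0%N x).
  by apply: (cintegrable_mul_bounded qi _ _ YK); apply: cont_measurable.
have YmI : cintegrable `[0, pi] (Y (2 * m)%N).
  have hm : ((2 * m).-1 < 2 * m)%N by rewrite prednK.
  by have [] := ac _ hm; rewrite prednK.
have cE j : c j = sine_coef b j (Y 0%N) by apply: eq_sine_coef => x xJ; rewrite Y0.
have hi2 : cintegrable `[0, pi] (fun x => (-1) ^+ m * Y (2 * m)%N x + q x * Y 0%N x).
  have mJ : measurable J by [].
  case: YmI qYi => ar ai [br bi]; rewrite signC; split.
    have := itg_add mJ (itg_scale ((-1) ^+ m) mJ ar) br.
    congr (mu.-integrable _ _); apply/funext => x /=.
    by rewrite ReD Re_realM.
  have := itg_add mJ (itg_scale ((-1) ^+ m) mJ ai) bi.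
  congr (mu.-integrable _ _); apply/funext => x /=.
  by rewrite ImD Im_realM.
have rel j : (free_ev b m j)%:C%C * c j + sine_coef b j (fun x => q x * Y 0%N x) = sine_coef b j f.
  rewrite cE -tower_coef // -sine_coef_lin //; apply: ae_eq_sine_coef => //.
  apply: ae_sub ae => x h xO; rewrite -h // Y0 //.
  by apply: subset_itv_oo_cc xO.
have cl1 : l1 c.
  pose half x := (1 + cm (f x) ^+ 2) / 2.
  pose half' x := (Kr + Ki) * ((1 + cm (q x) ^+ 2) / 2).
  apply: (@l1_of_bound b m c (4 / pi * \int[mu]_(x in `[0, pi]) half x +
     4 / pi * \int[mu]_(x in `[0, pi]) half' x)) => // j.
  have -> : (free_ev b m j)%:C%C * c j = sine_coef b j f - sine_coef b j (fun x => q x * Y 0%N x).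
    by rewrite -rel addrK.
  apply: (le_trans (cmB _ _)); apply: lerD; apply: sine_coef_bound => //.
  - exact: itg_cm_half.
  - by move=> x _; exact: cm_half.
  - by apply: itg_scale => //; exact: itg_cm_half.
  - move=> x xJ; rewrite cmM mulrC; apply: ler_pM; rewrite ?cm_ge0 ?cm_half //.
    exact: YK.
have Yser x : x \in `[0, (pi : R)] -> Y 0%N x = sine_series b c x.
  by apply: eq_sine_series => // j; rewrite cE.
split=> // [x xJ|j]; first by rewrite -Y0 // Yser.
by rewrite -rel; congr (_ + _); apply: eq_sine_coef => x xJ; rewrite Yser.
Qed.

Definition complex_tower b m (h : R -> C) (j : nat) (x : R) : C :=
  Complex (green_tower b m (fun x => Re (h x)) j x)
          (green_tower b m (fun x => Im (h x)) j x).

Lemma complex_tower_ac b m h : cintegrable `[0, pi] h ->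
  ac_derivatives (2 * m) (complex_tower b m h).
Proof.
move=> [hr hi] j jm.
have [ir ar] := green_tower_ac b hr jm.
have [ii ai] := green_tower_ac b hi jm.
split; first by split.
by move=> x xJ; apply: eq_complex_parts; rewrite ?ReD ?ImD /=; [exact: ar | exact: ai].
Qed.

Lemma complex_tower_bc b m h : cintegrable `[0, pi] h ->
  boundary_conditions b m (complex_tower b m h).
Proof.
move=> [hr hi]; rewrite /boundary_conditions.
have H i : (i < m)%N -> complex_tower b m h (2 * i)%N 0 = 0 /\
    if b then complex_tower b m h (2 * i + 1)%N pi = 0 else complex_tower b m h (2 * i)%N pi = 0.
  move=> im; have [r0 rp] := green_tower_bc b hr im.
  have [i0 ip] := green_tower_bc b hi im.
  split; first by apply: eq_complex_parts => /=; rewrite ?r0 ?i0.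
  by move: rp ip; rewrite /right_bc /complex_tower; case: (b) => h1 h2;
    apply: eq_complex_parts => /=; rewrite ?h1 ?h2.
by case: (b) H => H i im; exact: H.
Qed.

Lemma complex_tower_top b m h x : complex_tower b m h (2 * m) x = (-1) ^+ m * h x.
Proof.
rewrite /complex_tower !green_tower_even // subnn /= signC.
by apply: eq_complex_parts; rewrite ?ReM ?ImM /= mul0r ?subr0 ?addr0.
Qed.

(** The lowest function of the tower built from f - q y has the coefficients c,
    so it is y by completeness. *)
Lemma op_of_seq b m q y f c d : (0 < m)%N -> inL2 q -> l1 c -> l1 d ->
  (forall j, (free_ev b m j)%:C%C * c j + potential_coef b q c j = d j) ->
  (forall x, x \in `[0, (pi : R)] -> y x = sine_series b c x) ->
  (forall x, x \in `[0, (pi : R)] -> f x = sine_series b d x) ->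
  bc_operator b m q y f.
Proof.
move=> m0 qL hc hd rel yE fE.
have m2 : (0 < 2 * m)%N by rewrite muln_gt0.
have qi := inL2_cintegrable qL.
have OJ x : x \in `]0, (pi : R)[ -> x \in `[0, (pi : R)] by exact: subset_itv_oo_cc.
have fL : inL2 f.
  have [S hS] := hd; have [mr mi] := sine_series_measurable b hd.
  apply: (@bounded_inL2 _ _ S); last by move=> x xJ; rewrite fE //; exact: sine_series_bound.
  split.
    apply: (eq_measurable_fun (fun x => Re (sine_series b d x))).
      by move=> x /set_mem /= /OJ xJ; rewrite fE.
    by apply: measurable_funS mr => //; exact: OsubJ.
  apply: (eq_measurable_fun (fun x => Im (sine_series b d x))).
    by move=> x /set_mem /= /OJ xJ; rewrite fE.
  by apply: measurable_funS mi => //; exact: OsubJ.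
split => //.
(* The required value of (-1)^m y^(2m), namely f - q y. *)
pose h x := (-1) * (q x * sine_series b c x) + sine_series b d x.
have qci := cintegrable_mul_series b qi hc.
have di := sine_series_cintegrable b hd.
have hi : cintegrable `[0, pi] h.
  have mJ : measurable J by [].
  case: qci di => ar ai [br bi]; split.
    have := itg_add mJ (itg_scale (-1) mJ ar) br.
    congr (mu.-integrable _ _); apply/funext => x /=.
    by rewrite /h mulN1r ReD ReN mulN1r.
  have := itg_add mJ (itg_scale (-1) mJ ai) bi.
  congr (mu.-integrable _ _); apply/funext => x /=.
  by rewrite /h mulN1r ImD ImN mulN1r.
have ac := @complex_tower_ac b m h hi.
have bc := @complex_tower_bc b m h hi.
have hj j : sine_coef b j (complex_tower b m h 0%N) = c j.
  have ev0 : (free_ev b m j)%:C%C != 0 :> C.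
    by apply/eqP => -[/eqP]; rewrite gt_eqF // free_ev_gt0.
  apply: (mulfI ev0); rewrite -tower_coef //.
  have -> : sine_coef b j (complex_tower b m h (2 * m)) = (-1) ^+ m * sine_coef b j h.
    have z0 : cintegrable `[0, pi] (fun _ : R => (0 : C)) by split; exact: itg_cst.
    have := sine_coef_lin b j ((-1) ^+ m) hi z0.
    have -> : sine_coef b j (fun _ : R => 0) = 0.
      apply: (@cm_eq0 R); apply/eqP; rewrite eq_le cm_ge0 andbT.
      apply: (le_trans (sine_coef_bound b j z0 (itg_cst 0) _)); first by move=> x _; rewrite cm0.
      by rewrite Rint_cst_J mul0r mulr0.
    rewrite addr0 => <-; apply: eq_sine_coef => x _; by rewrite complex_tower_top addr0.
  rewrite mulrA -exprD addnn -mul2n exprM sqrrN expr1n expr1n mul1r.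
  rewrite sine_coef_lin // sine_coef_series // mulN1r.
  by rewrite -(rel j) addrC addrK.
exists (complex_tower b m h); split => //.
  move=> x xJ; rewrite yE //; move: x xJ; have [cr ci] := ac_cont m2 ac.
  exact: eq_sine_series.
apply: aeW => x xO; have xJ := OJ x xO.
rewrite complex_tower_top mulrA -exprD addnn -mul2n exprM sqrrN expr1n expr1n mul1r.
by rewrite /h yE // fE // mulN1r addrAC addNr add0r.
Qed.

End Operator.
Arguments free_ev {R} b m j.

(** * Localization of the eigenvalues *)

(** If (X - z)^e is the exact power in the characteristic polynomial, it is the
    gcd of that polynomial and (X - z)^(k+e), so every vector killed by some
    power of B - z is killed by the power e, and e does not exceed the
    dimension. *)
Lemma pow_geigenspace (F : fieldType) (n : nat) (B : 'M[F]_n.+1) z k (u : 'rV_n.+1) :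
  u *m (B - z%:M) ^+ k = 0 -> (u <= geigenspace B z)%MS.
Proof.
move=> uk; rewrite geigenspaceE; apply/sub_kermxP.
have cp0 : char_poly B != 0 by rewrite monic_neq0 // char_poly_monic.
have [e [r rz cpE]] := multiplicity_XsubC (char_poly B) z.
rewrite cp0 /= in rz.
have en : (e <= n.+1)%N.
  have r0 : r != 0 by apply: contraNneq cp0 => r0; rewrite cpE r0 mul0r.
  have := size_char_poly B; rewrite cpE size_Mmonic ?monic_exp ?monicXsubC //.
  have sr : (0 < size r)%N by rewrite size_poly_gt0.
  by rewrite size_exp_XsubC addnS /= => h; move: sr; rewrite -(ltn_add2r e) h add0n ltnS.
suff ue : u *m (B - z%:M) ^+ e = 0.
  rewrite (_ : _ ^+ n.+1 = (B - z%:M) ^+ e *m (B - z%:M) ^+ (n.+1 - e));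
  by [rewrite mulmxA ue mul0mx | rewrite mulmxE -exprD subnKC].
have cop : coprimep (('X - z%:P) ^+ k) r.
  by rewrite coprimep_expl // coprimep_sym coprimep_XsubC.
(* Expand (X - z)^e through the Bezout identity of (X - z)^k and the cofactor r. *)
have /Bezout_eq1_coprimepP [[v w] /= vw] := cop.
have hE j : horner_mx B (('X - z%:P) ^+ j) = (B - z%:M) ^+ j.
  by rewrite rmorphXn /= rmorphB /= horner_mx_X horner_mx_C.
rewrite -hE -[('X - _) ^+ e]mul1r -vw.
have -> : (v * ('X - z%:P) ^+ k + w * r) * ('X - z%:P) ^+ e =
  ('X - z%:P) ^+ k * (v * ('X - z%:P) ^+ e) + w * char_poly B.
  by rewrite cpE; ring.
rewrite rmorphD !rmorphM /= Cayley_Hamilton mulr0 addr0 hE.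
by rewrite -!mulmxE !mulmxA uk !mul0mx.
Qed.

Section Assembly.
Variable R : realType.
Local Notation mu := (@lebesgue_measure R).
Local Notation cm := (@cmodulus R).
Local Notation C := R[i].
Local Notation Re := complex.Re.
Local Notation Im := complex.Im.
Local Notation itg f := (mu.-integrable `[0, (pi : R)]%classic (EFin \o f)).
Implicit Types (f g y q : R -> C) (x : R) (b : bool) (c d : nat -> C).

Lemma l1_zero : l1 (fun _ : nat => (0 : C)).
Proof. by exists 0 => N; rewrite big1 // => i _; rewrite cm0. Qed.

Lemma sine_series0 b x : sine_series b (fun _ : nat => (0 : C)) x = 0.
Proof.
apply: cm_eq0; apply/eqP; rewrite eq_le cm_ge0 andbT; apply: sine_series_bound => N.
by rewrite big1 // => i _; rewrite cm0.
Qed.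

(** Root vectors of the differential operator are the sine series of the root
    vectors of the sequence model. *)
Lemma ker_pow_seq b m q z k y : (0 < m)%N -> inL2 q ->
  ker_pow (bc_operator b m q) z k y <->
  exists c, [/\ l1 c, forall x, x \in `[0, (pi : R)] -> y x = sine_series b c x &
    seq_ker_pow (potential_coef b q) (free_ev b m) z k c].
Proof.
move=> m0 qL; elim: k y => [|k IH] y /=.
  split=> [y0|[c [hc yE c0]] x xJ]; last first.
    by rewrite yE // (_ : c = fun=> 0) ?sine_series0 //; apply/funext => j.
  by exists (fun=> 0); split; [exact: l1_zero| |] => // x xJ; rewrite y0 // sine_series0.
split=> [[f [Lf /IH [d [hd fE dk]]]]|[c [hc yE [d [hd rel dk]]]]].
  have [hc yE rel] := op_coef m0 qL Lf.
  exists (fun j => sine_coef b j y); split => //; exists d; split => // j.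
  rewrite rel -[in RHS](sine_coef_series b j hc) -(sine_coef_series b j hd).
  rewrite -sine_coef_lin; try exact: sine_series_cintegrable.
  by apply: eq_sine_coef => x xJ; rewrite fE // yE.
exists (sine_series b d); split; last by apply/IH; exists d.
apply: (@op_of_seq _ b m q y _ c (fun j => z * c j + d j)) => //.
  exact: l1D (l1Z _ hc) hd.
by move=> x xJ; rewrite sine_series_lin // yE.
Qed.

(** The level separating the first n free eigenvalues from the others. *)
Definition gap_level b m n : R := gapfreq (theta b) n ^+ (2 * m).

Lemma double_pred m : (0 < m)%N -> exists p, (2 * m = p.+2)%N /\ (2 * m - 1 = p.+1)%N.
Proof. by move=> m0; exists (2 * m - 2)%N; lia. Qed.

Lemma free_ev_lt b m n j : (0 < m)%N -> (j < n)%N -> free_ev b m j < gap_level b m n.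
Proof.
move=> m0 jn; have [p [pE _]] := double_pred m0.
rewrite -subr_gt0 /free_ev /gap_level pE.
apply: lt_le_trans (gap_below p (theta_ge0 R b) (theta_le R b) jn).
by rewrite mulr_gt0 ?divr_gt0 ?ltr0n ?subn_gt0 // exprn_gt0 // ltr0n; lia.
Qed.

Lemma free_ev_gt b m n j : (0 < m)%N -> (0 < n)%N -> (n <= j)%N -> gap_level b m n < free_ev b m j.
Proof.
move=> m0 n0 jn; have [p [pE _]] := double_pred m0.
rewrite -subr_gt0 /free_ev /gap_level pE.
apply: lt_le_trans (gap_above p (theta_ge0 R b) (theta_le R b) n0 jn).
by rewrite !mulr_gt0 // exprn_gt0 // ltr0n.
Qed.

(** The common bound of the two sums of reciprocal distances to the n-th gap
    level. *)
Definition gapsum m n : R := 4 * (harm R n / n%:R ^+ (2 * m - 1)).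

Lemma gapsum_ge0 m n : 0 <= gapsum m n.
Proof. by rewrite mulr_ge0 // divr_ge0 ?harm_ge0 // exprn_ge0. Qed.

Lemma sum_free_ev_lt b m n : (0 < m)%N -> (0 < n)%N ->
  \sum_(j < n) (gap_level b m n - free_ev b m j)^-1 <= gapsum m n.
Proof.
move=> m0 n0; have [p [pE pE']] := double_pred m0.
rewrite /gapsum /gap_level /free_ev pE' pE; apply: gap_sum_below => //.
  exact: theta_ge0.
exact: theta_le.
Qed.

Lemma sum_free_ev_gt b m n N : (0 < m)%N -> (0 < n)%N ->
  \sum_(n <= j < N) (free_ev b m j - gap_level b m n)^-1 <= gapsum m n.
Proof.
move=> m0 n0; have [p [pE pE']] := double_pred m0.
rewrite /gapsum /gap_level /free_ev pE' pE; apply: gap_sum_above => //.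
  exact: theta_ge0.
exact: theta_le.
Qed.

Lemma kappa_gt0 (M : R) : 0 < kappa M.
Proof.
rewrite mulr_gt0 ?divr_gt0 ?pi_gt0 //.
by rewrite ltr_pwDl ?pi_gt0 // sqr_ge0.
Qed.

(** The root subspaces for Re z < T are those of the reduced matrix of size n+1,
    whose whole spectrum lies in that half-plane. *)
Lemma spectrum_count b m (M : R) q lam n : (0 < m)%N -> 0 <= M -> L2ball M q ->
  kappa M * gapsum m n.+1 <= 10^-1 -> is_spectrum (bc_operator b m q) lam ->
  forall k, (1 <= k)%N -> (Re (lam k) < gap_level b m n.+1) = (k <= n.+1)%N.
Proof.
move=> m0 M0 qM small [mono spec]; have [qL _] := qM.
have qi := inL2_cintegrable qL.
have QZD z c d : l1 c -> l1 d -> forall j,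
    potential_coef b q (fun i => z * c i + d i) j =
    z * potential_coef b q c j + potential_coef b q d j.
  by move=> hc hd j; exact: potential_coef_lin.
have Qb c S j : l1bound c S -> cm (potential_coef b q c j) <= kappa M * S.
  exact: potential_coef_bound.
have a_lt k : (k < n.+1)%N -> free_ev b m k < gap_level b m n.+1 by exact: free_ev_lt.
have a_gt j : (n.+1 <= j)%N -> gap_level b m n.+1 < free_ev b m j by exact: free_ev_gt.
have s_lt := sum_free_ev_lt b m0 (ltn0Sn n).
have s_gt N := sum_free_ev_gt b N m0 (ltn0Sn n).
have k0 := kappa_gt0 M; have e0 := gapsum_ge0 m n.+1.
pose B := reduced_mx (potential_coef b q) (free_ev b m) n.+1.
pose E u x := sine_series b (graph_emb (potential_coef b q) (free_ev b m) (n := n.+1) u) x.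
have el1 u : l1 (graph_emb (potential_coef b q) (free_ev b m) (n := n.+1) u).
  exact: (graph_emb_l1 QZD Qb a_lt a_gt s_lt s_gt k0 e0 small).
apply: (@count_spectrum _ _ _ B) => // [z /eigenvalueP [u uB u0]|z zT].
  exact: (reduced_mx_eigenvalue QZD Qb a_lt a_gt s_lt s_gt k0 e0 small uB u0).
have [d [hdim hcard]] := spec z.
suff <- : d = \rank (geigenspace B z) by [].
apply: (has_dim_rank (E := E)) hdim.
- move=> w u v x _; rewrite /E -sine_series_lin //; congr (sine_series b _ x).
  by apply/funext => j; rewrite graph_emb_lin.
- move=> u u0; apply/rowP => j; rewrite mxE.
  rewrite -(graph_emb_lt (potential_coef b q) (free_ev b m) u j) -(sine_coef_series b j (el1 u)).
  rewrite (@eq_sine_coef _ b j (sine_series b _) (sine_series b (fun=> 0))).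
    by rewrite sine_coef_series //; exact: l1_zero.
  by move=> x xJ; rewrite sine_series0; exact: u0.
move=> y; split.
  move=> [k /(ker_pow_seq b z k y m0 qL) [c [hc yE ck]]].
  have [u [cu uB]] := seq_ker_pow_graph QZD Qb a_lt a_gt s_lt s_gt k0 e0 small zT hc ck.
  exists u; split; first exact: pow_geigenspace uB.
  by move=> x xJ; rewrite yE // /E; congr (sine_series b _ x); apply/funext.
move=> [u [uW yE]]; exists n.+1.
apply/(ker_pow_seq b z n.+1 y m0 qL).
exists (graph_emb (potential_coef b q) (free_ev b m) (n := n.+1) u); split => //.
apply: (graph_seq_ker_pow QZD Qb a_lt a_gt s_lt s_gt k0 e0 small).
by apply/sub_kermxP; rewrite -geigenspaceE.
Qed.

End Assembly.
Arguments gap_level {R} b m n.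

(** * Asymptotics of the eigenfunctions *)

Section Eigenfunction.
Variable R : realType.
Local Notation mu := (@lebesgue_measure R).
Local Notation cm := (@cmodulus R).
Local Notation C := R[i].
Local Notation Re := complex.Re.
Local Notation Im := complex.Im.
Local Notation O := (`]0, (pi : R)[%classic : set (measurableTypeR R)).
Local Notation itg f := (mu.-integrable `[0, (pi : R)]%classic (EFin \o f)).
Implicit Types (f g y q : R -> C) (x : R) (b : bool) (c d : nat -> C).

(** Iterating the self-improving bound from S gives the bounds 2 A + S / 2^k. *)
Lemma l1_contract c (A S : R) : 0 <= A ->
  (forall S, l1bound c S -> l1bound c (A + S / 2)) -> l1bound c S ->
  l1bound c (2 * A).
Proof.
move=> A0 h hS N; apply: le_eps => e e0.
have [k hk] := half_pow_small S e0.
suff : l1bound c (2 * A + S * 2^-1 ^+ k).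
  by move=> /(_ N) /le_trans; apply; rewrite addrC lerD2r.
elim: k {hk} => [|k IH].
  by rewrite expr0 mulr1; apply: l1bound_le hS _; rewrite lerDr mulr_ge0.
rewrite (_ : 2 * A + S * _ = A + (2 * A + S * 2^-1 ^+ k) / 2); first exact: h.
by rewrite exprS; field.
Qed.

Definition zeroed c (j0 j : nat) : C := if j == j0 then 0 else c j.

Lemma sine_series_zeroed b c j0 x : l1 c ->
  sine_series b c x - c j0 * (sine b j0 x)%:C%C = sine_series b (zeroed c j0) x.
Proof.
move=> hc; have [d [d0 hd]] := l1_tail hc.
have hd' N N' : (N <= N')%N -> \sum_(N <= i < N') cm (zeroed c j0 i) <= d N.
  move=> NN; apply: le_trans (hd _ _ NN); apply: ler_sum => i _.
  by rewrite /zeroed; case: eqP => // _; rewrite cm0 cm_ge0.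
apply/eqP; rewrite -subr_eq0; apply/eqP; apply: cm_eq_small => e e0.
have e4 : 0 < e / 4 by rewrite divr_gt0.
have /cvgrPdist_lt /(_ _ e4) [N0 _ hN] := d0.
pose N := maxn N0 j0.+1.
have dN : d N < e / 4.
  have := hN N (leq_maxl _ _); rewrite /= sub0r normrN; exact: le_lt_trans (ler_norm _).
have j0N : (j0 < N)%N by rewrite leq_maxr.
have h1 := csum_dist d0 hd (fun j => sineC_le1 b j x) N.
have h2 := csum_dist d0 hd' (fun j => sineC_le1 b j x) N.
have E : \sum_(i < N) c i * (sine b i x)%:C%C = c j0 * (sine b j0 x)%:C%C +
    \sum_(i < N) zeroed c j0 i * (sine b i x)%:C%C.
  rewrite (bigD1 (Ordinal j0N)) //= [X in _ = _ + X](bigD1 (Ordinal j0N)) //=.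
  rewrite {1}/zeroed eqxx mul0r add0r; congr (_ + _); apply: eq_bigr => i ij.
  by rewrite /zeroed (_ : (i == j0 :> nat) = false) //; apply: negbTE.
have -> : sine_series b c x - c j0 * (sine b j0 x)%:C%C - sine_series b (zeroed c j0) x =
  (sine_series b c x - \sum_(i < N) c i * (sine b i x)%:C%C) -
  (sine_series b (zeroed c j0) x - \sum_(i < N) zeroed c j0 i * (sine b i x)%:C%C).
  by rewrite E; ring.
apply: (le_trans (cmB _ _)); apply: (le_trans (lerD h1 h2)); move: dN; lra.
Qed.

(** For j <> n the equation gives |c j| = |(Q c) j| / |a j - z|, and the real
    part of z lies between the gap levels on both sides of the free
    eigenvalue of index n. *)
Lemma eig_tail b m n (M : R) q z c S : (0 < m)%N -> (0 < n)%N -> 0 <= M ->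
  L2ball M q -> gap_level b m n <= Re z -> Re z < gap_level b m n.+1 -> l1bound c S ->
  (forall j, (free_ev b m j)%:C%C * c j + potential_coef b q c j = z * c j) ->
  l1bound (zeroed c n) (kappa M * (gapsum R m n + gapsum R m n.+1) * S).
Proof.
move=> m0 n0 M0 qM zl zr hS rel N; have S0 := l1bound_ge0 hS.
have kS : 0 <= kappa M * S by rewrite mulr_ge0 // ltW // kappa_gt0.
(* The reciprocal of a lower bound of |a j - z|, with the index n left out. *)
pose w (j : nat) : R := if (j < n)%N then (gap_level b m n - free_ev b m j)^-1 else
  if j == n then 0 else (free_ev b m j - gap_level b m n.+1)^-1.
have w0 j : 0 <= w j.
  rewrite /w; case: ltnP => [jn|]; first by rewrite invr_ge0 subr_ge0 ltW // free_ev_lt.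
  rewrite leq_eqVlt eq_sym; case: eqP => //= _ nj.
  by rewrite invr_ge0 subr_ge0 ltW // free_ev_gt.
have key j (t : R) : 0 < t -> t <= `|free_ev b m j - Re z| -> cm (c j) <= kappa M * S * t^-1.
  move=> t0 tz; rewrite ler_pdivlMr //; apply: le_trans (potential_coef_bound b j M0 qM hS).
  have -> : potential_coef b q c j = (z - (free_ev b m j)%:C%C) * c j by rewrite mulrBl -rel; ring.
  rewrite cmM mulrC ler_wpM2r ?cm_ge0 //; apply: (le_trans tz).
  by rewrite distrC; apply: le_trans (cm_Re _); rewrite ReD ReN.
have hw j : cm (zeroed c n j) <= kappa M * S * w j.
  rewrite /zeroed /w; case: ltnP => [jn|].
    rewrite (_ : (j == n) = false); last by apply/negbTE; rewrite neq_ltn jn.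
    apply: key; first by rewrite subr_gt0 free_ev_lt.
    by rewrite distrC; apply: le_trans (ler_norm _); rewrite lerD2r.
  rewrite leq_eqVlt eq_sym; case: eqP => /= [_ _|_ nj]; first by rewrite cm0 mulr0.
  apply: key; first by rewrite subr_gt0 free_ev_gt.
  by apply: le_trans (ler_norm _); rewrite lerD2l lerN2 ltW.
apply: (@le_trans _ _ (\sum_(i < N) kappa M * S * w i)); first by apply: ler_sum.
rewrite -mulr_sumr [leRHS]mulrAC ler_wpM2l //.
apply: (@le_trans _ _ (\sum_(0 <= i < maxn N n.+1) w i)).
  rewrite -(big_mkord xpredT w) [leRHS](big_cat_nat (leq0n N) (leq_maxl _ _)) /=.
  by rewrite lerDl sumr_ge0.
have nN : (n.+1 <= maxn N n.+1)%N by rewrite leq_maxr.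
rewrite (big_cat_nat (leq0n n.+1) nN) /= big_nat_recr //=.
have -> : w n = 0 by rewrite /w ltnn eqxx.
rewrite addr0; apply: lerD.
  rewrite big_mkord; apply: le_trans (@sum_free_ev_lt R b m n m0 n0).
  by apply: ler_sum => i _; rewrite /w ltn_ord.
apply: le_trans (@sum_free_ev_gt R b m n.+1 (maxn N n.+1) m0 (ltn0Sn n)).
rewrite !big_nat; apply: ler_sum => i /andP[ni _].
by rewrite /w ltnNge (ltnW ni) /= gtn_eqF.
Qed.

(** The normalizing constant of the free eigenfunctions. *)
Definition amplitude : R := Num.sqrt (2 / pi).

Lemma amplitude_gt0 : 0 < amplitude.
Proof. by rewrite sqrtr_gt0 divr_gt0 // pi_gt0. Qed.
Lemma amplitude_sqr : amplitude ^+ 2 = 2 / pi.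
Proof. by rewrite sqr_sqrtr // divr_ge0 // pi_ge0. Qed.

Lemma L2inner_sine b n y : cintegrable `[0, pi] y ->
  L2inner y (toC (fun x => amplitude * sine b n x)) = (amplitude * (pi / 2))%:C%C * sine_coef b n y.
Proof.
move=> [yr yi].
have pn : (pi : R) != 0 by rewrite gt_eqF // pi_gt0.
have mi (h : R -> R) : itg h -> itg (fun x => h x * sine b n x).
  by move=> hi; apply: mul_cont_itg => //; exact: sine_cont.
have key (u : R -> R) : itg u -> \int[mu]_(x in `]0, pi[) (amplitude * (u x * sine b n x)) =
    amplitude * (pi / 2) * (2 / pi * \int[mu]_(x in `[0, pi]) (u x * sine b n x)).
  move=> iu; rewrite Rint_OJ; last by apply: itg_scale => //; exact: mi.
  rewrite RintegralZl ?mi //; move: (pi : R) pn (\int[mu]_(x in _) _) => p pn I.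
  by field.
have -> : L2inner y (toC (fun x => amplitude * sine b n x)) =
    cintegral `]0, pi[ (fun x => (amplitude * sine b n x)%:C%C * y x).
  rewrite /L2inner; congr cintegral; apply/funext => x.
  by rewrite /toC conjc_real mulrC.
rewrite /cintegral; apply: eq_complex_parts; rewrite ?Re_realM ?Im_realM.
  rewrite -[RHS]key //; apply: eq_Rintegral => x _; rewrite Re_realM; ring.
rewrite -[RHS]key //; apply: eq_Rintegral => x _; rewrite Im_realM; ring.
Qed.

(** With A = kappa 1 a bound on all coefficients of a function of norm 1, the
    tail contributes 2 A, and the error on the main coefficient contributes
    3 A pi times the tail, scaled by the amplitude. *)
Definition eigenfunction_const : R := 2 * kappa 1 * (1 + amplitude * (3 * kappa 1 * pi)).

Lemma eigenfunction_const_gt0 : 0 < eigenfunction_const.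
Proof.
have k1 := kappa_gt0 (1 : R).
apply: mulr_gt0; first exact: mulr_gt0.
apply: ltr_pwDl => //; apply: mulr_ge0; first exact: ltW amplitude_gt0.
by apply: mulr_ge0 (pi_ge0 R); apply: mulr_ge0 (ltW k1).
Qed.

(** The coefficients of index other than n have moduli of sum at most Rr =
    O(eps), so y is uniformly within Rr of c n times the mode of index n.
    The sign convention makes c n a nonnegative real r, and comparing square
    norms gives |1 - r^2 pi / 2| = O(Rr), that is, r is within O(Rr) of the
    amplitude. *)
Lemma eigenfunction_bound b m n (M : R) q z y : (0 < m)%N -> (0 < n)%N -> 0 <= M ->
  L2ball M q -> gap_level b m n <= Re z -> Re z < gap_level b m n.+1 ->
  kappa M * (gapsum R m n + gapsum R m n.+1) <= 2^-1 ->
  normalized_eigenfunction (bc_operator b m q) z (toC (fun x => amplitude * sine b n x)) y ->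
  forall x, x \in `[0, (pi : R)] ->
  cm (y x - (amplitude * sine b n x)%:C%C) <=
    eigenfunction_const * (kappa M * (gapsum R m n + gapsum R m n.+1)).
Proof.
move=> m0 n0 M0 qM zl zr; set eps := kappa M * _ => small [Ly y1 yg].
have [qL _] := qM.
have eps0 : 0 <= eps by rewrite mulr_ge0 ?addr_ge0 ?gapsum_ge0 // ltW // kappa_gt0.
have [] := op_coef m0 qL Ly; set c := fun j => sine_coef b j y => hc yE rel.
have OJ x : x \in `]0, (pi : R)[ -> x \in `[0, (pi : R)] by exact: subset_itv_oo_cc.
have [mr mi] := sine_series_measurable b hc.
have yL : inL2 y.
  split; last by rewrite y1 ltry.
  split.
    apply: (eq_measurable_fun (fun x => Re (sine_series b c x))).
      by move=> x /set_mem /= /OJ xJ; rewrite yE.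
    by apply: measurable_funS mr => //; exact: OsubJ.
  apply: (eq_measurable_fun (fun x => Im (sine_series b c x))).
    by move=> x /set_mem /= /OJ xJ; rewrite yE.
  by apply: measurable_funS mi => //; exact: OsubJ.
have yi := inL2_cintegrable yL.
have yB : L2ball 1 y by split => //; rewrite y1.
have p0 := pi_gt0 R.
have k1 := kappa_gt0 (1 : R).
have cA j : cm (c j) <= kappa 1.
  apply: (le_trans (sine_coef_bound b j yi (itg_cm_half yL) _)).
    by move=> x _; exact: cm_half.
  rewrite (_ : kappa 1 = 4 / pi * ((pi + 1 ^+ 2) / 2)).
    by rewrite ler_wpM2l ?divr_ge0 ?pi_ge0 //; exact: L2_half_int.
  have pn : (pi : R) != 0 by rewrite gt_eqF.
  by rewrite /kappa; move: (pi : R) pn => p pn; field.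
have relz j : (free_ev b m j)%:C%C * c j + potential_coef b q c j = z * c j.
  rewrite rel -[RHS]addr0 -(sine_coef_series b j (l1_zero R)) -sine_coef_lin //;
    last exact: (sine_series_cintegrable b (l1_zero R)).
  by apply: eq_sine_coef => x _; rewrite sine_series0 addr0.
have [S hS] := hc.
(* Splitting off the coefficient of index n, any bound S on the sum of moduli improves to
   kappa 1 + eps * S, and eps <= 1/2. *)
have hc2 : l1bound c (2 * kappa 1).
  apply: l1_contract hS; first exact: ltW.
  move=> {}S hS; have S0 := l1bound_ge0 hS.
  have ht := eig_tail m0 n0 M0 qM zl zr hS relz.
  have h1 : l1bound (fun j => if j == n then c n else 0) (kappa 1).
    move=> N; apply: le_trans (cA n).
    rewrite (eq_bigr (fun i : 'I_N => if (i == n :> nat) then cm (c n) else 0)); last first.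
      by move=> i _; case: eqP => // _; rewrite cm0.
    rewrite -big_mkcond /=; have [nN|Nn] := ltnP n N.
      by rewrite (big_pred1 (Ordinal nN)).
    by rewrite big1 ?cm_ge0 // => i /eqP E; have := ltn_ord i; rewrite E ltnNge Nn.
  have := l1boundD h1 ht; rewrite -/eps => h2.
  apply: l1bound_le (l1bound_mono _ h2) _.
    by move=> i; rewrite /zeroed; case: eqP => [->|_]; rewrite ?addr0 ?add0r.
  by rewrite lerD2l mulrC ler_wpM2l.
set A := kappa 1 in k1 cA hc2 *.
pose Rr := eps * (2 * A).
have Rr0 : 0 <= Rr by rewrite mulr_ge0 // mulr_ge0 // ltW.
have RrA : Rr <= A.
  rewrite /Rr; apply: (@le_trans _ _ (2^-1 * (2 * A))); last by lra.
  by rewrite ler_wpM2r // mulr_ge0 // ltW.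
have close x : x \in `[0, (pi : R)] -> cm (y x - c n * (sine b n x)%:C%C) <= Rr.
  move=> xJ; rewrite yE // sine_series_zeroed //; apply: sine_series_bound.
  exact: (eig_tail m0 n0 M0 qM zl zr hc2 relz).
have ap := amplitude_gt0.
have [cIm cRe] : Im (c n) = 0 /\ 0 <= Re (c n).
  move: yg; rewrite L2inner_sine // -/(c n) lecE Re_realM Im_realM /=.
  have h0 : 0 < amplitude * (pi / 2) by rewrite mulr_gt0 // divr_gt0.
  by rewrite mulf_eq0 gt_eqF //= pmulr_rge0 // => /andP[/eqP].
pose r := Re (c n).
have cE : c n = r%:C%C by apply: eq_complex_parts.
have rA : r <= A.
  by apply: le_trans (cA n); rewrite cE cm_real ler_norm.
have r0 : 0 <= r by [].
pose dl := Rr * (2 * r + Rr).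
(* Two moduli at distance at most Rr, of sum at most 2 r + Rr. *)
have sq x : x \in `[0, (pi : R)] -> `|cm (y x) ^+ 2 - (r ^+ 2 * (sine b n x * sine b n x))| <= dl.
  move=> xJ; have h := close x xJ; rewrite cE -rmorphM /= in h.
  set v := `|r * sine b n x|.
  have -> : r ^+ 2 * (sine b n x * sine b n x) = v ^+ 2.
    by rewrite /v real_normK ?num_real //; ring.
  have v0 : 0 <= v by exact: normr_ge0.
  have vr : v <= r by rewrite /v normrM (ger0_norm r0) ler_piMr ?sine_le1.
  have u0 := cm_ge0 (y x).
  have uv : cm (y x) <= v + Rr.
    rewrite -(subrK (r * sine b n x)%:C%C (y x)); apply: (le_trans (cmD _ _)).
    by rewrite cm_real addrC lerD2l.
  have vu : v <= cm (y x) + Rr.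
    rewrite /v -cm_real -[X in cm X](subrK (y x)) addrC; apply: (le_trans (cmD _ _)).
    by rewrite lerD2l -cmN opprB.
  rewrite subr_sqr normrM (ger0_norm (addr_ge0 u0 v0)); apply: ler_pM => //.
  - exact: addr_ge0.
  - by rewrite ler_norml; lra.
  - lra.
have i2 := L2_sq_itg yL.
have is2 : itg (fun x => sine b n x * sine b n x).
  apply: mul_cont_itg; last exact: sine_cont.
  by apply: cont_itg; apply: continuous_subspaceT; exact: sine_cont.
have nrm : `|1 - r ^+ 2 * (pi / 2)| <= dl * pi.
  have E1 := L2_unit_int yL y1.
  have E2 : \int[mu]_(x in `[0, pi]) (sine b n x * sine b n x) = pi / 2.
    by rewrite sine_orthogonal eqxx.
  have -> : 1 - r ^+ 2 * (pi / 2) = \int[mu]_(x in `[0, pi]) (cm (y x) ^+ 2) -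
      r ^+ 2 * \int[mu]_(x in `[0, pi]) (sine b n x * sine b n x) by rewrite E1 E2.
  rewrite -RintegralZl // -RintegralB //; last exact: itg_scale.
  rewrite -Rint_cst_J.
  have ig : itg (fun x => cm (y x) ^+ 2 - r ^+ 2 * (sine b n x * sine b n x)).
    by apply: itg_sub => //; exact: itg_scale.
  exact: (Rint_le_bound _ ig (itg_cst dl) sq).
have dlA : dl <= Rr * (3 * A) by rewrite /dl ler_wpM2l //; lra.
have ra : `|r - amplitude| <= amplitude * (Rr * (3 * A) * pi).
  pose t := r / amplitude.
  have t0 : 0 <= t by rewrite divr_ge0 // ltW.
  have rt : r = amplitude * t by rewrite /t mulrC divfK // gt_eqF.
  have t2 : r ^+ 2 * (pi / 2) = t ^+ 2.
    rewrite rt exprMn amplitude_sqr; have : (pi : R) != 0 by rewrite gt_eqF.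
    by move: (pi : R) (t) => p u pn; field.
  rewrite rt -[X in _ - X]mulr1 -mulrBr normrM (ger0_norm (ltW ap)) ler_wpM2l ?(ltW ap) //.
  apply: (@le_trans _ _ (dl * pi)); last by rewrite ler_wpM2r ?pi_ge0.
  apply: le_trans nrm; rewrite t2 distrC -[1 in leRHS](expr1n _ 2) subr_sqr normrM.
  by rewrite ler_peMr // ger0_norm ?addr_ge0 // lerDl.
move=> x xJ.
have -> : y x - (amplitude * sine b n x)%:C%C =
    (y x - c n * (sine b n x)%:C%C) + ((r - amplitude) * sine b n x)%:C%C.
  by rewrite cE; move: (r) (sine b n x) => r1 s1; rewrite !rmorphM /= rmorphB /=; ring.
apply: (le_trans (cmD _ _)); rewrite cm_real normrM.
apply: (@le_trans _ _ (Rr + amplitude * (Rr * (3 * A) * pi))).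
  apply: lerD; first exact: close.
  by apply: le_trans ra; rewrite ler_piMr // sine_le1.
by rewrite /eigenfunction_const -/A /Rr le_eqVlt; apply/orP; left; apply/eqP; ring.
Qed.

Lemma gapsum_le_ln m n : (1 < n)%N ->
  gapsum R m n + gapsum R m n.+1 <=
  12 * (2 ^+ (2 * m - 1) + 1) * (ln n.+1%:R / n.+1%:R ^+ (2 * m - 1)).
Proof.
move=> n1; set p := (2 * m - 1)%N.
have n0 : (0 : R) < n%:R by rewrite ltr0n ltnW.
have n0' : (0 : R) < n.+1%:R by [].
set H := harm R n.+1.
have H0 : 0 <= H by exact: harm_ge0.
have HL : H <= 3 * ln n.+1%:R by apply: harm_le_ln; exact: ltnW.
have h1 : harm R n / n%:R ^+ p <= H * (2 ^+ p / n.+1%:R ^+ p).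
  apply: ler_pM; rewrite ?harm_ge0 ?invr_ge0 ?exprn_ge0 ?harm_mono //.
  have -> : 2 ^+ p / n.+1%:R ^+ p = ((n.+1%:R / 2) ^+ p)^-1 :> R.
    by rewrite expr_div_n invf_div.
  apply: ler_inv; first by rewrite exprn_gt0 // divr_gt0.
  apply: ler_exp; first by rewrite divr_ge0.
  by rewrite ler_pdivrMr // -natrM ler_nat; lia.
rewrite /gapsum -/p -/H -mulrDr.
apply: (@le_trans _ _ (4 * (H * ((2 ^+ p + 1) / n.+1%:R ^+ p)))).
  by rewrite ler_wpM2l // mulrDl mul1r mulrDr lerD2r.
rewrite (_ : 12 * _ * _ = 4 * ((3 * ln n.+1%:R) * ((2 ^+ p + 1) / n.+1%:R ^+ p))).
  rewrite ler_wpM2l // ler_wpM2r // divr_ge0 ?addr_ge0 ?exprn_ge0 //.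
by ring.
Qed.

Lemma gapsum_small m (e : R) : (0 < m)%N -> 0 < e ->
  exists N, forall n, (N <= n)%N -> gapsum R m n <= e.
Proof.
move=> m0 e0; have [p [_ pE]] := double_pred m0.
have e4 : 0 < e / 4 by rewrite divr_gt0.
have [N hN] := harm_over_small p e4; exists N => n Nn.
rewrite /gapsum pE mulrC -ler_pdivlMr //; exact: hN.
Qed.

Lemma phi0_sine n : (0 < n)%N -> toC (@phi0 R n) = toC (fun x => amplitude * sine false n.-1 x).
Proof.
move=> n0; apply/funext => x; rewrite /toC /phi0 /sine /omega /freq /theta /=.
by rewrite prednK // subr0.
Qed.

Lemma psi0_sine n : (0 < n)%N -> toC (@psi0 R n) = toC (fun x => amplitude * sine true n.-1 x).
Proof.
move=> n0; apply/funext => x; rewrite /toC /psi0 /sine /omega /freq /theta /=.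
by rewrite prednK.
Qed.

(** Beyond some index the smallness condition holds at both gap levels n-1 and
    n. Counting below each of them places Re (lam n) between the two. *)
Lemma eigenfunction_asymptotics b m (M : R) : (0 < m)%N -> 0 < M ->
  exists P1 : nat, forall n, (P1 < n)%N -> forall q, L2ball M q ->
  forall lam, is_spectrum (bc_operator b m q) lam -> forall y,
  normalized_eigenfunction (bc_operator b m q) (lam n)
    (toC (fun x => amplitude * sine b n.-1 x)) y ->
  (sup_dist y (toC (fun x => (amplitude * sine b n.-1 x)%R)) <=
    (eigenfunction_const * kappa M * (12 * (2 ^+ (2 * m - 1) + 1)) *
      (ln n%:R / n%:R ^+ (2 * m - 1)))%:E)%E.
Proof.
move=> m0 M0; have k0 := kappa_gt0 M.
have [|N hN] := @gapsum_small m (10^-1 / kappa M) m0; first by rewrite divr_gt0 // invr_gt0.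
have small n : (N <= n)%N -> kappa M * gapsum R m n <= 10^-1.
  by move=> /hN; rewrite ler_pdivlMr // mulrC.
exists (N + 2)%N => n Nn q qM lam sp y hy.
case: n => [|[|n]] // in Nn hy *; try lia.
have Nn1 : (N <= n.+1)%N by lia.
have lamn := spectrum_count m0 (ltW M0) qM (small _ Nn1) sp.
have Nn2 : (N <= n.+2)%N by lia.
have lamn' := spectrum_count m0 (ltW M0) qM (small _ Nn2) sp.
have zl : gap_level b m n.+1 <= complex.Re (lam n.+2) by rewrite leNgt lamn // ltnn.
have zr : complex.Re (lam n.+2) < gap_level b m n.+2 by rewrite lamn'.
have sm : kappa M * (gapsum R m n.+1 + gapsum R m n.+2) <= 2^-1.
  by rewrite mulrDr; apply: (le_trans (lerD (small _ Nn1) (small _ Nn2))); lra.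
have hb := eigenfunction_bound m0 (ltn0Sn n) (ltW M0) qM zl zr sm hy.
apply: ge_ereal_sup => _ [x xJ <-]; rewrite lee_fin; apply: (le_trans (hb x xJ)).
rewrite -2!mulrA ler_wpM2l ?(ltW eigenfunction_const_gt0) // ler_wpM2l ?(ltW k0) //.
by apply: gapsum_le_ln; lia.
Qed.

End Eigenfunction.

Theorem theorem3p5 (R : realType) (m : nat) (hm : (1 <= m)%N)
    (M : R) (hM : 0 < M) :
  exists (P1 : nat) (C : R), (0 < P1)%N /\ 0 < C /\
  forall q : R -> R[i], L2ball M q ->
    (forall lam : nat -> R[i], is_spectrum (L1 m q) lam ->
     forall n : nat, (P1 < n)%N ->
     forall phi : R -> R[i],
       normalized_eigenfunction (L1 m q) (lam n) (toC (phi0 n)) phi ->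
       (sup_dist phi (toC (phi0 n))
          <= (C * (ln n%:R / n%:R ^+ (2 * m - 1)))%:E)%E) /\
    (forall mu : nat -> R[i], is_spectrum (L2 m q) mu ->
     forall n : nat, (P1 < n)%N ->
     forall psi : R -> R[i],
       normalized_eigenfunction (L2 m q) (mu n) (toC (psi0 n)) psi ->
       (sup_dist psi (toC (psi0 n))
          <= (C * (ln n%:R / n%:R ^+ (2 * m - 1)))%:E)%E).
Proof.
have [N1 h1] := eigenfunction_asymptotics false hm hM.
have [N2 h2] := eigenfunction_asymptotics true hm hM.
exists (maxn N1 N2).+1, (eigenfunction_const R * kappa M * (12 * (2 ^+ (2 * m - 1) + 1))).
split => //; split.
  apply: mulr_gt0; first by rewrite mulr_gt0 ?eigenfunction_const_gt0 ?kappa_gt0.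
  by rewrite mulr_gt0 // ltr_wpDl // exprn_ge0.
move=> q qM; split=> [lam sp n Pn y|mu sp n Pn y].
  have n0 : (0 < n)%N by apply: leq_ltn_trans Pn.
  rewrite phi0_sine //; apply: h1 => //.
  by apply: leq_ltn_trans Pn; rewrite leqW // leq_maxl.
have n0 : (0 < n)%N by apply: leq_ltn_trans Pn.
rewrite psi0_sine //; apply: h2 => //.
by apply: leq_ltn_trans Pn; rewrite leqW // leq_maxr.
Qed.
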